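(* Let $T$ and $T'$ be two contractions on a complex Hilbert space $\mathcal{H}$ such that $T$ is Harnack dominated by $T'$. (i) If $T$ is completely nonunitary then $T'$ is also completely nonunitary. (ii) $T$ is absolutely continuous if and only if $T'$ is absolutely continuous. (iii) $T$ belongs to the class $C_{0\cdot}$, $C_{\cdot 0}$, or $C_{00}$ if and only if $T'$ belongs to the same class, respectively. (iv) The sequence $\{T^n\}$ is strongly convergent if and only if $\{T'^n\}$ is strongly convergent. (v) $T$ is weakly stable if and only if $T'$ is weakly stable. (vi) The sequence $\{T^n\}$ is weakly convergent if and only if $\{T'^n\}$ is weakly convergent.
   Context: A contraction on $\mathcal{H}$ is a bounded linear operator of norm at most $1$. For contractions $T,T'$ on $\mathcal{H}$, $T$ is Harnack dominated by $T'$ if there is a constant $c\ge 1$ such that $\operatorname{Re} p(T)\le c\,\operatorname{Re} p(T')$ for every analytic polynomial $p$ with $\operatorname{Re} p(z)\ge 0$ for all $|z|\le 1$; here $\operatorname{Re} A=\frac12(A+A^* )$ for an operator $A$. A contraction is completely nonunitary if it has no nonzero reducing subspace on which it is unitary. For a contraction $T$ there is a unique semi-spectral measure $F_T$ on the unit circle $\mathbb{T}$ (a map from the Borel subsets of $\mathbb{T}$ into the bounded operators on $\mathcal{H}$ such that $\sigma\mapsto\langle F_T(\sigma)h,h\rangle$ is a positive measure for each $h$) with $\langle p(T)h,k\rangle=\int_{\mathbb{T}}p\,d\langle F_T h,k\rangle$ for all $h,k\in\mathcal{H}$ and all trigonometric polynomials $p$, where in $p(T)$ the function $\zeta^n$ is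 replaced by $T^n$ if $n\ge 0$ and by $T^{*|n|}$ if $n<0$. The contraction $T$ is absolutely continuous if $F_T$ is absolutely continuous with respect to Lebesgue measure on $\mathbb{T}$; equivalently, $T$ has no nonzero reducing subspace on which it is a singular unitary operator (a unitary operator whose spectral measure is singular with respect to Lebesgue measure). $T$ is strongly (weakly) stable if $\{T^n\}$ converges to $0$ in the strong (weak) operator topology. $T$ is of class $C_{0\cdot}$ if $T$ is strongly stable, of class $C_{\cdot 0}$ if $T^*$ is strongly stable, and of class $C_{00}$ if both hold. Strong and weak convergence of $\{T^n\}$ refer to the strong and weak operator topologies. *)

(* Defs.v *)
From HB Require Import structures.
From mathcomp Require Import all_boot all_order all_algebra.
From mathcomp Require Import complex.
From mathcomp Require Import all_classical all_reals all_analysis.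

Set Implicit Arguments.
Unset Strict Implicit.
Unset Printing Implicit Defensive.

Import Order.TTheory GRing.Theory Num.Theory.
Import numFieldNormedType.Exports.

Local Open Scope classical_set_scope.
Local Open Scope ring_scope.

(* The inner product is linear in its first and antilinear in its second
   argument. On R[i], [0 <= z] means that z is real and nonnegative. *)
HB.mixin Record NormedModule_isHilbert (R : realType) (H : Type)
    & CompleteNormedModule R[i] H := {
  hdot : {dot H for (@Num.conj R[i])};
  hdotE : forall x : H, hdot x x = `|x| ^+ 2
}.

#[short(type="hilbertType")]
HB.structure Definition Hilbert (R : realType) :=
  {H of CompleteNormedModule R[i] H & NormedModule_isHilbert R H}.

Section Operators.
Context {R : realType} {H : hilbertType R}.
Implicit Types (T A B : H -> H) (p : {poly R[i]}) (M : set H).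

Definition bounded_op A :=
  exists c : R, forall x : H, `|A x| <= c%:C%C * `|x|.

Definition contraction_op T := forall x : H, `|T x| <= `|x|.

(* For a bounded linear A the vector z exists (Riesz representation) and is
   unique, so the default value 0 is irrelevant. *)
Definition adj A : H -> H :=
  fun y => xget 0 [set z : H | forall x, hdot (A x) y = hdot x z].

Definition re_op A : H -> H := fun x => 2^-1 *: (A x + adj A x).

Definition le_op A B := forall x : H, 0 <= hdot (B x - A x) x.

Definition poly_op p T : H -> H :=
  fun x => \sum_(i < size p) p`_i *: iter i T x.

Definition harnack_dominated T T' :=
  exists2 c : R, 1 <= c &
    forall p, (forall z : R[i], `|z| <= 1 -> 0 <= complex.Re p.[z]) ->
      le_op (re_op (poly_op p T)) (fun x => c%:C%C *: re_op (poly_op p T') x).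

Definition closed_subspace M :=
  [/\ closed M, M 0 & forall (a : R[i]) x y, M x -> M y -> M (a *: x + y)].

Definition orthocomplement M : set H :=
  [set y | forall x, M x -> hdot x y = 0].

Definition reducing T M :=
  [/\ closed_subspace M, T @` M `<=` M
    & T @` orthocomplement M `<=` orthocomplement M].

Definition unitary_on T M :=
  T @` M = M /\ (forall x y, M x -> M y -> hdot (T x) (T y) = hdot x y).

Definition completely_nonunitary T :=
  forall M, reducing T M -> unitary_on T M -> M = [set 0].

Definition strongly_stable T :=
  forall h : H, iter n T h @[n --> \oo] --> (0 : H).

Definition weakly_stable T :=
  forall h k : H, hdot (iter n T h) k @[n --> \oo] --> (0 : R[i]^o).

Definition strongly_convergent T :=
  exists A : {linear H -> H}, bounded_op A /\
    forall h : H, iter n T h @[n --> \oo] --> A h.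

Definition weakly_convergent T :=
  exists A : {linear H -> H}, bounded_op A /\
    forall h k : H,
      hdot (iter n T h) k @[n --> \oo] --> (hdot (A h) k : R[i]^o).

Definition class_C0_ T := strongly_stable T.
Definition class_C_0 T := strongly_stable (adj T).
Definition class_C00 T := class_C0_ T /\ class_C_0 T.

End Operators.

Section Circle.
Variable R : realType.

Definition circle : Type := set_type [set z : R[i]^o | `|z| = 1].

Lemma circle1_subproof : (1 : R[i]^o) \in [set z : R[i]^o | `|z| = 1].
Proof. by rewrite inE /= normr1. Qed.

HB.instance Definition _ := Topological.on circle.
HB.instance Definition _ :=
  isPointed.Build circle (exist _ 1 circle1_subproof).

Definition borel_circle := g_sigma_algebraType (@open circle).

Definition arc_length (S : set borel_circle) : \bar R :=
  lebesgue_measure [set t : R | 0 <= t < 2 * pi /\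
    exists2 z : circle, S z & set_val z = (cos t +i* sin t)%C].

End Circle.

Section SemispectralMeasure.
Context {R : realType} {H : hilbertType R}.

(* [I] is the integral of the bounded Borel function [f] against the complex
   measure [nu]: decompose [nu] as m0 + i m1 - m2 - i m3 with finite positive
   measures mj; the value does not depend on the decomposition. *)
Definition cmeasure_integral (nu : set (borel_circle R) -> R[i])
    (f : borel_circle R -> R[i]) (I : R[i]) :=
  exists m : 'I_4 -> {finite_measure set (borel_circle R) -> \bar R},
    (forall S, measurable S -> nu S = \sum_(j < 4) 'i ^+ j * (fine (m j S))%:C%C)
    /\ I = \sum_(j < 4) 'i ^+ j *
         (Rintegral (m j) setT (fun z => complex.Re (f z)) +i*
          Rintegral (m j) setT (fun z => complex.Im (f z)))%C.

(* The trigonometric polynomial with coefficients a_n, -N <= n <= N. *)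
Definition trig_poly (N : nat) (a : int -> R[i]) (z : borel_circle R) : R[i] :=
  \sum_(j < N.*2.+1)
    a (j%:Z - N%:Z) * (set_val (z : circle R) : R[i]) ^ (j%:Z - N%:Z).

(* T^n for n >= 0 and T^*|n| for n < 0. *)
Definition zpow_op (T : H -> H) (n : int) : H -> H :=
  match n with
  | Posz k => iter k T
  | Negz k => iter k.+1 (adj T)
  end.

Definition trig_poly_op (N : nat) (a : int -> R[i]) (T : H -> H) : H -> H :=
  fun h => \sum_(j < N.*2.+1) a (j%:Z - N%:Z) *: zpow_op T (j%:Z - N%:Z) h.

Implicit Type F : set (borel_circle R) -> {linear H -> H}.

(* Only the values of F on Borel sets matter. *)
Definition semispectral F :=
  (forall S, measurable S -> bounded_op (F S)) /\
  (forall h : H, exists m : {finite_measure set (borel_circle R) -> \bar R},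
     forall S, measurable S -> hdot (F S h) h = (fine (m S))%:C%C).

Definition semispectral_measure_of (T : H -> H) F :=
  semispectral F /\
  forall (N : nat) (a : int -> R[i]) (h k : H),
    cmeasure_integral (fun S => hdot (F S h) k) (trig_poly N a)
      (hdot (trig_poly_op N a T h) k).

(* For a contraction T there is exactly one F, up to its values on non-Borel
   sets. *)
Definition absolutely_continuous_op (T : H -> H) :=
  exists2 F, semispectral_measure_of T F &
    forall S, measurable S -> arc_length S = 0%E -> forall h : H, F S h = 0.

End SemispectralMeasure.

(* Main.v *)
From HB Require Import structures.
Require Import Defs.
From mathcomp Require Import all_boot all_order all_algebra cyclic separable cyclotomic.
From mathcomp Require Import complex ring lra zify.
From mathcomp Require Import all_classical all_reals all_analysis.
From mathcomp Require Import measurable_realfun.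

(** A Harnack inequality between [T] and [T'] is an inequality between their
    unitary dilations. Let [U] be the unitary dilation of [T]: it acts on a
    larger Hilbert space, and [<U^n x, y>] is [<T^n x, y>] for [n >= 0] and
    [<T*^(-n) x, y>] for [n < 0]. A finite list of pairs [(n, x)] represents the
    vector [sum U^n x], and [toeplitz] computes inner products of such vectors
    inside [H], so no dilation space has to be constructed. Applied to the
    polynomials whose real part is a rotated Fejer kernel, Harnack domination
    says that the Fejer sums of [c T'^n - T^n] are positive; averaging over
    roots of unity turns this into [|sum U^n x|^2 <= c |sum U'^n x|^2] for every
    list, and into [p(T) <= c p(T')] for every trigonometric polynomial [p]
    that is nonnegative on the circle ([harnack_toeplitz]).

    The inequality for [U^m h - T'^m h] gives
    [|T^m h - T'^m h|^2 <= c (|h|^2 - |T'^m h|^2)] ([power_difference]). So [T]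
    and [T'] coincide wherever [T'] is isometric, and a space that reduces [T']
    to a unitary operator also reduces [T] to a unitary operator, which proves
    (i). As [|T'^n h|] decreases, the same bound, started from [T'^n h] with
    [n] large, shows that every orbit of [T'] ends up following an orbit of [T]
    ([shadowed_dominating]). Conversely the functional [<., h>] on the dilation
    space of [T] is bounded for the norm of the dilation space of [T'], hence
    is represented there, approximately, by a finite sum [sum U'^k x]; this
    makes an orbit of [T] follow an orbit of [T'] ([shadowed_dominated]).
    Strong and weak stability and convergence pass along shadowing. This proves
    (iii)-(vi), the statements on adjoints following because the adjoint merely
    reverses the exponents.

    For (ii), absolute continuity is restated as a property of polynomials:
    [acont T h] says that [<p(T) h, h>] is small when [0 <= p <= 1] on the circle
    and the mean of [p] is small. Absolute continuity of the semi-spectral measure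
    implies it by the Borel-Cantelli lemma ([absolutely_continuous_acont]).
    Conversely, under [acont] the Fejer means [p_M] of an indicator function
    have convergent values [p_M(T) h], because the differences [p_M - p_L] are
    bounded by 1 and small in [L^2]; the limits define the semi-spectral
    measure and show that it is null on null sets
    ([acont_absolutely_continuous]).

    The property passes from [T'] to [T] by [p(T) <= c p(T')]. In the other
    direction, suppose that it fails for [T'] at [h]. A minimising argument
    ([concentration]) yields [q] with [0 <= q <= 1], of arbitrarily small mean,
    with [<q(T') h, h>] bounded below, and concentrated where the spectral
    measure of [U'] at [h] is singular. The orthogonal complement of [H] in the
    dilation space is generated by wandering vectors; finite combinations of
    their translates have bounded spectral densities, so the complement cannot
    carry a singular measure, and [q(U') h] is nearly a vector [g] of [H] ([concentrated_in_space]). The Toeplitz inequality then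
    brings [g] close to [q(U) h], which is small since [acont] holds for [T];
    hence [q(U') h] is small, a contradiction ([acont_dominating]). *)

Set Implicit Arguments.
Unset Strict Implicit.
Unset Printing Implicit Defensive.

Import Order.TTheory GRing.Theory Num.Theory.
Import numFieldNormedType.Exports.

Local Open Scope classical_set_scope.
Local Open Scope ring_scope.

Local Notation Re := complex.Re.
Local Notation Im := complex.Im.

(** * Complex numbers through their real and imaginary parts *)

Section ComplexReal.
Context {R : realType}.
Implicit Types (a b : R[i]) (r : R).

Lemma Re_add a b : Re (a + b) = Re a + Re b.
Proof. by case: a; case: b. Qed.

Lemma Im_add a b : Im (a + b) = Im a + Im b.
Proof. by case: a; case: b. Qed.

Lemma Re_opp a : Re (- a) = - Re a.
Proof. by case: a. Qed.

Lemma Im_opp a : Im (- a) = - Im a.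
Proof. by case: a. Qed.

Lemma Re_mul a b : Re (a * b) = Re a * Re b - Im a * Im b.
Proof. by case: a; case: b. Qed.

Lemma Im_mul a b : Im (a * b) = Re a * Im b + Im a * Re b.
Proof. by case: a => ? ?; case: b => ? ? /=; rewrite addrC. Qed.

Lemma Re_sum I (s : seq I) (P : pred I) (F : I -> R[i]) :
  Re (\sum_(i <- s | P i) F i) = \sum_(i <- s | P i) Re (F i).
Proof. exact: (big_morph _ Re_add). Qed.

Lemma Im_sum I (s : seq I) (P : pred I) (F : I -> R[i]) :
  Im (\sum_(i <- s | P i) F i) = \sum_(i <- s | P i) Im (F i).
Proof. exact: (big_morph _ Im_add). Qed.

Lemma conjE a : Num.conj a = (Re a -i* Im a)%C.
Proof. by case: a. Qed.

Lemma Re_conjC a : Re (Num.conj a) = Re a.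
Proof. by rewrite conjE. Qed.

Lemma Im_conjC a : Im (Num.conj a) = - Im a.
Proof. by rewrite conjE. Qed.

Lemma complex_eq a b : Re a = Re b -> Im a = Im b -> a = b.
Proof. by case: a => ? ?; case: b => ? ? /= -> ->. Qed.

Lemma complex_ge0 a : (0 <= a) = (Im a == 0) && (0 <= Re a).
Proof. by rewrite lecE. Qed.

Definition normsq a : R := Re a ^+ 2 + Im a ^+ 2.

Lemma normsqE a : (normsq a)%:C%C = `|a| ^+ 2.
Proof. exact: add_Re2_Im2. Qed.

Lemma normsq_ge0 a : 0 <= normsq a.
Proof. by rewrite addr_ge0 ?sqr_ge0. Qed.

Lemma normsqM a b : normsq (a * b) = normsq a * normsq b.
Proof. rewrite /normsq Re_mul Im_mul; ring. Qed.

Lemma norm1_normsq a : `|a| = 1 <-> normsq a = 1.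
Proof.
split=> h.
  by apply: (@complexI R); rewrite normsqE h expr1n.
apply/eqP; rewrite -(@eqrXn2 _ 2) //.
by rewrite -normsqE h expr1n.
Qed.

Lemma normle_normsq a r : 0 <= r -> (`|a| <= r%:C%C) = (normsq a <= r ^+ 2).
Proof.
move=> r0; rewrite -(@ler_pXn2r _ 2) ?nnegrE ?normr_ge0 ?ler0c //.
by rewrite -normsqE -rmorphXn lecR.
Qed.

Lemma norm1_inv a : `|a| = 1 -> a^-1 = Num.conj a.
Proof. by move=> h; rewrite invC_norm h expr1n invr1 mul1r. Qed.

Lemma norm1_exprz a (n : int) : `|a| = 1 -> `|a ^ n| = 1.
Proof.
move=> h; case: n => n; first by rewrite -exprnP normrX h expr1n.
by rewrite NegzE -exprnN normfV normrX h expr1n invr1.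
Qed.

Lemma norm1_neq0 a : `|a| = 1 -> a != 0.
Proof. by move=> h; rewrite -normr_gt0 h ltr01. Qed.

Lemma conj_exprz a (n : int) : `|a| = 1 -> Num.conj (a ^ n) = a ^ (- n).
Proof.
by move=> h; rewrite -norm1_inv ?norm1_exprz// invr_expz.
Qed.

End ComplexReal.

(** * Approximate Riesz representation *)

(** A real pre-Hilbert space presented without quotienting by equality of
    vectors, so that formal sums qualify. *)
Record prehilbert (R : realType) (W : Type) := PreHilbert {
  pre_add : W -> W -> W;
  pre_scale : R -> W -> W;
  pre_dot : W -> W -> R;
  pre_dotC : forall x y, pre_dot x y = pre_dot y x;
  pre_dotDl : forall x y z, pre_dot (pre_add x y) z = pre_dot x z + pre_dot y z;
  pre_dotZl : forall r x z, pre_dot (pre_scale r x) z = r * pre_dot x z;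
  pre_dot_ge0 : forall x, 0 <= pre_dot x x
}.

Lemma quadratic_le (R : realFieldType) (a b c : R) : 0 <= c ->
  (forall t, 0 <= c - 2 * t * b + t ^+ 2 * a) -> 0 <= a -> b ^+ 2 <= c * a.
Proof.
move=> c0 h a0.
have [a_eq0|an0] := eqVneq a 0.
  have [->|bn0] := eqVneq b 0; first by rewrite a_eq0; lra.
  have := h ((c + 1) / (2 * b)).
  rewrite a_eq0 mulr0 addr0.
  have -> : 2 * ((c + 1) / (2 * b)) * b = c + 1 by field.
  lra.
have := h (b / a).
have -> : c - 2 * (b / a) * b + (b / a) ^+ 2 * a = (c * a - b ^+ 2) / a by field.
rewrite pmulr_lge0 ?invr_gt0 ?lt_neqAle 1?eq_sym ?an0//.
lra.
Qed.

Section PreHilbertTheory.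
Context {R : realType} {W : Type} (P : prehilbert R W).
Local Notation B := (pre_dot P).
Local Notation N x := (pre_dot P x x).

Lemma pre_dotDr x y z : B z (pre_add P x y) = B z x + B z y.
Proof. by rewrite pre_dotC pre_dotDl !(pre_dotC P _ z). Qed.

Lemma pre_dotZr r x z : B z (pre_scale P r x) = r * B z x.
Proof. by rewrite pre_dotC pre_dotZl (pre_dotC P _ z). Qed.

Lemma pre_dot_CS x y : B x y ^+ 2 <= N x * N y.
Proof.
apply: quadratic_le; rewrite ?pre_dot_ge0// => t.
have := pre_dot_ge0 P (pre_add P x (pre_scale P (- t) y)).
rewrite !(pre_dotDl, pre_dotDr, pre_dotZl, pre_dotZr) (pre_dotC P y x).
congr (_ <= _); ring.
Qed.

(** The near minimiser of [N x - 2 f x] represents [f] up to a small error;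
    completeness would turn it into an exact representative. *)
Lemma approximate_riesz (x0 : W) (f : W -> R) (K : R) :
  (forall x y, f (pre_add P x y) = f x + f y) ->
  (forall r x, f (pre_scale P r x) = r * f x) ->
  0 <= K -> (forall x, f x ^+ 2 <= K * N x) ->
  forall e, 0 < e -> exists x, forall y, (f y - B y x) ^+ 2 <= e * N y.
Proof.
move=> fD fZ K0 fK e e0.
pose J x := N x - 2 * f x.
have Jlb x : - K <= J x.
  rewrite /J.
  have h := fK x; have := pre_dot_ge0 P x; move: h.
  move: (f x) (N x) => u v h v0.
  have : 2 * u <= v + K.
    have [u0|u0] := lerP u 0; first by lra.
    rewrite -(@ler_pXn2r _ 2) ?nnegrE//; [|lra..].
    have := sqr_ge0 (v - K); nra.
  lra.
have hinf : has_inf (range J).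
  split; first by exists (J x0), x0.
  by exists (- K) => _ [x _ <-].
have [_ [x _ <-] Jx] : exists2 z, range J z & z < inf (range J) + e.
  by have [z] := inf_adherent e0 hinf; exists z.
exists x => y.
have Jy t : J x - e <= J (pre_add P x (pre_scale P t y)).
  apply: (@le_trans _ _ (inf (range J))); first by lra.
  by apply: ge_inf; [case: hinf | exists (pre_add P x (pre_scale P t y))].
apply: quadratic_le; rewrite ?pre_dot_ge0// ?ltW// => t.
have := Jy t; rewrite /J fD fZ.
rewrite !(pre_dotDl, pre_dotDr, pre_dotZl, pre_dotZr) (pre_dotC P x y).
lra.
Qed.

End PreHilbertTheory.

(** * Hilbert space as a real inner product space *)

Section Hilbert.
Context {R : realType} {H : hilbertType R}.
Implicit Types (x y z h k : H) (a : R[i]) (r : R).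

Lemma dotC x y : hdot x y = Num.conj (hdot y x).
Proof. by rewrite hermC expr0 mul1r. Qed.

Lemma dotDl x y z : hdot (x + y) z = hdot x z + hdot y z.
Proof. exact: linearDl. Qed.

Lemma dotDr x y z : hdot z (x + y) = hdot z x + hdot z y.
Proof. exact: linearDr. Qed.

Lemma dotNl x z : hdot (- x) z = - hdot x z.
Proof. exact: linearNl. Qed.

Lemma dotNr x z : hdot z (- x) = - hdot z x.
Proof. exact: linearNr. Qed.

Lemma dotZl a x z : hdot (a *: x) z = a * hdot x z.
Proof. exact: linearZl_LR. Qed.

Lemma dotZr a x z : hdot z (a *: x) = Num.conj a * hdot z x.
Proof. by rewrite dotC dotZl rmorphM /= [in RHS]dotC. Qed.

(** The real inner product carries the positivity arguments; [Im_hdot]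
    recovers the complex one. *)
Definition rdot x y : R := Re (hdot x y).
Definition sq x : R := rdot x x.

Lemma Im_hdot x y : Im (hdot x y) = rdot x ('i%C *: y).
Proof.
by rewrite /rdot dotZr Re_mul conjE /= mul0r mulN1r sub0r opprK.
Qed.

Lemma rdotC x y : rdot x y = rdot y x.
Proof. by rewrite /rdot dotC Re_conjC. Qed.

Lemma rdotDl x y z : rdot (x + y) z = rdot x z + rdot y z.
Proof. by rewrite /rdot dotDl Re_add. Qed.

Lemma rdotDr x y z : rdot z (x + y) = rdot z x + rdot z y.
Proof. by rewrite /rdot dotDr Re_add. Qed.

Lemma rdotNl x z : rdot (- x) z = - rdot x z.
Proof. by rewrite /rdot dotNl Re_opp. Qed.

Lemma rdotNr x z : rdot z (- x) = - rdot z x.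
Proof. by rewrite /rdot dotNr Re_opp. Qed.

Lemma rdot0l z : rdot 0 z = 0.
Proof. by rewrite -(scale0r 0) /rdot dotZl mul0r. Qed.

Lemma rdot0r z : rdot z 0 = 0.
Proof. by rewrite rdotC rdot0l. Qed.

Lemma rdotZl r x z : rdot (r%:C%C *: x) z = r * rdot x z.
Proof. by rewrite /rdot dotZl Re_mul /= mul0r subr0. Qed.

Lemma rdotZ a x z : rdot (a *: x) z = rdot x (Num.conj a *: z).
Proof. by rewrite /rdot dotZl dotZr conjCK. Qed.

Lemma rdot_suml I (s : seq I) (Q : pred I) (F : I -> H) z :
  rdot (\sum_(i <- s | Q i) F i) z = \sum_(i <- s | Q i) rdot (F i) z.
Proof.
by apply: (big_morph (fun x => rdot x z)) => [x y|]; rewrite ?rdotDl ?rdot0l.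
Qed.

Lemma rdot_sumr I (s : seq I) (Q : pred I) (F : I -> H) z :
  rdot z (\sum_(i <- s | Q i) F i) = \sum_(i <- s | Q i) rdot z (F i).
Proof. by rewrite rdotC rdot_suml; apply: eq_bigr => i _; rewrite rdotC. Qed.

Lemma sqE x : (sq x)%:C%C = `|x| ^+ 2.
Proof.
rewrite /sq /rdot hdotE; apply: RRe_real.
by rewrite realX// normr_real.
Qed.

Lemma hdotxx x : hdot x x = (sq x)%:C%C.
Proof. by rewrite hdotE sqE. Qed.

Lemma sq_ge0 x : 0 <= sq x.
Proof. by rewrite -ler0c sqE exprn_ge0. Qed.

Lemma sq0 : sq 0 = 0 :> R.
Proof. exact: rdot0l. Qed.

Lemma sq_eq0 x : sq x <= 0 -> x = 0.
Proof.
move=> h; have h0 : sq x = 0 by apply/eqP; rewrite eq_le h sq_ge0.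
by apply/eqP; rewrite -normr_eq0 -sqrf_eq0 -sqE h0.
Qed.

Lemma sqN x : sq (- x) = sq x.
Proof. by rewrite /sq rdotNl rdotNr opprK. Qed.

Lemma sqD x y : sq (x + y) = sq x + 2 * rdot x y + sq y.
Proof. rewrite /sq !(rdotDl, rdotDr) (rdotC y x); ring. Qed.

Lemma sqB x y : sq (x - y) = sq x - 2 * rdot x y + sq y.
Proof. rewrite sqD sqN rdotNr; ring. Qed.

Lemma sqZ a x : sq (a *: x) = normsq a * sq x.
Proof.
rewrite /sq /rdot dotZl dotZr mulrA -normCK -normsqE hdotxx Re_mul /=.
by rewrite mulr0 subr0.
Qed.

Lemma sqDle x y : sq (x + y) <= 2 * sq x + 2 * sq y.
Proof. have := sq_ge0 (x - y); rewrite sqB sqD; lra. Qed.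

Lemma sqDle3 x y z : sq (x + y + z) <= 3 * sq x + 3 * sq y + 3 * sq z.
Proof.
have := sq_ge0 (x - y); have := sq_ge0 (y - z); have := sq_ge0 (x - z).
rewrite !sqB !sqD rdotDl; lra.
Qed.

Lemma norm_le_sq x y : (`|x| <= `|y|) = (sq x <= sq y).
Proof. by rewrite -(@ler_pXn2r _ 2) ?nnegrE ?normr_ge0// -!sqE lecR. Qed.

Lemma norm_lt_sqr r x : 0 <= r -> (`|x| < r%:C%C) = (sq x < r ^+ 2).
Proof.
move=> r0; rewrite -(@ltr_pXn2r _ 2) ?nnegrE ?normr_ge0 ?ler0c//.
by rewrite -sqE -rmorphXn ltcR.
Qed.

Definition hilbert_pre : prehilbert R H.
Proof.
apply: (@PreHilbert R H +%R (fun r x => r%:C%C *: x) rdot).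
- exact: rdotC.
- by move=> x y z; rewrite rdotDl.
- exact: rdotZl.
- exact: sq_ge0.
Defined.

Lemma rdot_CS x y : rdot x y ^+ 2 <= sq x * sq y.
Proof. exact: (pre_dot_CS hilbert_pre). Qed.

Lemma rdot_eq x y : (forall z, rdot z x = rdot z y) -> x = y.
Proof.
move=> h; apply/eqP; rewrite -subr_eq0; apply/eqP/sq_eq0.
by rewrite /sq rdotDr rdotNr h subrr.
Qed.

Lemma hdot_eq x y : (forall z, hdot z x = hdot z y) -> x = y.
Proof. by move=> h; apply: rdot_eq => z; rewrite /rdot h. Qed.

(** The real Cauchy-Schwarz inequality, after rotating [x] so that the inner
    product becomes real. *)
Lemma normsq_hdot x y : normsq (hdot x y) <= sq x * sq y.
Proof.
set a := hdot x y.
have := rdot_CS (Num.conj a *: x) y.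
rewrite sqZ {1}/rdot dotZl -/a.
have -> : Re (Num.conj a * a) = normsq a by rewrite Re_mul Re_conjC Im_conjC /normsq; ring.
have -> : normsq (Num.conj a) = normsq a by rewrite /normsq Re_conjC Im_conjC sqrrN.
have [->|an0] := eqVneq (normsq a) 0; first by rewrite mulr_ge0 ?sq_ge0.
rewrite expr2 -mulrA ler_pM2l// lt_neqAle eq_sym an0; exact: normsq_ge0.
Qed.

(** The norm takes values in [R[i]]; [sq] gives real estimates. *)
Lemma cvg_sq (u : nat -> H) (l : H) :
  u n @[n --> \oo] --> l <->
  forall e : R, 0 < e -> exists n0, forall n, (n0 <= n)%N -> sq (u n - l) < e.
Proof.
split.
  move=> /cvgrPdist_lt h e e0.
  have e1 : 0 < (Num.sqrt e)%:C%C by rewrite ltcR sqrtr_gt0.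
  have [n0 _ hn] := h _ e1.
  exists n0 => n /hn /=.
  by rewrite distrC norm_lt_sqr ?sqrtr_ge0// sqr_sqrtr// ltW.
move=> h; apply/cvgrPdist_lt => e e0.
have eE : e = (Re e)%:C%C by rewrite RRe_real// realE ltW.
have e1 : 0 < Re e by rewrite -ltcR -eE.
have [n0 hn] := h (Re e ^+ 2) (exprn_gt0 _ e1).
exists n0 => //= n /hn; rewrite eE distrC norm_lt_sqr//; exact: ltW.
Qed.

Lemma cauchy_sq (u : nat -> H) :
  (forall e : R, 0 < e -> exists n0, forall n m, (n0 <= n)%N -> (n0 <= m)%N ->
    sq (u n - u m) < e) ->
  exists l : H, u n @[n --> \oo] --> l.
Proof.
move=> h.
suff : cvgn u by move=> hu; exists (lim (u @ \oo)).
apply/cauchy_cvgP/cauchy_ballP => e e0.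
have eE : e = (Re e)%:C%C by rewrite RRe_real// realE ltW.
have e1 : 0 < Re e by rewrite -ltcR -eE.
have [n0 hn] := h (Re e ^+ 2) (exprn_gt0 _ e1).
exists (u @` [set n | (n0 <= n)%N], u @` [set n | (n0 <= n)%N]).
  by split; exists n0 => // n /= hn0; exists n.
move=> [_ _] /= [[n hn0 <-] [m hm0 <-]]; rewrite -ball_normE /=.
rewrite eE norm_lt_sqr; [exact: hn|exact: ltW].
Qed.

Lemma cvg_cauchy_sq (u : nat -> H) (l : H) : u n @[n --> \oo] --> l ->
  forall e : R, 0 < e -> exists n0, forall n m, (n0 <= n)%N -> (n0 <= m)%N ->
    sq (u n - u m) < e.
Proof.
move=> /cvg_sq h e e0; have [|n0 hn] := h (e / 4); first by lra.
exists n0 => n m hn0 hm0.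
have := hn _ hn0; have := hn _ hm0.
have -> : u n - u m = (u n - l) + (- (u m - l)) by rewrite opprB addrA subrK.
have := sqDle (u n - l) (- (u m - l)); rewrite sqN; lra.
Qed.

(** * Riesz representation *)

(** The [1/n]-approximate representatives form a Cauchy sequence, whose limit
    represents [f]. *)
Lemma riesz_real (f : H -> R) (K : R) :
  (forall x y, f (x + y) = f x + f y) -> (forall r x, f (r%:C%C *: x) = r * f x) ->
  0 <= K -> (forall x, f x ^+ 2 <= K * sq x) ->
  exists z, forall x, f x = rdot x z.
Proof.
move=> fD fZ K0 fK.
have appr := approximate_riesz (P := hilbert_pre) 0 fD fZ K0 fK.
have /choice [u hu] : forall n : nat, exists x,
    forall y, (f y - rdot y x) ^+ 2 <= n.+1%:R^-1 * sq y.
  by move=> n; apply: appr; rewrite invr_gt0.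
have inv_lt (e : R) : 0 < e -> exists n0, forall n, (n0 <= n)%N -> n.+1%:R^-1 < e.
  move=> e0; exists (Num.truncn e^-1) => n hn.
  rewrite invf_plt ?posrE ?ltr0n//.
  apply: (lt_le_trans (truncnS_gt _)).
  by rewrite ler_nat ltnS.
have ucauchy n m y : rdot y (u n - u m) ^+ 2 <=
    2 * (n.+1%:R^-1 + m.+1%:R^-1) * sq y.
  have := hu n y; have := hu m y; rewrite rdotDr rdotNr.
  have := sqr_ge0 ((f y - rdot y (u n)) + (f y - rdot y (u m))).
  move: (rdot y (u n)) (rdot y (u m)) (sq y) (n.+1%:R^-1) (m.+1%:R^-1).
  move=> a b s p q; nra.
have [z hz] : exists z : H, u n @[n --> \oo] --> z.
  apply: cauchy_sq => e e0.
  have [|n0 hn0] := inv_lt (e / 4); first by lra.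
  exists n0 => n m /hn0 hn /hn0 hm.
  have := ucauchy n m (u n - u m); rewrite -/(sq _).
  have [->//|s0] := eqVneq (sq (u n - u m)) 0.
  have sp : 0 < sq (u n - u m) by rewrite lt_neqAle eq_sym s0 sq_ge0.
  rewrite expr2 ler_pM2r//.
  by move: (n.+1%:R^-1) (m.+1%:R^-1) hn hm => p q; lra.
exists z => x; apply/eqP; rewrite -subr_eq0 -sqrf_eq0 eq_le sqr_ge0 andbT.
apply/ler_addgt0Pl => e e0; rewrite addr0.
have s0 := sq_ge0 x.
have [|n0 hn0] := inv_lt (e / (4 * (sq x + 1))).
  by rewrite divr_gt0//; lra.
have /cvg_sq/(_ (e / (4 * (sq x + 1))))[|n1 hn1] := hz.
  by rewrite divr_gt0//; lra.
pose n := maxn n0 n1.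
have h0 := hn0 n (leq_maxl _ _); have h1 := hn1 n (leq_maxr _ _).
have h2 := hu n x; have h3 := rdot_CS x (u n - z).
rewrite rdotDr rdotNr in h3.
have : (f x - rdot x z) ^+ 2 <= 2 * (n.+1%:R^-1 * sq x) + 2 * (sq x * sq (u n - z)).
  have := sqr_ge0 ((f x - rdot x (u n)) - (rdot x (u n) - rdot x z)).
  move: h2 h3; move: (n.+1%:R^-1) (sq x) (sq (u n - z)) => p q s.
  by move: (f x) (rdot x (u n)) (rdot x z) => a b d; lra.
move=> /le_trans; apply.
have d0 : 0 < 4 * (sq x + 1) by lra.
move: h0 h1; rewrite !ltr_pdivlMr//.
move: (n.+1%:R^-1) (sq (u n - z)) (sq_ge0 (u n - z)) => p q q0.
move: (sq x) s0 => s s0; nra.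
Qed.

(** A continuous linear functional is the pairing with a vector: apply the
    real case to its real part, then recover the imaginary part from [i x]. *)
Lemma riesz (f : H -> R[i]) (K : R) :
  (forall x y, f (x + y) = f x + f y) -> (forall a x, f (a *: x) = a * f x) ->
  0 <= K -> (forall x, normsq (f x) <= K * sq x) ->
  exists z, forall x, f x = hdot x z.
Proof.
move=> fD fZ K0 fK.
have [||//|x|z hz] := @riesz_real (fun x => Re (f x)) K.
- by move=> x y; rewrite fD Re_add.
- by move=> r x; rewrite fZ Re_mul /= mul0r subr0.
- apply: le_trans (fK x); rewrite /normsq lerDl; exact: sqr_ge0.
exists z => x; apply: complex_eq; first exact: hz.
have := hz ('i%C *: x); rewrite fZ /rdot dotZl !Re_mul /= !mul0r !mul1r !sub0r.
exact: oppr_inj.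
Qed.

End Hilbert.

(** * Contractions and their adjoints *)

Section Operators.
Context {R : realType} {H : hilbertType R}.
Implicit Types (T A : H -> H) (x y h : H) (a : R[i]).

(** Linearity is kept as a property of plain functions, since [adj T] and the
    powers of [T] come without a bundled linear structure. *)
Record bounded_linear A : Prop := BoundedLinear {
  blD : forall x y, A (x + y) = A x + A y;
  blZ : forall a x, A (a *: x) = a *: A x;
  bl_bound : exists2 K : R, 0 <= K & forall x, sq (A x) <= K * sq x
}.

Record linear_contraction T : Prop := LinearContraction {
  lcD : forall x y, T (x + y) = T x + T y;
  lcZ : forall a x, T (a *: x) = a *: T x;
  lc_le : forall x, sq (T x) <= sq x
}.

Lemma linear_contraction_bounded T : linear_contraction T -> bounded_linear T.
Proof. by case=> D Z le; split=> //; exists 1 => // x; rewrite mul1r. Qed.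

Lemma contraction_linear (T : {linear H -> H}) :
  contraction_op T -> linear_contraction T.
Proof.
move=> h; by split=> *; rewrite ?linearD ?linearZ// -norm_le_sq.
Qed.

Lemma bounded_linear_sum I (s : seq I) (F : I -> H -> H) :
  (forall i, bounded_linear (F i)) -> bounded_linear (fun x => \sum_(i <- s) F i x).
Proof.
move=> hF; elim: s => [|i s IH].
  split=> [x y|a x|]; rewrite ?big_nil ?addr0 ?scaler0//.
  by exists 0 => // x; rewrite big_nil sq0 mul0r.
have [D Z [K K0 le]] := IH; have [Di Zi [Ki Ki0 lei]] := hF i.
split=> [x y|a x|]; rewrite ?big_cons.
- by rewrite D Di addrACA.
- by rewrite Z Zi scalerDr.
exists (2 * Ki + 2 * K); first by lra.
move=> x; rewrite big_cons; apply: le_trans (sqDle _ _) _.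
have := le x; have := lei x; lra.
Qed.

Lemma bounded_linear_scale (b : R[i]) A : bounded_linear A -> bounded_linear (fun x => b *: A x).
Proof.
case=> D Z [K K0 le]; split=> [x y|a x|].
- by rewrite D scalerDr.
- by rewrite Z !scalerA mulrC.
exists (normsq b * K); first by rewrite mulr_ge0 ?normsq_ge0.
by move=> x; rewrite sqZ -mulrA ler_wpM2l ?normsq_ge0.
Qed.

Lemma linear_contraction_iter (n : nat) T : linear_contraction T -> linear_contraction (iter n T).
Proof.
case=> D Z le; elim: n => [|n [Dn Zn len]] /=; split=> // x *.
- by rewrite !iterS Dn D.
- by rewrite !iterS Zn Z.
- exact: le_trans (le _) (len _).
Qed.

(** The Riesz vector exists, so the default value in [adj] is never taken. *)
Lemma adjP A : bounded_linear A -> forall x y, hdot (A x) y = hdot x (adj A y).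
Proof.
move=> [D Z [K K0 le]] x y; rewrite /adj.
case: xgetP => [z _ hz|]; first exact: hz.
have [||||z hz] := @riesz R H (fun x => hdot (A x) y) (K * sq y).
- by move=> u v; rewrite D dotDl.
- by move=> a u; rewrite Z dotZl.
- by rewrite mulr_ge0 ?sq_ge0.
- move=> u; apply: le_trans (normsq_hdot _ _) _.
  by rewrite mulrAC ler_wpM2r ?sq_ge0.
by move=> /(_ z) /(_ hz).
Qed.

Lemma rdot_adj A : bounded_linear A -> forall x y, rdot (A x) y = rdot x (adj A y).
Proof. by move=> hA x y; rewrite /rdot adjP. Qed.

Lemma linear_contraction_adj T : linear_contraction T -> linear_contraction (adj T).
Proof.
move=> hT; have hb := linear_contraction_bounded hT.
split=> [x y|a x|x].
- by apply: hdot_eq => z; rewrite dotDr -!adjP// dotDr.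
- by apply: hdot_eq => z; rewrite dotZr -!adjP// dotZr.
have h : sq (adj T x) ^+ 2 <= sq (adj T x) * sq x.
  rewrite {1}/sq -rdot_adj//; apply: le_trans (rdot_CS _ _) _.
  by rewrite ler_wpM2r ?sq_ge0// (lc_le hT).
have := sq_ge0 (adj T x); rewrite le_eqVlt => /orP[/eqP <-|h0]; first exact: sq_ge0.
by move: h; rewrite expr2 ler_pM2l.
Qed.

Lemma adjK T : linear_contraction T -> adj (adj T) = T.
Proof.
move=> hT; apply/funext => x; apply: hdot_eq => z.
have hb := linear_contraction_bounded hT.
have hb' := linear_contraction_bounded (linear_contraction_adj hT).
by rewrite -adjP// dotC -adjP// -dotC.
Qed.

Lemma rdot_iter_adj T : linear_contraction T ->
  forall n x y, rdot (iter n T x) y = rdot x (iter n (adj T) y).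
Proof.
move=> hT; elim=> //= n IH x y.
by rewrite rdot_adj ?IH -?iterS ?iterSr//; exact: linear_contraction_bounded.
Qed.

Lemma zpow_linear_contraction T (n : int) : linear_contraction T ->
  linear_contraction (zpow_op T n).
Proof.
move=> hT; case: n => n; apply: linear_contraction_iter => //.
exact: linear_contraction_adj.
Qed.

Lemma zpow_nat T k : zpow_op T k%:Z = iter k T.
Proof. by []. Qed.

Lemma zpowN_nat T k : zpow_op T (- k%:Z) = iter k (adj T).
Proof. by case: k => [|k] //; rewrite -NegzE. Qed.

Lemma zpow_adj T (n : int) : linear_contraction T -> zpow_op (adj T) n = zpow_op T (- n).
Proof.
move=> hT; case: n => n; first by rewrite zpowN_nat.
by rewrite NegzE opprK -NegzE /= adjK.
Qed.

Lemma rdot_zpow T : linear_contraction T ->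
  forall (n : int) x y, rdot (zpow_op T n x) y = rdot x (zpow_op T (- n) y).
Proof.
move=> hT [] n x y; first by rewrite zpowN_nat /= rdot_iter_adj.
by rewrite NegzE opprK zpowN_nat zpow_nat rdotC -rdot_iter_adj// rdotC.
Qed.

End Operators.

(** * Fejer positivity *)

Section Fejer.
Context {R : realType}.

Fixpoint zrange (N : nat) : seq int :=
  if N is N'.+1 then N%:Z :: - N%:Z :: zrange N' else [:: 0].

Lemma mem_zrange N (n : int) : (n \in zrange N) = (`|n| <= N)%N.
Proof.
elim: N => [|N IH]; first by rewrite inE; lia.
by rewrite /= !inE IH; lia.
Qed.

Lemma zrange_uniq N : uniq (zrange N).
Proof.
elim: N => [|N IH] //=; rewrite IH inE !mem_zrange andbT; lia.
Qed.

Lemma big_zrange (V : nmodType) N (F : int -> V) :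
  \sum_(n <- zrange N) F n =
  F 0 + \sum_(1 <= j < N.+1) (F j%:Z + F (- j%:Z)).
Proof.
elim: N => [|N IH]; first by rewrite big_geq ?addr0 //= big_seq1.
rewrite big_nat_recr//= !big_cons IH addrA addrC -!addrA; congr (_ + _).
Qed.

(** The coefficients of [M] times the Fejer kernel. *)
Definition tri (M : nat) (n : int) : R := (M - `|n|)%N%:R.

Context {H : hilbertType R}.
Implicit Types (T : H -> H) (x y h : H) (u : R[i]).

(** The one property of an operator family from which all positivity below is
    drawn. *)
Definition fejer_positive (s : int -> H -> H) :=
  forall M h u, `|u| = 1 ->
    0 <= \sum_(n <- zrange M) tri M n * rdot (u ^ n *: s n h) h.

Definition fejer_sum T u M h : R :=
  M%:R * sq h + 2 * \sum_(1 <= j < M.+1) (M - j)%N%:R * rdot (u ^+ j *: iter j T h) h.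

Lemma fejer_sumE T u M h : linear_contraction T -> `|u| = 1 ->
  \sum_(n <- zrange M) tri M n * rdot (u ^ n *: zpow_op T n h) h = fejer_sum T u M h.
Proof.
move=> hT u1; rewrite big_zrange /fejer_sum mulr_sumr; congr (_ + _).
  by rewrite /tri subn0 expr0z scale1r.
apply: eq_bigr => j _; rewrite /tri abszN absz_nat zpowN_nat zpow_nat.
rewrite (_ : rdot (u ^ (- j%:Z) *: _) h = rdot (u ^ j%:Z *: iter j T h) h).
  by rewrite -exprnP; ring.
rewrite rdotZ rdotC -rdot_iter_adj// (lcZ (linear_contraction_iter j hT)).
by rewrite conj_exprz// opprK.
Qed.

(** With [S m] the sum of [u^j T^j h] over [j < m], [S (m+1) = h + u T S m]
    gives [|S (m+1) - h| <= |S m|], and these inequalities telescope. *)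
Lemma fejer_sum_ge0 T u M h : linear_contraction T -> `|u| = 1 ->
  0 <= fejer_sum T u M h.
Proof.
move=> hT u1.
pose S m := \sum_(j < m) (u ^+ j *: iter j T h).
have SS m : S m.+1 = h + u *: T (S m).
  rewrite /S big_ord_recl scale1r; congr (_ + _).
  rewrite (big_morph T (lcD hT) (_ : T 0 = 0)); last first.
    by rewrite -(scale0r 0) (lcZ hT) !scale0r.
  rewrite scaler_sumr; apply: eq_bigr => j _.
  by rewrite (lcZ hT) scalerA -exprS.
suff : sq (S M) <= fejer_sum T u M h by apply: le_trans; exact: sq_ge0.
elim: M => [|M IH]; first by rewrite /S /fejer_sum big_ord0 sq0 big_geq// mul0r mulr0 addr0.
have -> : fejer_sum T u M.+1 h = fejer_sum T u M h + 2 * rdot (S M.+1) h - sq h.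
  rewrite /fejer_sum big_nat_recr//= subnn mul0r addr0.
  have -> : rdot (S M.+1) h = sq h + \sum_(1 <= j < M.+1) rdot (u ^+ j *: iter j T h) h.
    rewrite /S rdot_suml -(big_mkord xpredT (fun j => rdot (u ^+ j *: iter j T h) h)).
    by rewrite big_ltn// expr0 scale1r.
  have -> : \sum_(1 <= j < M.+1) (M.+1 - j)%N%:R * rdot (u ^+ j *: iter j T h) h
     = \sum_(1 <= j < M.+1) (M - j)%N%:R * rdot (u ^+ j *: iter j T h) h
       + \sum_(1 <= j < M.+1) rdot (u ^+ j *: iter j T h) h.
    rewrite -big_split /=; apply: eq_big_nat => j /andP[j1 jM].
    by rewrite subSn// -natr1 mulrDl mul1r.
  rewrite -natr1; ring.
have : sq (S M.+1 - h) <= sq (S M).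
  rewrite SS addrAC subrr add0r sqZ; have/norm1_normsq -> := u1.
  by rewrite mul1r (lc_le hT).
rewrite sqB; lra.
Qed.

Lemma fejer_positive_zpow T : linear_contraction T -> fejer_positive (zpow_op T).
Proof. by move=> hT M h u u1; rewrite fejer_sumE// fejer_sum_ge0. Qed.

(** The analytic polynomial whose real part is the rotated Fejer kernel. *)
Definition fejer_poly u M : {poly R[i]} :=
  \poly_(i < M.+1) (if i == 0%N then M%:R else 2 * (M - i)%N%:R * u ^+ i).

Lemma poly_op_fejer T u M h : linear_contraction T ->
  rdot (poly_op (fejer_poly u M) T h) h = fejer_sum T u M h.
Proof.
move=> hT; rewrite /poly_op.
have -> : \sum_(i < size (fejer_poly u M)) (fejer_poly u M)`_i *: iter i T h =
          \sum_(i < M.+1) (fejer_poly u M)`_i *: iter i T h.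
  rewrite (big_ord_widen M.+1 (fun i => (fejer_poly u M)`_i *: iter i T h)) ?size_poly//.
  rewrite [LHS]big_mkcond; apply: eq_bigr => i _; case: ltnP => // hi.
  by rewrite nth_default// scale0r.
rewrite rdot_suml -(big_mkord xpredT (fun i => rdot ((fejer_poly u M)`_i *: iter i T h) h)).
rewrite big_ltn// /fejer_sum mulr_sumr coef_poly /=; congr (_ + _).
  by rewrite -(rmorph_nat (real_complex R)) rdotZl.
apply: eq_big_nat => j /andP[j1 jM]; rewrite coef_poly jM.
case: eqP => [j0|_]; first by rewrite j0 in j1.
rewrite -mulrA -scalerA -(rmorph_nat (real_complex R)) rdotZl -scalerA.
by rewrite -(rmorph_nat (real_complex R)) rdotZl; ring.
Qed.

(** Multiplication by a scalar [z] of the closed disc is a contraction, so the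
    scalar inequality is an instance of the operator one. *)
Lemma fejer_poly_Re_ge0 u M (z : R[i]) h : h != 0 -> `|u| = 1 -> `|z| <= 1 ->
  0 <= Re (fejer_poly u M).[z].
Proof.
move=> h0 u1 z1.
have hz : linear_contraction (fun x : H => z *: x).
  split=> [x y|a x|x]; first exact: scalerDr.
    by rewrite !scalerA mulrC.
  rewrite sqZ ler_piMl ?sq_ge0//.
  by rewrite -(expr1n _ 2) -normle_normsq.
have := fejer_sum_ge0 M h hz u1; rewrite -poly_op_fejer//.
have -> : poly_op (fejer_poly u M) (fun x => z *: x) h = (fejer_poly u M).[z] *: h.
  rewrite horner_coef scaler_suml; apply: eq_bigr => i _.
  rewrite -scalerA; congr (_ *: _).
  by elim: (nat_of_ord i) => [|n IH]; rewrite ?scale1r// iterS IH scalerA exprS.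
have s0 : 0 < sq h.
  rewrite lt_neqAle sq_ge0 andbT eq_sym; apply: contra h0 => /eqP hs.
  by apply/eqP/sq_eq0; rewrite hs.
by rewrite /rdot dotZl hdotxx Re_mul /= mulr0 subr0 pmulr_lge0.
Qed.

Lemma bounded_linear_poly_op p T : linear_contraction T -> bounded_linear (poly_op p T).
Proof.
move=> hT; apply: bounded_linear_sum => i; apply: bounded_linear_scale.
by apply: linear_contraction_bounded; apply: linear_contraction_iter.
Qed.

(** Harnack domination is used only through the Fejer polynomials. *)
Lemma harnack_fejer_positive T T' :
  linear_contraction T -> linear_contraction T' -> harnack_dominated T T' ->
  exists2 c : R, 1 <= c &
    fejer_positive (fun n x => c%:C%C *: zpow_op T' n x - zpow_op T n x).
Proof.
move=> hT hT' [c c1 hc]; exists c => // M h u u1.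
have -> : \sum_(n <- zrange M) tri M n *
    rdot (u ^ n *: (c%:C%C *: zpow_op T' n h - zpow_op T n h)) h =
    c * fejer_sum T' u M h - fejer_sum T u M h.
  rewrite -!fejer_sumE// mulr_sumr -sumrB; apply: eq_bigr => n _.
  by rewrite scalerBr rdotDl rdotNl scalerA [u ^ n * _]mulrC -scalerA rdotZl; ring.
have [->|h0] := eqVneq h 0.
  rewrite /fejer_sum sq0 !mulr0 !add0r.
  by rewrite !big1 ?mulr0 ?subr0// => i _; rewrite rdot0r mulr0.
have := hc (fejer_poly u M) (fun z => fejer_poly_Re_ge0 M h0 u1) h.
rewrite complex_ge0 => /andP[_]; rewrite -/(rdot _ h) rdotDl rdotNl rdotZl.
have reE A : bounded_linear A -> rdot (re_op A h) h = rdot (A h) h.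
  move=> hA; rewrite /re_op.
  have -> : 2^-1 = (2^-1 : R)%:C%C :> R[i] by rewrite fmorphV rmorph_nat.
  by rewrite rdotZl rdotDl (rdotC (adj A h)) -rdot_adj//; lra.
rewrite !reE ?poly_op_fejer//; exact: bounded_linear_poly_op.
Qed.

End Fejer.

(** * Averaging over roots of unity *)

Section Averaging.
Context {R : realType}.

Lemma prim_root_exists (L : nat) : (0 < L)%N -> exists z : R[i], L.-primitive_root z.
Proof.
move=> L0; pose p : {poly R[i]} := 'X^L - 1.
have [r Dp] := closed_field_poly_normal p.
rewrite (monicP _) ?monicXnsubC // scale1r in Dp.
have rn1 : all L.-unity_root r by apply/allP => z; rewrite -root_prod_XsubC -Dp.
have sz_r : (L < (size r).+1)%N by rewrite -(size_prod_XsubC r id) -Dp size_XnsubC.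
have [|z _ hz] := hasP (has_prim_root L0 rn1 _ sz_r); last by exists z.
by rewrite -separable_prod_XsubC -Dp separable_Xn_sub_1 // pnatr_eq0 -lt0n.
Qed.

(** Averages over [L]-th roots of unity isolate one coefficient of a
    polynomial of degree less than [L], in place of an integral over the
    circle. *)
Lemma unity_averages (L : nat) : (0 < L)%N -> exists w : nat -> R[i],
  (forall k, `|w k| = 1) /\
  forall m : int, (`|m| < L)%N -> \sum_(k < L) w k ^ m = if m == 0 then L%:R else 0.
Proof.
move=> L0; have [z hz] := prim_root_exists L0.
have z1 : `|z| = 1.
  apply/eqP; rewrite -(@pexpr_eq1 _ _ L) ?normr_ge0//.
  by rewrite -normrX (prim_expr_order hz) normr1.
exists (fun k => z ^+ k); split=> [k|m mL]; first by rewrite normrX z1 expr1n.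
have [->|m0] := eqVneq m 0.
  under eq_bigr do rewrite expr0z.
  by rewrite sumr_const card_ord.
have -> : \sum_(k < L) (z ^+ k) ^ m = \sum_(k < L) (z ^ m) ^+ k.
  by apply: eq_bigr => k _; rewrite !exprnP !exprz_exp mulrC.
have q1 : z ^ m != 1.
  have h (j : nat) : (0 < j < L)%N -> z ^+ j != 1.
    move=> /andP[j0 jL]; rewrite -(prim_order_dvd hz).
    by apply/negP => /dvdn_leq; rewrite j0 leqNgt jL => /(_ isT).
  case: m m0 mL => [j|j] j0 jL; first by apply: h; lia.
  rewrite NegzE -exprnN invr_eq1; apply: h; lia.
apply: (mulfI (x := z ^ m - 1)); first by rewrite subr_eq0.
rewrite mulr0 -subrX1 exprnP exprz_exp mulrC -exprz_exp -exprnP.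
by rewrite (prim_expr_order hz) exp1rz subrr.
Qed.

Lemma list_bound (I : eqType) (r : seq I) (m : I -> int) :
  exists B, forall i, i \in r -> (`|m i| <= B)%N.
Proof.
exists (\sum_(i <- r) `|m i|)%N => i si.
by rewrite (perm_big _ (perm_to_rem si)) big_cons leq_addr.
Qed.

(** For large [M] the weighted sum is [M] times the plain sum plus a constant,
    so the plain sum is nonnegative: this is the passage from Fejer sums to
    full sums. *)
Lemma tri_sum_ge0 (I : eqType) (s : seq I) (m : I -> int) (c : I -> R) :
  (forall M, 0 <= \sum_(i <- s) tri M (m i) * c i) -> 0 <= \sum_(i <- s) c i.
Proof.
move=> h.
have [B hB] := list_bound s m.
pose D := \sum_(i <- s) `|m i|%N%:R * c i.
have hM M : (B <= M)%N -> D <= M%:R * \sum_(i <- s) c i.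
  move=> BM; rewrite -subr_ge0; apply: le_trans (h M) _; rewrite le_eqVlt.
  apply/orP; left; apply/eqP; rewrite mulr_sumr /D -sumrB; apply: eq_big_seq => i si.
  by rewrite /tri natrB ?mulrBl// (leq_trans (hB _ si)).
rewrite leNgt; apply/negP => c0.
pose M := maxn B (Num.truncn (D / \sum_(i <- s) c i)).+1.
have := hM M (leq_maxl _ _); apply/negP; rewrite -ltNge.
rewrite -ltr_ndivrMr//.
apply: lt_le_trans (truncnS_gt _) _.
by rewrite ler_nat leq_maxr.
Qed.

End Averaging.

(** * Toeplitz forms *)

Section Toeplitz.
Context {R : realType} {H : hilbertType R}.
Implicit Types (v w : seq (int * H)) (p q : seq (int * R[i])) (h : H).

(** A list of pairs [(n, x)] stands for the trigonometric polynomial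
    [sum z^n x]; lists make sums, products and shifts of such polynomials
    plain list operations. When [s n] is the [n]-th power of a contraction,
    [toeplitz s] is the inner product in the space of its unitary dilation
    [U], the pair [(n, x)] standing for the vector [U^n x]. *)
Definition toeplitz (s : int -> H -> H) v w : R :=
  \sum_(x <- v) \sum_(y <- w) rdot (s (x.1 - y.1) x.2) y.2.

Definition trig p (z : R[i]) : R[i] := \sum_(x <- p) x.2 * z ^ x.1.

Definition trig_form (s : int -> H -> H) p h : R :=
  \sum_(x <- p) rdot (x.2 *: s x.1 h) h.

Definition complex_linear (A : H -> H) :=
  (forall x y, A (x + y) = A x + A y) /\ (forall (a : R[i]) x, A (a *: x) = a *: A x).

Lemma rdotZJ (a : R[i]) (x y : H) : rdot x (a *: y) = rdot (Num.conj a *: x) y.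
Proof. by rewrite rdotZ conjCK. Qed.

Lemma complex_linear_sum A I (r : seq I) (F : I -> H) : complex_linear A ->
  A (\sum_(i <- r) F i) = \sum_(i <- r) A (F i).
Proof.
move=> [D Z]; apply: big_morph => //.
by rewrite -(scale0r 0) Z !scale0r.
Qed.

(** The average over roots of unity [w k] selects the coefficient [m] of a
    Fejer sum. *)
Lemma fejer_average (s : int -> H -> H) M (B L : nat) (w : nat -> R[i])
    (m : int) (x y : H) :
  (M + B < L)%N -> (`|m| <= B)%N -> (forall k, `|w k| = 1) ->
  (forall m : int, (`|m| < L)%N -> \sum_(k < L) w k ^ m = if m == 0 then L%:R else 0) ->
  \sum_(k < L) \sum_(n <- zrange M) tri M n * rdot ((w k)^-1 ^ n *: (w k ^ m *: s n x)) y
  = L%:R * (tri M m * rdot (s m x) y).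
Proof.
move=> ML mB w1 hw; rewrite exchange_big /=.
have E n : n \in zrange M ->
    \sum_(k < L) tri M n * rdot ((w k)^-1 ^ n *: (w k ^ m *: s n x)) y =
    if n == m then L%:R * (tri M m * rdot (s m x) y) else 0.
  rewrite mem_zrange => nM.
  have -> : \sum_(k < L) tri M n * rdot ((w k)^-1 ^ n *: (w k ^ m *: s n x)) y
     = tri M n * rdot ((\sum_(k < L) w k ^ (m - n)) *: s n x) y.
    rewrite scaler_suml rdot_suml mulr_sumr; apply: eq_bigr => k _.
    rewrite scalerA exprz_inv -expfzDr ?norm1_neq0//.
    by rewrite addrC.
  rewrite hw; last by lia.
  rewrite subr_eq0 eq_sym; case: eqP => [<-|_].
    by rewrite -(rmorph_nat (real_complex R)) rdotZl; ring.
  by rewrite scale0r rdot0l mulr0.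
rewrite (eq_big_seq _ E).
have [mM|mM] := boolP (m \in zrange M).
  rewrite (bigD1_seq m) ?zrange_uniq//= eqxx big1 ?addr0// => n /negbTE ->//.
rewrite big_seq big1; last first.
  by move=> n nM; case: eqP => // nm; rewrite -nm nM in mM.
rewrite /tri; move: mM; rewrite mem_zrange -ltnNge => mM.
by rewrite (eqP (_ : M - `|m| == 0)%N) ?mul0r ?mulr0// subn_eq0 ltnW.
Qed.

(** The Toeplitz form weighted by [tri M] is an average of Fejer sums evaluated
    at the vectors [sum w^n x], hence nonnegative; then [M] grows. *)
Lemma fejer_toeplitz_ge0 s v : (forall n, complex_linear (s n)) ->
  fejer_positive s -> 0 <= toeplitz s v v.
Proof.
move=> hs hf; rewrite /toeplitz.
pose r := [seq (x, y) | x <- v, y <- v].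
have -> : \sum_(x <- v) \sum_(y <- v) rdot (s (x.1 - y.1) x.2) y.2 =
   \sum_(i <- r) rdot (s (i.1.1 - i.2.1) i.1.2) i.2.2.
  by rewrite /r big_allpairs_dep.
apply: (@tri_sum_ge0 _ _ r (fun i => i.1.1 - i.2.1)) => M.
have [B hB] := list_bound r (fun i => i.1.1 - i.2.1).
have [|w [w1 hw]] := @unity_averages R (M + B).+1; first by [].
rewrite -(pmulr_rge0 _ (ltr0Sn R (M + B))) mulr_sumr.
have -> : \sum_(i <- r) (M + B).+1%:R *
     (tri M (i.1.1 - i.2.1) * rdot (s (i.1.1 - i.2.1) i.1.2) i.2.2) =
   \sum_(i <- r) \sum_(k < (M + B).+1) \sum_(n <- zrange M)
      tri M n * rdot ((w k)^-1 ^ n *: (w k ^ (i.1.1 - i.2.1) *: s n i.1.2)) i.2.2.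
  by apply: eq_big_seq => i /hB hi; rewrite (@fejer_average s M B (M + B).+1 w).
rewrite exchange_big sumr_ge0// => k _.
pose sk := \sum_(x <- v) w k ^ x.1 *: x.2.
have := hf M sk (w k)^-1; rewrite normfV w1 invr1 => /(_ erefl).
congr (_ <= _); rewrite exchange_big; apply: eq_bigr => n _.
rewrite -mulr_sumr; congr (_ * _).
rewrite (complex_linear_sum _ _ (hs n)) scaler_sumr rdot_suml.
rewrite /r big_allpairs_dep; apply: eq_bigr => x _.
rewrite /sk rdot_sumr; apply: eq_bigr => y _ /=.
rewrite (hs n).2 rdotZJ conj_exprz// !scalerA.
congr (rdot (_ *: _) _); rewrite expfzDr ?norm1_neq0//; ring.
Qed.

(** Similarly, the weighted form of [p] is an average of Fejer sums with the
    nonnegative weights [p (w k)]. *)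
Lemma fejer_trig_ge0 s p h : fejer_positive s ->
  (forall z, `|z| = 1 -> 0 <= trig p z) -> 0 <= trig_form s p h.
Proof.
move=> hf hp; apply: (@tri_sum_ge0 _ _ p (fun i => i.1)) => M.
have [B hB] := list_bound p (fun i => i.1).
have [|w [w1 hw]] := @unity_averages R (M + B).+1; first by [].
rewrite -(pmulr_rge0 _ (ltr0Sn R (M + B))) mulr_sumr.
have -> : \sum_(i <- p) (M + B).+1%:R * (tri M i.1 * rdot (i.2 *: s i.1 h) h) =
   \sum_(i <- p) \sum_(k < (M + B).+1) \sum_(n <- zrange M)
      tri M n * rdot ((w k)^-1 ^ n *: (w k ^ i.1 *: s n h)) (Num.conj i.2 *: h).
  apply: eq_big_seq => i /hB hi; rewrite (@fejer_average s M B (M + B).+1 w)//.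
  by rewrite rdotZ.
rewrite exchange_big sumr_ge0// => k _.
have := hp (w k) (w1 k); set t := trig p (w k); rewrite complex_ge0 => /andP[/eqP It Rt].
have := hf M h (w k)^-1; rewrite normfV w1 invr1 => /(_ erefl) /(mulr_ge0 Rt).
congr (_ <= _); rewrite exchange_big mulr_sumr; apply: eq_bigr => n _.
rewrite -mulr_sumr mulrCA; congr (_ * _).
rewrite -rdotZl (_ : (Re t)%:C%C = t); last by apply: complex_eq.
rewrite /t /trig scaler_suml rdot_suml; apply: eq_bigr => i _.
rewrite rdotZJ conjCK !scalerA; congr (rdot (_ *: _) _); ring.
Qed.

End Toeplitz.

(** * Harnack domination of Toeplitz forms *)

Section Domination.
Context {R : realType} {H : hilbertType R}.
Implicit Types (T S : H -> H) (v w : seq (int * H)) (p q : seq (int * R[i])) (h k : H).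

Lemma complex_linear_zpow T n : linear_contraction T -> complex_linear (zpow_op T n).
Proof. by move=> hT; have [D Z _] := zpow_linear_contraction n hT. Qed.

Lemma toeplitz_ge0 T v : linear_contraction T -> 0 <= toeplitz (zpow_op T) v v.
Proof.
move=> hT; apply: fejer_toeplitz_ge0; last exact: fejer_positive_zpow.
by move=> n; exact: complex_linear_zpow.
Qed.

Lemma trig_form_ge0 T p h : linear_contraction T ->
  (forall z, `|z| = 1 -> 0 <= trig p z) -> 0 <= trig_form (zpow_op T) p h.
Proof. by move=> hT; apply: fejer_trig_ge0; exact: fejer_positive_zpow. Qed.

Definition toeplitz_dominated (c : R) T T' :=
  forall v, toeplitz (zpow_op T) v v <= c * toeplitz (zpow_op T') v v.

Lemma harnack_toeplitz T T' :
  linear_contraction T -> linear_contraction T' -> harnack_dominated T T' ->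
  exists c : R, [/\ 0 < c, toeplitz_dominated c T T' &
    forall p h, (forall z, `|z| = 1 -> 0 <= trig p z) ->
      trig_form (zpow_op T) p h <= c * trig_form (zpow_op T') p h].
Proof.
move=> hT hT' hTT'; have [c c1 hc] := harnack_fejer_positive hT hT' hTT'.
exists c; split=> [|v|p h hp]; first by lra.
- have lin n : complex_linear (fun x => c%:C%C *: zpow_op T' n x - zpow_op T n x).
    have [D' Z'] := complex_linear_zpow n hT'; have [D Z] := complex_linear_zpow n hT.
    split=> [x y|a x]; first by rewrite D' D scalerDr opprD addrACA.
    by rewrite Z Z' scalerBr !scalerA (mulrC a).
  rewrite -subr_ge0; have := fejer_toeplitz_ge0 v lin hc; congr (_ <= _).
  rewrite /toeplitz mulr_sumr -sumrB; apply: eq_bigr => x _.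
  rewrite mulr_sumr -sumrB; apply: eq_bigr => y _.
  by rewrite rdotDl rdotNl rdotZl.
rewrite -subr_ge0; have := fejer_trig_ge0 h hc hp; congr (_ <= _).
rewrite /trig_form mulr_sumr -sumrB; apply: eq_bigr => x _.
by rewrite scalerBr rdotDl rdotNl scalerA mulrC -scalerA rdotZl.
Qed.

(** * The Toeplitz form as an inner product *)

Lemma toeplitz_sym T v w : linear_contraction T ->
  toeplitz (zpow_op T) v w = toeplitz (zpow_op T) w v.
Proof.
move=> hT; rewrite /toeplitz exchange_big; apply: eq_bigr => x _.
by apply: eq_bigr => y _; rewrite rdot_zpow// opprB rdotC.
Qed.

Lemma toeplitz_catl s v1 v2 w :
  toeplitz s (v1 ++ v2) w = toeplitz s v1 w + toeplitz s v2 w :> R.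
Proof. by rewrite /toeplitz big_cat. Qed.

Lemma toeplitz_catr s v1 v2 w :
  toeplitz s w (v1 ++ v2) = toeplitz s w v1 + toeplitz s w v2 :> R.
Proof.
by rewrite /toeplitz -big_split; apply: eq_bigr => x _; rewrite big_cat.
Qed.

Definition lscale (a : R[i]) v := [seq (x.1, a *: x.2) | x <- v].

Lemma toeplitz_scalel T (r : R) v w : linear_contraction T ->
  toeplitz (zpow_op T) (lscale r%:C%C v) w = r * toeplitz (zpow_op T) v w.
Proof.
move=> hT; rewrite /toeplitz big_map mulr_sumr; apply: eq_bigr => x _.
rewrite mulr_sumr; apply: eq_bigr => y _ /=.
by rewrite (complex_linear_zpow _ hT).2 rdotZl.
Qed.

Definition toeplitz_pre T (hT : linear_contraction T) : prehilbert R (seq (int * H)).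
Proof.
apply: (@PreHilbert R _ cat (fun r v => lscale r%:C%C v) (toeplitz (zpow_op T))).
- by move=> v w; exact: toeplitz_sym.
- by move=> v1 v2 w; exact: toeplitz_catl.
- by move=> r v w; exact: toeplitz_scalel.
- by move=> v; exact: toeplitz_ge0.
Defined.

Lemma toeplitz_scaler T (r : R) v w : linear_contraction T ->
  toeplitz (zpow_op T) w (lscale r%:C%C v) = r * toeplitz (zpow_op T) w v.
Proof. by move=> hT; rewrite toeplitz_sym// toeplitz_scalel// toeplitz_sym. Qed.

Lemma toeplitz_CS T v w : linear_contraction T ->
  toeplitz (zpow_op T) v w ^+ 2 <=
  toeplitz (zpow_op T) v v * toeplitz (zpow_op T) w w.
Proof. by move=> hT; exact: (pre_dot_CS (toeplitz_pre hT)). Qed.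

(** The orthogonal projection onto [H] of the dilation vector [v], by
    [toeplitz_single]. *)
Definition lproj T v : H := \sum_(x <- v) zpow_op T x.1 x.2.

Lemma toeplitz_single T v h : toeplitz (zpow_op T) v [:: (0, h)] = rdot (lproj T v) h.
Proof.
rewrite /toeplitz /lproj rdot_suml; apply: eq_bigr => x _.
by rewrite big_seq1 subr0.
Qed.

Lemma toeplitz_single2 T g h : toeplitz (zpow_op T) [:: (0, g)] [:: (0, h)] = rdot g h.
Proof. by rewrite toeplitz_single /lproj big_seq1. Qed.

(** Passing from [U] to its inverse, the dilation of the adjoint. *)
Definition lneg v := [seq (- x.1, x.2) | x <- v].

Lemma toeplitz_lneg T v : linear_contraction T ->
  toeplitz (zpow_op (adj T)) v v = toeplitz (zpow_op T) (lneg v) (lneg v).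
Proof.
move=> hT; rewrite /toeplitz big_map; apply: eq_bigr => x _.
rewrite big_map; apply: eq_bigr => y _ /=.
by rewrite zpow_adj// opprB opprK addrC.
Qed.

Lemma toeplitz_dominated_adj c T T' : linear_contraction T -> linear_contraction T' ->
  toeplitz_dominated c T T' -> toeplitz_dominated c (adj T) (adj T').
Proof. by move=> hT hT' h v; rewrite !toeplitz_lneg. Qed.

(** * Asymptotic comparison of the powers *)

(** Domination for the dilation vector [U^m h - T'^m h]. *)
Lemma power_difference c T T' (m : nat) h :
  linear_contraction T -> linear_contraction T' -> toeplitz_dominated c T T' ->
  sq (iter m T h - iter m T' h) <= c * (sq h - sq (iter m T' h)).
Proof.
move=> hT hT' hc; set g := iter m T' h.
have E S : linear_contraction S ->
    toeplitz (zpow_op S) [:: (m%:Z, h); (0, - g)] [:: (m%:Z, h); (0, - g)] =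
    sq h - 2 * rdot (iter m S h) g + sq g.
  move=> hS; rewrite /toeplitz !big_cons !big_nil !subrr subr0 sub0r.
  rewrite zpow_nat (_ : zpow_op S (- m%:Z) (- g) = iter m (adj S) (- g)); last first.
    by rewrite zpowN_nat.
  rewrite [rdot (iter m (adj S) _) _]rdotC -rdot_iter_adj// !rdotNr.
  rewrite /= rdotNl opprK -!/(sq _); ring.
have := hc [:: (m%:Z, h); (0, - g)]; rewrite !E//.
rewrite -/g -/(sq g) => hle; rewrite sqB.
have := lc_le (linear_contraction_iter m hT) h; lra.
Qed.

(** The bound holds uniformly at all later times, which is what carries limits
    from the orbits of [S'] to those of [S]. *)
Definition shadowed S S' :=
  forall h (e : R), 0 < e -> exists u n0,
    forall n, sq (iter (n0 + n) S h - iter n S' u) <= e.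

Lemma nonincreasing_cauchy (f : nat -> R) (e : R) :
  (forall n, 0 <= f n) -> (forall n m, (n <= m)%N -> f m <= f n) -> 0 < e ->
  exists n0, forall n m, (n0 <= n)%N -> (n <= m)%N -> f n - f m <= e.
Proof.
move=> f0 fd e0.
have hinf : has_inf (range f).
  by split; [exists (f 0%N), 0%N | exists 0 => _ [n _ <-]].
have [_ [n0 _ <-] hn] : exists2 z, range f z & z < inf (range f) + e.
  by have [z] := inf_adherent e0 hinf; exists z.
exists n0 => n m hn0 hnm.
have := fd _ _ hn0; have : inf (range f) <= f m.
  by apply: ge_inf; [case: hinf | exists m].
lra.
Qed.

(** The defect in [power_difference] is small along the tail of an orbit of
    [T'], because [|T'^n h|] decreases to a limit. *)
Lemma shadowed_dominating c T T' : 0 < c ->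
  linear_contraction T -> linear_contraction T' -> toeplitz_dominated c T T' ->
  shadowed T' T.
Proof.
move=> c0 hT hT' hc h e e0.
have dec n m : (n <= m)%N -> sq (iter m T' h) <= sq (iter n T' h).
  move=> /subnK <-; rewrite iterD; exact: lc_le (linear_contraction_iter _ hT') _.
have [|n0 hn0] := nonincreasing_cauchy (fun n => sq_ge0 (iter n T' h)) dec (e := e / c).
  by rewrite divr_gt0.
exists (iter n0 T' h), n0 => n.
have := power_difference n (iter n0 T' h) hT hT' hc; rewrite -iterD (addnC n).
rewrite -opprB sqN => /le_trans; apply.
by rewrite mulrC -ler_pdivlMr// hn0// leq_addr.
Qed.

(** The functional [<U^n x, h>] on the dilation space of [T] is bounded for the
    form of [T'], hence almost represented by some [t] there; testing on
    [U^(-n) k] compares [T^n h] with a combination of powers of [T']. *)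
Lemma shadowed_dominated c T T' : 0 < c ->
  linear_contraction T -> linear_contraction T' -> toeplitz_dominated c T T' ->
  shadowed T T'.
Proof.
move=> c0 hT hT' hc h e e0.
pose f v := toeplitz (zpow_op T) v [:: (0, h)].
have [||||//|t ht] := @approximate_riesz _ _ (toeplitz_pre hT') [::] f (c * sq h) _ _ _ _ e.
- by move=> v w; exact: toeplitz_catl.
- by move=> r v; exact: toeplitz_scalel.
- by rewrite mulr_ge0 ?sq_ge0// ltW.
- move=> v; apply: le_trans (toeplitz_CS _ _ hT) _.
  rewrite toeplitz_single2 -/(sq h) mulrAC; apply: ler_wpM2r; first exact: sq_ge0.
  exact: hc.
have [n0 hn0] := list_bound t (fun x => x.1).
exists (\sum_(x <- t) zpow_op T' (n0%:Z + x.1) x.2), n0 => n.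
set d := iter (n0 + n) T h - _.
have := ht [:: (- (n0 + n)%:Z, d)].
have -> : f [:: (- (n0 + n)%:Z, d)] = rdot d (iter (n0 + n) T h).
  rewrite /f toeplitz_single /lproj big_seq1 /= zpowN_nat.
  by rewrite rdotC -rdot_iter_adj// rdotC.
have -> : pre_dot (toeplitz_pre hT') [:: (- (n0 + n)%:Z, d)] t =
    rdot d (iter n T' (\sum_(x <- t) zpow_op T' (n0%:Z + x.1) x.2)).
  rewrite /= /toeplitz big_seq1 -[iter n T' _]/(zpow_op T' n%:Z _).
  rewrite (complex_linear_sum _ _ (complex_linear_zpow n hT')) rdot_sumr.
  apply: eq_big_seq => x /hn0 hx /=.
  rewrite rdot_zpow// opprB opprK; congr (rdot _ _).
  have [j jE] : exists j : nat, n0%:Z + x.1 = j%:Z by exists (absz (n0%:Z + x.1)); lia.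
  rewrite jE (_ : x.1 + (n0 + n)%:Z = (n + j)%N%:Z); last by lia.
  by rewrite !zpow_nat iterD.
have -> : pre_dot (toeplitz_pre hT') [:: (- (n0 + n)%:Z, d)] [:: (- (n0 + n)%:Z, d)] = sq d.
  by rewrite /= /toeplitz !big_seq1 subrr.
rewrite -rdotNr -rdotDr -/d -/(sq d).
have := sq_ge0 d; rewrite le_eqVlt => /orP[/eqP <- _|d0]; first exact: ltW.
by rewrite expr2 ler_pM2r.
Qed.

Lemma shadowed_strongly_stable S S' : shadowed S S' ->
  strongly_stable S' -> strongly_stable S.
Proof.
move=> hs hS' h; apply/cvg_sq => e e0.
have [|u [n0 hu]] := hs h (e / 8); first by lra.
have /cvg_sq/(_ (e / 8))[|n1 hn1] := hS' u; first by lra.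
exists (n0 + n1)%N => n hn; rewrite subr0.
have := hn1 (n - n0)%N ltac:(lia); rewrite subr0 => h1.
have := hu (n - n0)%N; rewrite subnKC; last by lia.
move=> h2; have := sqDle (iter n S h - iter (n - n0) S' u) (iter (n - n0) S' u).
rewrite subrK; lra.
Qed.

Lemma shadowed_cauchy S S' : shadowed S S' ->
  (forall h, exists l : H, iter n S' h @[n --> \oo] --> l) ->
  (forall h, exists l : H, iter n S h @[n --> \oo] --> l).
Proof.
move=> hs hS' h; apply: cauchy_sq => e e0.
have [|u [n0 hu]] := hs h (e / 18); first by lra.
have [l hl] := hS' u.
have [|n1 hn1] := cvg_cauchy_sq hl (e := e / 18); first by lra.
exists (n0 + n1)%N => n m hn hm.
have := hn1 (n - n0)%N (m - n0)%N ltac:(lia) ltac:(lia) => h1.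
have := hu (n - n0)%N; rewrite subnKC; last by lia.
move=> h2; have := hu (m - n0)%N; rewrite subnKC; last by lia.
move=> h3.
have := sqDle3 (iter n S h - iter (n - n0) S' u)
  (iter (n - n0) S' u - iter (m - n0) S' u) (- (iter m S h - iter (m - n0) S' u)).
rewrite sqN opprB !subrKA; lra.
Qed.

Lemma hdotB_small (x y k : H) (e : R) : sq (x - y) <= e ->
  normsq (hdot x k - hdot y k) <= e * sq k.
Proof.
move=> h; rewrite -dotNl -dotDl; apply: le_trans (normsq_hdot _ _) _.
by apply: ler_wpM2r; rewrite ?sq_ge0.
Qed.

Lemma normsqD_le (a b : R[i]) : normsq (a + b) <= 2 * normsq a + 2 * normsq b.
Proof.
rewrite /normsq !(Re_add, Im_add).
have := sqr_ge0 (Re a - Re b); have := sqr_ge0 (Im a - Im b); lra.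
Qed.

Lemma normsqN (a : R[i]) : normsq (- a) = normsq a.
Proof. by rewrite /normsq Re_opp Im_opp !sqrrN. Qed.

(** Complex limits are handled with [normsq] to keep the estimates real. *)
Lemma cvg_normsq (u : nat -> R[i]) (l : R[i]) :
  u n @[n --> \oo] --> (l : R[i]^o) <->
  forall e : R, 0 < e -> exists n0, forall n, (n0 <= n)%N -> normsq (u n - l) < e.
Proof.
have P := @cvgrPdist_lt _ R[i]^o _ _ eventually_filter u l.
split.
  move=> /P h e e0.
  have e1 : 0 < (Num.sqrt e)%:C%C by rewrite ltcR sqrtr_gt0.
  have [n0 _ hn] := h _ e1.
  exists n0 => n /hn /=.
  rewrite distrC -(@ltr_pXn2r _ 2) ?nnegrE ?normr_ge0 ?ler0c ?sqrtr_ge0//.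
  by rewrite -normsqE -rmorphXn ltcR sqr_sqrtr// ltW.
move=> h; apply/P => e e0.
have eE : e = (Re e)%:C%C by rewrite RRe_real// realE ltW.
have e1 : 0 < Re e by rewrite -ltcR -eE.
have [n0 hn] := h (Re e ^+ 2) (exprn_gt0 _ e1).
exists n0 => //= n /hn hn'; rewrite eE distrC.
rewrite -(@ltr_pXn2r _ 2) ?nnegrE ?normr_ge0 ?ler0c ?(ltW e1)//.
by rewrite -normsqE -rmorphXn ltcR.
Qed.

Lemma shadowed_weakly_stable S S' : shadowed S S' ->
  weakly_stable S' -> weakly_stable S.
Proof.
move=> hs hS' h k; apply/cvg_normsq => e e0.
have k0 := sq_ge0 k.
have d0 : 0 < e / (4 * (sq k + 1)) by rewrite divr_gt0//; lra.
have [u [n0 hu]] := hs h _ d0.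
have /cvg_normsq/(_ (e / 4))[|n1 hn1] := hS' u k; first by lra.
exists (n0 + n1)%N => n hn; rewrite subr0.
have := hn1 (n - n0)%N ltac:(lia); rewrite subr0 => h1.
have := hu (n - n0)%N; rewrite subnKC; last by lia.
move=> /(hdotB_small k) h2.
have := normsqD_le (hdot (iter n S h) k - hdot (iter (n - n0) S' u) k)
  (hdot (iter (n - n0) S' u) k).
rewrite subrK.
have : e / (4 * (sq k + 1)) * sq k <= e / 4.
  rewrite -subr_ge0 (_ : _ - _ = e / (4 * (sq k + 1))); first exact: ltW.
  by field; apply: lt0r_neq0; lra.
lra.
Qed.

Lemma cauchy_normsq (u : nat -> R[i]) :
  (forall e : R, 0 < e -> exists n0, forall n m, (n0 <= n)%N -> (n0 <= m)%N ->
     normsq (u n - u m) < e) ->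
  exists l : R[i], u n @[n --> \oo] --> (l : R[i]^o).
Proof.
move=> h.
have real_cvg (f : R[i] -> R) : (forall a b, (f a - f b) ^+ 2 <= normsq (a - b)) ->
    exists l : R, f (u n) @[n --> \oo] --> l.
  move=> hf; suff : cvgn (fun n => f (u n)) by move=> hu; exists (lim (f (u n) @[n --> \oo])).
  apply/cauchy_cvgP/cauchy_ballP => e e0.
  have [n0 hn] := h (e ^+ 2) (exprn_gt0 _ e0).
  exists ((f \o u) @` [set n | (n0 <= n)%N], (f \o u) @` [set n | (n0 <= n)%N]).
    by split; exists n0 => // n /= hn0; exists n.
  move=> [_ _] /= [[n hn0 <-] [m hm0 <-]]; rewrite -ball_normE /=.
  rewrite -(@ltr_pXn2r _ 2) ?nnegrE ?normr_ge0 ?(ltW e0)// real_normK ?num_real//.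
  exact: le_lt_trans (hf _ _) (hn _ _ hn0 hm0).
have [|a ha] := real_cvg (fun z => Re z).
  by move=> x y; rewrite /normsq Re_add Re_opp lerDl sqr_ge0.
have [|b hb] := real_cvg (fun z => Im z).
  by move=> x y; rewrite /normsq Im_add Im_opp lerDr sqr_ge0.
exists (a +i* b)%C; apply/cvg_normsq => e e0.
have e1 : 0 < Num.sqrt (e / 2) by rewrite sqrtr_gt0; lra.
have [n0 _ hn0] := (cvgrPdist_lt _ _).1 ha _ e1.
have [n1 _ hn1] := (cvgrPdist_lt _ _).1 hb _ e1.
exists (maxn n0 n1) => n; rewrite geq_max => /andP[/hn0 /= h0 /hn1 /= h1].
have sqr_lt (x : R) : `|x| < Num.sqrt (e / 2) -> x ^+ 2 < e / 2.
  rewrite -(@ltr_pXn2r _ 2) ?nnegrE ?normr_ge0 ?sqrtr_ge0//.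
  by rewrite real_normK ?num_real// sqr_sqrtr//; lra.
rewrite /normsq Re_add Re_opp Im_add Im_opp /=.
move/sqr_lt: h0; move/sqr_lt: h1; lra.
Qed.

Lemma shadowed_weakly_cvg S S' : shadowed S S' ->
  (forall h k, exists l : R[i], hdot (iter n S' h) k @[n --> \oo] --> (l : R[i]^o)) ->
  (forall h k, exists l : R[i], hdot (iter n S h) k @[n --> \oo] --> (l : R[i]^o)).
Proof.
move=> hs hS' h k; apply: cauchy_normsq => e e0.
have k0 := sq_ge0 k.
have d0 : 0 < e / (16 * (sq k + 1)) by rewrite divr_gt0//; lra.
have [u [n0 hu]] := hs h _ d0.
have [l /cvg_normsq/(_ (e / 32))[|n1 hn1]] := hS' u k; first by lra.
have small n : (n0 + n1 <= n)%N -> normsq (hdot (iter n S h) k - l) < e / 4.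
  move=> hn; have := hn1 (n - n0)%N ltac:(lia) => h1.
  have := hu (n - n0)%N; rewrite subnKC; last by lia.
  move=> /(hdotB_small k) h2.
  have := normsqD_le (hdot (iter n S h) k - hdot (iter (n - n0) S' u) k)
    (hdot (iter (n - n0) S' u) k - l).
  rewrite subrKA.
  have : e / (16 * (sq k + 1)) * sq k <= e / 16.
    rewrite -subr_ge0 (_ : _ - _ = e / (16 * (sq k + 1))); first exact: ltW.
    by field; apply: lt0r_neq0; lra.
  lra.
exists (n0 + n1)%N => n m /small hn /small hm.
have := normsqD_le (hdot (iter n S h) k - l) (- (hdot (iter m S h) k - l)).
rewrite normsqN opprB subrKA; lra.
Qed.

End Domination.

(** * Limit operators of convergent sequences of powers *)

Section Limits.
Context {R : realType} {H : hilbertType R}.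
Implicit Types (T S : H -> H) (h k : H).

Lemma linear_pack (A : H -> H) : complex_linear A ->
  exists B : {linear H -> H}, forall h, B h = A h.
Proof.
move=> [D Z].
have lin : linear A by move=> a x y; rewrite D Z.
pose m := GRing.isLinear.Build R[i] H H *:%R A lin.
pose B : {linear H -> H} := HB.pack A m.
by exists B.
Qed.

Lemma lim_unique (u : nat -> H) (l l' : H) :
  u n @[n --> \oo] --> l -> u n @[n --> \oo] --> l' -> l = l'.
Proof.
move=> /cvg_sq h /cvg_sq h'; apply/eqP; rewrite -subr_eq0; apply/eqP/sq_eq0.
apply/ler_addgt0Pl => e e0; rewrite addr0.
have [|n hn] := h (e / 4); first by lra.
have [|m hm] := h' (e / 4); first by lra.
have := sqDle (- (u (maxn n m) - l)) (u (maxn n m) - l').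
rewrite sqN opprB subrKA.
have := hn _ (leq_maxl n m); have := hm _ (leq_maxr n m); lra.
Qed.

(** The constant 4 leaves room for the crude [sqDle] in the limit arguments. *)
Lemma bounded_op_sq (A : H -> H) : (forall x, sq (A x) <= 4 * sq x) -> bounded_op A.
Proof.
move=> h; exists 2 => x.
have -> : 2%:C%C * `|x| = `|2%:C%C *: x : H|.
  by rewrite normrZ ger0_norm// ler0c.
rewrite norm_le_sq sqZ (_ : normsq _ = 4) ?h//.
by rewrite /normsq /=; ring.
Qed.

(** The pointwise limit is automatically linear and bounded. *)
Lemma strong_limit T : linear_contraction T ->
  (forall h, exists l : H, iter n T h @[n --> \oo] --> l) <-> strongly_convergent T.
Proof.
move=> hT; split; last by move=> [A [_ hA]] h; exists (A h).
move=> /choice [A hA].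
have [|B hB] := @linear_pack A.
  split=> [x y|a x].
    apply: lim_unique (hA _) _.
    under eq_fun do rewrite (lcD (linear_contraction_iter _ hT)).
    exact: cvgD (hA x) (hA y).
  apply: lim_unique (hA _) _.
  under eq_fun do rewrite (lcZ (linear_contraction_iter _ hT)).
  exact: cvgZr (hA x).
exists B; split=> [|h]; last by rewrite hB.
apply: bounded_op_sq => x; rewrite hB; apply/ler_addgt0Pl => e e0.
have /cvg_sq/(_ (e / 2))[|n /(_ n (leqnn n)) hn] := hA x; first by lra.
have := sqDle (iter n T x) (- (iter n T x - A x)).
rewrite sqN opprB addrC subrK.
have := lc_le (linear_contraction_iter n hT) x; have := sq_ge0 x; lra.
Qed.

Definition clim (u : nat -> R[i]) (l : R[i]) := forall e : R, 0 < e ->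
  exists n0, forall n, (n0 <= n)%N -> normsq (u n - l) < e.

Lemma clim_unique u l l' : clim u l -> clim u l' -> l = l'.
Proof.
move=> h h'; apply/eqP; rewrite -subr_eq0 -normr_eq0 -sqrf_eq0 -normsqE.
suff : normsq (l - l') <= 0.
  move=> n0; have -> : normsq (l - l') = 0 by apply/eqP; rewrite eq_le n0 normsq_ge0.
  by rewrite eqxx.
apply/ler_addgt0Pl => e e0; rewrite addr0.
have [|n hn] := h (e / 4); first by lra.
have [|m hm] := h' (e / 4); first by lra.
have := normsqD_le (- (u (maxn n m) - l)) (u (maxn n m) - l').
rewrite normsqN opprB subrKA.
have := hn _ (leq_maxl n m); have := hm _ (leq_maxr n m); lra.
Qed.

Lemma climD u v l m : clim u l -> clim v m -> clim (fun n => u n + v n) (l + m).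
Proof.
move=> hu hv e e0.
have [|n hn] := hu (e / 4); first by lra.
have [|n' hn'] := hv (e / 4); first by lra.
exists (maxn n n') => k; rewrite geq_max => /andP[/hn h1 /hn' h2].
have := normsqD_le (u k - l) (v k - m); rewrite addrACA -opprD; lra.
Qed.

Lemma climZ a u l : clim u l -> clim (fun n => a * u n) (a * l).
Proof.
move=> hu e e0; have a0 := normsq_ge0 a.
have [|n hn] := hu (e / (normsq a + 1)); first by rewrite divr_gt0//; lra.
exists n => k /hn; rewrite ltr_pdivlMr; last by lra.
rewrite -mulrBr normsqM; have := normsq_ge0 (u k - l); nra.
Qed.

Lemma clim_le u l (b : R) : clim u l -> (forall n, normsq (u n) <= b) ->
  normsq l <= 2 * b.
Proof.
move=> hu hb; apply/ler_addgt0Pl => e e0.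
have [|n /(_ n (leqnn n)) hn] := hu (e / 2); first by lra.
have := normsqD_le (u n) (- (u n - l)); rewrite normsqN opprB addrC subrK.
have := hb n; lra.
Qed.

Lemma clim_conj u l : clim u l -> clim (fun n => Num.conj (u n)) (Num.conj l).
Proof.
move=> hu e /hu[n hn]; exists n => k /hn.
by rewrite /normsq !(Re_add, Im_add, Re_opp, Im_opp, Re_conjC, Im_conjC) -opprD sqrrN.
Qed.

(** The limit of [<k, T^n h>] is a bounded functional of [k]; its Riesz vector
    is the limit operator at [h]. *)
Lemma weak_limit T : linear_contraction T ->
  (forall h k, exists l : R[i], hdot (iter n T h) k @[n --> \oo] --> (l : R[i]^o)) <->
  weakly_convergent T.
Proof.
move=> hT; split; last by move=> [A [_ hA]] h k; exists (hdot (A h) k).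
move=> hw; have hTn n := linear_contraction_iter n hT.
have /choice [A hA] : forall h, exists z,
    (forall k, clim (fun n => hdot (iter n T h) k) (hdot z k)) /\ sq z <= 4 * sq h.
  move=> h; have /choice [l hl] : forall k, exists l,
      clim (fun n => hdot k (iter n T h)) l.
    move=> k; have [l /cvg_normsq hl] := hw h k; exists (Num.conj l).
    move=> e e0; have [n hn] := clim_conj hl e0.
    by exists n => m /hn; rewrite -dotC.
  have lb k : normsq (l k) <= 2 * sq h * sq k.
    rewrite -mulrA; apply: clim_le (hl k) _ => n.
    rewrite mulrC; apply: le_trans (normsq_hdot _ _) _.
    by apply: ler_wpM2l; rewrite ?sq_ge0 ?(lc_le (hTn n)).
  have [|||//|z hz] := @riesz R H l (2 * sq h).
  - move=> x y; apply: clim_unique (hl _) _ => e /(climD (hl x) (hl y))[n hn].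
    by exists n => m /hn; rewrite dotDl.
  - move=> a x; apply: clim_unique (hl _) _ => e /(climZ a (hl x))[n hn].
    by exists n => m /hn; rewrite dotZl.
  - by rewrite mulr_ge0 ?sq_ge0.
  exists z; split=> [k|].
    rewrite dotC -hz => e /(clim_conj (hl k))[n hn].
    by exists n => m /hn; rewrite -dotC.
  have := lb z; rewrite hz hdotxx /normsq /= expr0n addr0.
  have := sq_ge0 z; have := sq_ge0 h.
  rewrite [0 <= sq z]le_eqVlt => h0 /orP[/eqP <-|z0]; first by lra.
  rewrite expr2 ler_pM2r//; lra.
have [|B hB] := @linear_pack A.
  split=> [x y|a x]; apply: hdot_eq => k; rewrite dotC [RHS]dotC; congr (Num.conj _).
    rewrite dotDl; apply: clim_unique ((hA _).1 k) _.
    move=> e /(climD ((hA x).1 k) ((hA y).1 k))[n hn].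
    by exists n => m /hn; rewrite (lcD (hTn m)) dotDl.
  rewrite dotZl; apply: clim_unique ((hA _).1 k) _.
  move=> e /(climZ a ((hA x).1 k))[n hn].
  by exists n => m /hn; rewrite (lcZ (hTn m)) dotZl.
exists B; split=> [|h k]; last by apply/cvg_normsq; rewrite hB; exact: (hA h).1.
by apply: bounded_op_sq => x; rewrite hB; exact: (hA x).2.
Qed.

End Limits.

(** * The unitary part *)

Section UnitaryPart.
Context {R : realType} {H : hilbertType R}.
Implicit Types (T : H -> H) (M : set H).

Lemma isometric_adj T x : linear_contraction T -> sq (T x) = sq x -> adj T (T x) = x.
Proof.
move=> hT hx; apply/eqP; rewrite -subr_eq0; apply/eqP/sq_eq0.
have hb := linear_contraction_bounded hT.
have := lc_le (linear_contraction_adj hT) (T x).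
rewrite sqB rdotC -rdot_adj// -/(sq _) hx; lra.
Qed.

(** Where [T'] is isometric the defect bounding [T - T'] vanishes, so [T]
    agrees with [T'] on every space reducing [T'] to a unitary. *)
Lemma completely_nonunitary_dominated c T T' :
  linear_contraction T -> linear_contraction T' -> toeplitz_dominated c T T' ->
  completely_nonunitary T -> completely_nonunitary T'.
Proof.
move=> hT hT' hc hcnu M [cM TM TMo] [ontoM isoM].
have eqT x : M x -> T x = T' x.
  move=> Mx; apply/eqP; rewrite -subr_eq0; apply/eqP/sq_eq0.
  have := power_difference 1 x hT hT' hc.
  by rewrite /= /sq {2}/rdot [rdot (T' x) _]/rdot isoM// subrr mulr0.
have imM : T @` M = M.
  by rewrite -[RHS]ontoM; apply/eq_imagel => x Mx; rewrite eqT.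
have isoT x y : M x -> M y -> hdot (T x) (T y) = hdot x y.
  by move=> Mx My; rewrite !eqT// isoM.
apply: hcnu; split=> //; first by rewrite imM.
move=> _ [y My <-] x Mx.
move: Mx; rewrite -{1}imM => -[u Mu <-].
rewrite dotC adjP; last exact: linear_contraction_bounded.
rewrite isometric_adj// /sq /rdot ?isoT// -dotC; exact: My.
Qed.

End UnitaryPart.

(** * Scalar trigonometric polynomials *)

Section TrigAlgebra.
Context {R : realType}.
Implicit Types (p q : seq (int * R[i])) (z : R[i]).

Definition tmul p q := [seq (x.1 + y.1, x.2 * y.2) | x <- p, y <- q].
Definition tconj p := [seq (- x.1, Num.conj x.2) | x <- p].
Definition tscale (a : R[i]) p := [seq (x.1, a * x.2) | x <- p].

(** The mean over the circle. *)
Definition tmean p : R := \sum_(x <- p | x.1 == 0) Re x.2.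

(** The squared norm of [p] in [L^2] of the circle. *)
Definition tnorm2 p : R := tmean (tmul p (tconj p)).

Lemma tnorm2E p : tnorm2 p = \sum_(x <- p) \sum_(y <- p)
  (if x.1 - y.1 == 0 then Re (x.2 * Num.conj y.2) else 0).
Proof.
rewrite /tnorm2 /tmean big_mkcond big_allpairs_dep; apply: eq_bigr => x _.
by rewrite big_map.
Qed.

Lemma trig_cat p q z : trig (p ++ q) z = trig p z + trig q z.
Proof. by rewrite /trig big_cat. Qed.

Lemma trig_scale a p z : trig (tscale a p) z = a * trig p z.
Proof.
by rewrite /trig big_map mulr_sumr; apply: eq_bigr => x _; rewrite mulrA.
Qed.

Lemma trig_mul p q z : `|z| = 1 -> trig (tmul p q) z = trig p z * trig q z.
Proof.
move=> z1; rewrite /trig big_allpairs_dep mulr_suml; apply: eq_bigr => x _.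
rewrite mulr_sumr; apply: eq_bigr => y _ /=.
by rewrite expfzDr ?norm1_neq0//; ring.
Qed.

Lemma trig_conj p z : `|z| = 1 -> trig (tconj p) z = Num.conj (trig p z).
Proof.
move=> z1; rewrite /trig big_map rmorph_sum; apply: eq_bigr => x _ /=.
by rewrite rmorphM /= conj_exprz.
Qed.

Lemma tmean_cat p q : tmean (p ++ q) = tmean p + tmean q.
Proof. by rewrite /tmean big_cat. Qed.

Lemma tmean_scale (r : R) p : tmean (tscale r%:C%C p) = r * tmean p.
Proof.
rewrite /tmean big_map mulr_sumr; apply: eq_bigr => x _.
by rewrite Re_mul /= mul0r subr0.
Qed.

(** The constant term is the average over sufficiently many roots of unity. *)
Lemma tmean_ge0 p : (forall z, `|z| = 1 -> 0 <= trig p z) -> 0 <= tmean p.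
Proof.
move=> hp; have [B hB] := list_bound p (fun i => i.1).
have [|w [w1 hw]] := @unity_averages R B.+1; first by [].
rewrite -(pmulr_rge0 _ (ltr0Sn R B)).
have -> : B.+1%:R * tmean p = \sum_(k < B.+1) Re (trig p (w k)).
  rewrite -Re_sum /trig exchange_big /= Re_sum /tmean mulr_sumr big_mkcond.
  apply: eq_big_seq => x /hB hx; rewrite -mulr_sumr hw//.
  case: eqP => _; last by rewrite mulr0.
  by rewrite -(rmorph_nat (real_complex R)) Re_mul /= mulr0 subr0 mulrC.
by apply: sumr_ge0 => k _; have := hp _ (w1 k); rewrite complex_ge0 => /andP[].
Qed.

Lemma tmean_le p q :
  (forall z, `|z| = 1 -> trig p z <= trig q z) -> tmean p <= tmean q.
Proof.
move=> h; have := @tmean_ge0 (q ++ tscale (-1)%:C%C p).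
rewrite tmean_cat tmean_scale mulN1r subr_ge0; apply=> z z1.
by rewrite trig_cat trig_scale rmorphN mulN1r subr_ge0 h.
Qed.

Definition unit_trig p := forall z, `|z| = 1 -> 0 <= trig p z <= 1.

Lemma mulr_conj z : z * Num.conj z = (normsq z)%:C%C.
Proof. by rewrite -normCK -normsqE. Qed.

Lemma trig_norm p z : `|z| = 1 ->
  trig (tmul p (tconj p)) z = (normsq (trig p z))%:C%C.
Proof. by move=> z1; rewrite trig_mul// trig_conj// mulr_conj. Qed.

Lemma unit_trig_normsq p z : unit_trig p -> `|z| = 1 ->
  (normsq (trig p z))%:C%C <= trig p z.
Proof.
move=> hp z1; have := hp _ z1; case: (trig p z) => a b.
rewrite !lecE /= => /andP[/andP[/eqP -> a0] /andP[_ a1]].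
by rewrite eqxx /normsq /= expr0n addr0 expr2 ler_piMl.
Qed.

Lemma unit_trig_le1 p z : unit_trig p -> `|z| = 1 -> normsq (trig p z) <= 1.
Proof.
move=> hp z1; rewrite -lecR; apply: le_trans (unit_trig_normsq hp z1) _.
by have /andP[] := hp _ z1.
Qed.

Lemma tnorm2_unit p : unit_trig p -> tnorm2 p <= tmean p.
Proof.
move=> hp; apply: tmean_le => z z1; rewrite trig_norm//.
exact: unit_trig_normsq.
Qed.

Lemma tnorm2_ge0 p : 0 <= tnorm2 p.
Proof. by apply: tmean_ge0 => z z1; rewrite trig_norm// ler0c normsq_ge0. Qed.

End TrigAlgebra.

(** * Polynomials of the dilation *)

Section TrigForm.
Context {R : realType} {H : hilbertType R}.
Implicit Types (T : H -> H) (v w : seq (int * H)) (p q : seq (int * R[i])) (h g : H).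

Lemma trig_form_cat (s : int -> H -> H) p q h :
  trig_form s (p ++ q) h = trig_form s p h + trig_form s q h.
Proof. by rewrite /trig_form big_cat. Qed.

Lemma trig_form_scale (s : int -> H -> H) (r : R) p h :
  trig_form s (tscale r%:C%C p) h = r * trig_form s p h.
Proof.
rewrite /trig_form big_map mulr_sumr; apply: eq_bigr => x _.
by rewrite -scalerA rdotZl.
Qed.

Lemma trig_form_le T p q h : linear_contraction T ->
  (forall z, `|z| = 1 -> trig p z <= trig q z) ->
  trig_form (zpow_op T) p h <= trig_form (zpow_op T) q h.
Proof.
move=> hT hpq; rewrite -subr_ge0.
have := @trig_form_ge0 _ _ T (q ++ tscale (-1)%:C%C p) h hT.
rewrite trig_form_cat trig_form_scale mulN1r; apply=> z z1.
by rewrite trig_cat trig_scale rmorphN mulN1r subr_ge0 hpq.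
Qed.

Lemma trig_form_eq T p q h : linear_contraction T ->
  (forall z, `|z| = 1 -> trig p z = trig q z) ->
  trig_form (zpow_op T) p h = trig_form (zpow_op T) q h.
Proof.
by move=> hT e; apply/eqP; rewrite eq_le !trig_form_le// => z /e ->.
Qed.

(** The vector-valued polynomial [p(z) h]. *)
Definition tens p h := [seq (x.1, x.2 *: h) | x <- p].

(** [<p(U) h, q(U) h>] is the value at [T] of [p] times the conjugate of [q]. *)
Lemma toeplitz_tens T p q h : linear_contraction T ->
  toeplitz (zpow_op T) (tens p h) (tens q h) =
  trig_form (zpow_op T) (tmul p (tconj q)) h.
Proof.
move=> hT; rewrite /toeplitz /trig_form /tmul big_map big_allpairs_dep.
apply: eq_bigr => x _; rewrite !big_map; apply: eq_bigr => y _ /=.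
by rewrite (complex_linear_zpow _ hT).2 rdotZJ scalerA mulrC.
Qed.

Lemma toeplitz_tens_le T p h (b : R) : linear_contraction T ->
  (forall z, `|z| = 1 -> normsq (trig p z) <= b) ->
  toeplitz (zpow_op T) (tens p h) (tens p h) <= b * sq h.
Proof.
move=> hT hb; rewrite toeplitz_tens//.
have -> : b * sq h = trig_form (zpow_op T) [:: (0, b%:C%C)] h.
  by rewrite /trig_form big_seq1 rdotZl.
apply: trig_form_le => // z z1; rewrite trig_norm//.
by rewrite /trig big_seq1 expr0z mulr1 lecR hb.
Qed.

Lemma toeplitz_tens_single T p h : linear_contraction T ->
  toeplitz (zpow_op T) (tens p h) [:: (0, h)] = trig_form (zpow_op T) p h.
Proof.
move=> hT; rewrite toeplitz_single /lproj /trig_form rdot_suml big_map.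
by apply: eq_bigr => x _; rewrite /= (complex_linear_zpow _ hT).2.
Qed.

(** Absolute continuity of the spectral measure of [T] at [h], expressed
    through polynomials: trigonometric polynomials with values in [[0, 1]] and
    small mean have small value at [T]. *)
Definition acont T h := forall e : R, 0 < e -> exists2 d : R, 0 < d &
  forall p, unit_trig p -> tmean p <= d -> trig_form (zpow_op T) p h <= e.

(** Vector form: [|p(U) h|^2] is the value of [|p|^2] at [T]. *)
Lemma acont_tens T h : linear_contraction T -> acont T h ->
  forall e : R, 0 < e -> exists2 d : R, 0 < d &
  forall p, (forall z, `|z| = 1 -> normsq (trig p z) <= 1) -> tnorm2 p <= d ->
    toeplitz (zpow_op T) (tens p h) (tens p h) <= e.
Proof.
move=> hT hac e e0; have [d d0 hd] := hac e e0.
exists d => // p hp pd; rewrite toeplitz_tens//; apply: hd => // z z1.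
by rewrite trig_norm// ler0c normsq_ge0 lecR hp.
Qed.

Lemma acont_dominated c T T' h : 0 < c ->
  (forall p, (forall z, `|z| = 1 -> 0 <= trig p z) ->
     trig_form (zpow_op T) p h <= c * trig_form (zpow_op T') p h) ->
  acont T' h -> acont T h.
Proof.
move=> c0 hc hac e e0; have [|d d0 hd] := hac (e / c); first by rewrite divr_gt0.
exists d => // p hp pd; apply: le_trans (hc _ _) _.
  by move=> z /hp/andP[].
by rewrite mulrC -ler_pdivlMr// hd.
Qed.

(** * Wandering vectors *)

(** The action of [p(U)] on a dilation vector. *)
Definition lmul p v := [seq (x.1 + y.1, x.2 *: y.2) | y <- v, x <- p].

Lemma toeplitz_lmul (s : int -> H -> H) p v :
  toeplitz s (lmul p v) (lmul p v) = \sum_(y <- v) \sum_(x <- p) \sum_(b <- v)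
    \sum_(a <- p) rdot (s (x.1 + y.1 - (a.1 + b.1)) (x.2 *: y.2)) (a.2 *: b.2).
Proof.
rewrite /toeplitz big_allpairs_dep; apply: eq_bigr => y _; apply: eq_bigr => x _.
by rewrite big_allpairs_dep.
Qed.

(** [v] has a bounded spectral density for the dilation of [T]. *)
Definition bounded_density T v := exists2 K : R, 0 <= K &
  forall p, toeplitz (zpow_op T) (lmul p v) (lmul p v) <= K * tnorm2 p.

(** Equality of formal sums as vector-valued polynomials. *)
Definition lsim v w := forall f : int -> H -> R,
  (forall n x y, f n (x + y) = f n x + f n y) ->
  \sum_(x <- v) f x.1 x.2 = \sum_(x <- w) f x.1 x.2.

Lemma toeplitz_lsim T p v w u : linear_contraction T -> lsim v w ->
  toeplitz (zpow_op T) (lmul p v) u = toeplitz (zpow_op T) (lmul p w) u.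
Proof.
move=> hT hvw; rewrite /toeplitz !big_allpairs_dep.
apply: (hvw (fun n h => \sum_(x <- p) \sum_(z <- u)
  rdot (zpow_op T (x.1 + n - z.1) (x.2 *: h)) z.2)) => n x y.
rewrite -big_split; apply: eq_bigr => a _; rewrite -big_split; apply: eq_bigr => b _.
by rewrite scalerDr (complex_linear_zpow _ hT).1 rdotDl.
Qed.

Lemma bounded_density_lsim T v w : linear_contraction T -> lsim v w ->
  bounded_density T v -> bounded_density T w.
Proof.
move=> hT hvw [K K0 hK]; exists K => // p.
by rewrite -(toeplitz_lsim _ _ hT hvw) toeplitz_sym// -(toeplitz_lsim _ _ hT hvw).
Qed.

Lemma bounded_density_cat T v w : linear_contraction T ->
  bounded_density T v -> bounded_density T w -> bounded_density T (v ++ w).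
Proof.
move=> hT [K K0 hK] [L L0 hL]; exists (2 * K + 2 * L); first by lra.
move=> p; rewrite [lmul p _]allpairs_cat -!/(lmul _ _).
have := toeplitz_ge0 (lmul p v ++ lscale (-1)%:C%C (lmul p w)) hT.
rewrite !toeplitz_catl !toeplitz_catr !toeplitz_scalel// !toeplitz_scaler//.
rewrite (toeplitz_sym (lmul p w) (lmul p v) hT).
have := hK p; have := hL p; lra.
Qed.

Lemma bounded_density_nil T : bounded_density T [::].
Proof. by exists 0 => // p; rewrite mul0r /toeplitz big_nil. Qed.

Definition lshift (m : int) v := [seq (m + x.1, x.2) | x <- v].

Lemma bounded_density_shift T m v : bounded_density T v -> bounded_density T (lshift m v).
Proof.
case=> K K0 hK; exists K => // p; apply: le_trans (hK p); rewrite le_eqVlt.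
apply/orP; left; apply/eqP; rewrite /toeplitz !big_allpairs_dep big_map.
apply: eq_bigr => y _; apply: eq_bigr => x _; rewrite !big_allpairs_dep big_map.
apply: eq_bigr => y' _; apply: eq_bigr => x' _ /=; congr (rdot (zpow_op _ _ _) _); ring.
Qed.

(** The left-hand side is the inner product of [U^d (U x - T x)] and
    [U y - T y]; it vanishes for [d <> 0]. *)
Lemma defect_correlation T (d : int) (x y : H) : linear_contraction T ->
  rdot (zpow_op T d x) y - rdot (zpow_op T (d + 1) x) (T y)
  - rdot (zpow_op T (d - 1) (T x)) y + rdot (zpow_op T d (T x)) (T y) =
  if d == 0 then rdot x y - rdot (T x) (T y) else 0.
Proof.
move=> hT; have hb := linear_contraction_bounded hT.
have adjl a b : rdot (adj T a) b = rdot a (T b) by rewrite rdotC -rdot_adj// rdotC.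
case: d => [[|k]|k].
- rewrite eqxx add0r sub0r (_ : - 1 = - 1%:Z)// zpowN_nat (_ : 1 = 1%:Z)//.
  by rewrite !zpow_nat /= adjl; ring.
- rewrite (_ : Posz k.+1 - 1 = k%:Z); last by lia.
  rewrite (_ : Posz k.+1 + 1 = k.+2%:Z); last by lia.
  by rewrite !zpow_nat -!iterSr /=; ring.
rewrite (_ : Negz k + 1 = - k%:Z); last by lia.
rewrite (_ : Negz k - 1 = - k.+2%:Z); last by lia.
by rewrite NegzE !zpowN_nat !iterS !adjl /=; ring.
Qed.

Lemma rdot_scaled (a b : R[i]) g : rdot (a *: g) (b *: g) = Re (a * Num.conj b) * sq g.
Proof.
by rewrite /rdot dotZl dotZr hdotxx mulrA [LHS]Re_mul /= mulr0 subr0.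
Qed.

(** [U g - T g] generates a wandering subspace of the dilation space, so its
    spectral density is constant. *)
Lemma bounded_density_defect T g : linear_contraction T ->
  bounded_density T [:: (1, g); (0, - T g)].
Proof.
move=> hT; exists (sq g - sq (T g)); first by rewrite subr_ge0 (lc_le hT).
move=> p; rewrite le_eqVlt; apply/orP; left; apply/eqP.
have Z n := (complex_linear_zpow n hT).2; have TZ := lcZ hT.
rewrite toeplitz_lmul tnorm2E mulr_sumr !big_cons big_nil addr0 -big_split.
apply: eq_bigr => x _; rewrite !big_cons !big_nil !addr0 -!big_split mulr_sumr.
apply: eq_bigr => y _ /=.
have := defect_correlation (x.1 - y.1) (x.2 *: g) (y.2 *: g) hT.
rewrite !TZ !rdot_scaled.
rewrite !addr0 (_ : x.1 + 1 - (y.1 + 1) = x.1 - y.1); last by ring.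
rewrite (_ : x.1 + 1 - y.1 = x.1 - y.1 + 1); last by ring.
rewrite (_ : x.1 - (y.1 + 1) = x.1 - y.1 - 1); last by ring.
have ZN n u : zpow_op T n (- u) = - zpow_op T n u.
  by have := Z n (- 1) u; rewrite !scaleN1r.
rewrite !scalerN !ZN !rdotNl !rdotNr opprK.
by case: ifP => _; lra.
Qed.

Lemma bounded_density_lneg T v : linear_contraction T ->
  bounded_density (adj T) v -> bounded_density T (lneg v).
Proof.
move=> hT [K K0 hK]; exists K => // p.
pose p' := [seq (- x.1, x.2) | x <- p].
have -> : lmul p (lneg v) = lneg (lmul p' v).
  rewrite /lmul /lneg map_allpairs allpairs_mapl allpairs_mapr.
  by apply: eq_allpairs => y x /=; rewrite opprD opprK.
have -> : tnorm2 p = tnorm2 p'.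
  rewrite !tnorm2E big_map; apply: eq_bigr => x _; rewrite big_map.
  by apply: eq_bigr => y _ /=; rewrite -opprD oppr_eq0.
by rewrite -toeplitz_lneg.
Qed.

(** [U^(k+1) g - T^(k+1) g] splits as [U (U^k g - T^k g)] plus the defect of
    [T^k g]. *)
Lemma bounded_density_power T (k : nat) g : linear_contraction T ->
  bounded_density T [:: (k%:Z, g); (0, - iter k T g)].
Proof.
move=> hT; elim: k => [|k IH].
  apply: bounded_density_lsim hT _ (bounded_density_nil T) => f fD.
  rewrite !big_cons !big_nil addr0 -fD subrr.
  by apply: (addrI (f 0 0)); rewrite -fD !addr0.
apply: (bounded_density_lsim hT _
  (bounded_density_cat hT (bounded_density_shift 1 IH)
     (bounded_density_defect (iter k T g) hT))) => f fD.
rewrite /= !big_cons !big_nil !addr0 /=.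
have f0 : f 1 0 = 0 by apply: (addrI (f 1 0)); rewrite -fD !addr0.
rewrite [f 1 (- _) + _]addrA -fD addNr f0 add0r (_ : 1 + k%:Z = k.+1%:Z)//.
Qed.

Lemma bounded_density_zpow T (n : int) g : linear_contraction T ->
  bounded_density T [:: (n, g); (0, - zpow_op T n g)].
Proof.
move=> hT; case: n => k; first exact: bounded_density_power.
have := bounded_density_lneg hT (bounded_density_power k.+1 g (linear_contraction_adj hT)).
by rewrite /lneg /= oppr0 NegzE.
Qed.

(** Hence the component of [q(U) h] orthogonal to [H] has a bounded density. *)
Lemma bounded_density_tens T q h : linear_contraction T ->
  bounded_density T (tens q h ++ [:: (0, - lproj T (tens q h))]).
Proof.
move=> hT; elim: q => [|x q IH].
  apply: bounded_density_lsim hT _ (bounded_density_nil T) => f fD.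
  rewrite big_cons !big_nil addr0 /= /lproj big_nil oppr0.
  by apply: (addrI (f 0 0)); rewrite -fD !addr0.
apply: (bounded_density_lsim hT _
  (bounded_density_cat hT (bounded_density_zpow x.1 (x.2 *: h) hT) IH)) => f fD.
rewrite big_cat /= !big_cons big_nil big_cat /= big_cat /= !big_cons !big_nil /=.
rewrite {2}/lproj big_cons -/(lproj _ _) /= opprD fD.
rewrite !addr0 -!addrA; congr (_ + _); rewrite addrCA; congr (_ + _); exact: addrC.
Qed.

End TrigForm.

(** * Transfer of absolute continuity to the dominating contraction *)

Section Transfer.
Context {R : realType} {H : hilbertType R}.
Implicit Types (T : H -> H) (v w : seq (int * H)) (p q : seq (int * R[i])) (h g : H).

Definition tmid p q := tscale (2^-1 : R)%:C%C (p ++ q).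
Definition tsub p q := p ++ tscale (- 1 : R)%:C%C q.

Lemma trig_sub p q z : trig (tsub p q) z = trig p z - trig q z.
Proof. by rewrite trig_cat trig_scale rmorphN mulN1r. Qed.

Lemma trig_mid p q z : trig (tmid p q) z = (trig p z + trig q z) / 2.
Proof. by rewrite trig_scale trig_cat fmorphV rmorph_nat mulrC. Qed.

Lemma tens_cat p q h : tens (p ++ q) h = tens p h ++ tens q h.
Proof. by rewrite /tens map_cat. Qed.

Lemma tens_scale a p h : tens (tscale a p) h = lscale a (tens p h).
Proof.
by rewrite /tens /lscale /tscale -!map_comp; apply: eq_map => x /=; rewrite scalerA.
Qed.

Lemma toeplitz_tens_eq T p q h : linear_contraction T ->
  (forall z, `|z| = 1 -> trig p z = trig q z) ->
  toeplitz (zpow_op T) (tens p h) (tens p h) = toeplitz (zpow_op T) (tens q h) (tens q h).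
Proof.
move=> hT e; rewrite !toeplitz_tens//; apply: trig_form_eq => // z z1.
by rewrite !trig_norm// e.
Qed.

(** Let [C d] be the class of polynomials [p] with values in [[0, 1]], mean at
    most [d], and value at least [e0] at [T], and let [s] be the limit as [d]
    tends to 0 of the infimum of [|p(U) h|^2] over [C d]. Two members of small
    classes with values close to [s] must be close to each other, because their
    midpoint is again in [C d] and cannot have a value much smaller than [s]
    (the parallelogram law). The set [E] collects the lower bounds of these
    values, so that [s] is its supremum. *)
Lemma concentration T h (e0 : R) : linear_contraction T ->
  (forall d : R, 0 < d -> exists p, [/\ unit_trig p, tmean p <= d &
     e0 <= trig_form (zpow_op T) p h]) ->
  forall e d0 : R, 0 < e -> 0 < d0 -> exists q,
    [/\ unit_trig q, tmean q <= d0, e0 <= trig_form (zpow_op T) q h &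
     forall d : R, 0 < d -> exists p, [/\ unit_trig p, tmean p <= d &
       toeplitz (zpow_op T) (tens (tsub q p) h) (tens (tsub q p) h) <= e]].
Proof.
move=> hT hC e d0 ep d0p.
pose C (d : R) p := [/\ unit_trig p, tmean p <= d & e0 <= trig_form (zpow_op T) p h].
pose N p := toeplitz (zpow_op T) (tens p h) (tens p h).
pose E := [set r : R | exists2 d : R, 0 < d & forall p, C d p -> r <= N p].
have N_ge0 p : 0 <= N p by exact: toeplitz_ge0.
have supE : has_sup E.
  split; first by exists 0, 1.
  exists (1 * sq h) => r [d dp hr]; have [p Cp] := hC _ dp.
  apply: le_trans (hr _ Cp) _; apply: toeplitz_tens_le => // z z1.
  by apply: unit_trig_le1 => //; case: Cp.
have e8 : 0 < e / 8 by lra.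
have [r [d1 d1p hr] rD] := sup_adherent e8 supE.
have near d : 0 < d -> exists2 p, C d p & N p < sup E + e / 8.
  move=> dp; apply: contrapT => hn.
  have : E (sup E + e / 8).
    exists d => // p Cp; rewrite leNgt; apply/negP => lt_N; apply: hn; exists p => //.
  by move=> /(ub_le_sup supE.2); lra.
have [|q [uq mq fq] Nq] := near (Num.min d0 d1); first by rewrite lt_min d0p.
exists q; split=> //; first by apply: le_trans mq _; rewrite ge_min lexx.
move=> d dp; have [|p [up mp fp] Np] := near (Num.min d d1); first by rewrite lt_min dp.
exists p; split=> //; first by apply: le_trans mp _; rewrite ge_min lexx.
have Cmid : C d1 (tmid p q).
  split.
  - move=> z z1; rewrite trig_mid.
    have /andP[a0 a1] := up _ z1; have /andP[b0 b1] := uq _ z1.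
    rewrite divr_ge0 ?addr_ge0//= ler_pdivrMr// mul1r.
    by rewrite -[2]/(1 + 1) lerD.
  - rewrite tmean_scale tmean_cat.
    have : tmean p <= d1 by apply: le_trans mp _; rewrite ge_min lexx orbT.
    have : tmean q <= d1 by apply: le_trans mq _; rewrite ge_min lexx orbT.
    lra.
  - rewrite trig_form_scale trig_form_cat; lra.
have := hr _ Cmid; rewrite /N /tmid /tsub !tens_scale !tens_cat !tens_scale.
have sym := toeplitz_sym (tens p h) (tens q h) hT.
rewrite !(toeplitz_scalel, toeplitz_scaler, toeplitz_catl, toeplitz_catr)//.
move: Np Nq; rewrite /N sym; lra.
Qed.

Lemma toeplitz_lmul_conj T p v w : linear_contraction T ->
  toeplitz (zpow_op T) (lmul p v) w = toeplitz (zpow_op T) v (lmul (tconj p) w).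
Proof.
move=> hT; rewrite /toeplitz big_allpairs_dep; apply: eq_bigr => y _.
rewrite big_allpairs_dep exchange_big; apply: eq_bigr => b _.
rewrite big_map; apply: eq_bigr => x _ /=.
rewrite (complex_linear_zpow _ hT).2 rdotZ.
by congr (rdot (zpow_op _ _ _) _); ring.
Qed.

Lemma lmul_single p h : lmul p [:: (0, h)] = tens p h.
Proof.
by rewrite /lmul /tens /= cats0; apply: eq_map => x; rewrite addr0.
Qed.

(** Let [y] be the component of [q(U) h] orthogonal to [H]. Then [|y|^2] is
    [<y, q(U) h>], which is close to [<y, p(U) h>] for polynomials [p] of
    arbitrarily small mean, and [<y, p(U) h>] is small because [y] has bounded
    spectral density: [|p(U) y|^2 <= K |p|^2] in [L^2]. *)
Lemma concentrated_in_space T h q (e : R) : linear_contraction T -> 0 < e ->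
  unit_trig q ->
  (forall d : R, 0 < d -> exists p, [/\ unit_trig p, tmean p <= d &
     toeplitz (zpow_op T) (tens (tsub q p) h) (tens (tsub q p) h) <= e]) ->
  (toeplitz (zpow_op T) (tens q h) (tens q h) - sq (lproj T (tens q h))) ^+ 2
    <= 4 * e * sq h.
Proof.
move=> hT e0 uq hq; set x := tens q h; set g := lproj T x.
pose y := x ++ [:: (0, - g)].
have [K K0 hK] := bounded_density_tens q h hT.
(* the mean of [p] is chosen after the density bound [K] of [y] *)
have [|p [up mp Np]] := hq (e / (K + 1)); first by rewrite divr_gt0//; lra.
have gN v : toeplitz (zpow_op T) v [:: (0, - g)] = - rdot (lproj T v) g.
  by rewrite toeplitz_single rdotNr.
have Ny : toeplitz (zpow_op T) y y = toeplitz (zpow_op T) x x - sq g.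
  rewrite toeplitz_catl !toeplitz_catr (toeplitz_sym _ x)// !gN.
  by rewrite /lproj big_seq1 /= rdotNl -/(lproj T x) -/g -/(sq g); ring.
have Byx : toeplitz (zpow_op T) y x = toeplitz (zpow_op T) x x - sq g.
  by rewrite toeplitz_catl (toeplitz_sym _ x)// gN.
rewrite -Byx.
have -> : toeplitz (zpow_op T) y x =
    toeplitz (zpow_op T) y (tens (tsub q (tconj p)) h) +
    toeplitz (zpow_op T) (lmul p y) [:: (0, h)].
  rewrite toeplitz_lmul_conj// lmul_single /tsub tens_cat tens_scale toeplitz_catr.
  by rewrite toeplitz_scaler//; ring.
have Nyh : toeplitz (zpow_op T) y y <= sq h.
  rewrite Ny; apply: (@le_trans _ _ (toeplitz (zpow_op T) x x)).
    have := sq_ge0 g; lra.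
  rewrite -[sq h]mul1r; apply: toeplitz_tens_le => // z z1; exact: unit_trig_le1.
have h1 := toeplitz_CS y (tens (tsub q (tconj p)) h) hT.
have h2 := toeplitz_CS (lmul p y) [:: (0, h)] hT.
rewrite toeplitz_single2 -/(sq h) in h2.
rewrite (toeplitz_tens_eq (q := tsub q p)) in h1 => //; last first.
  move=> z z1; rewrite !trig_sub trig_conj//; congr (_ - _).
  have := up _ z1; case: (trig p z) => a b; rewrite !lecE /= => /andP[/andP[/eqP -> _] _].
  by rewrite conjE /= oppr0.
have KN : toeplitz (zpow_op T) (lmul p y) (lmul p y) <= e.
  apply: le_trans (hK p) _; have := tnorm2_unit up.
  move=> /le_trans/(_ mp); rewrite ler_pdivlMr; last by lra.
  have := tnorm2_ge0 p; nra.
have s0 := sq_ge0 h; have N0 := toeplitz_ge0 (tens (tsub q p) h) hT.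
have Ny0 := toeplitz_ge0 y hT.
have h1' : toeplitz (zpow_op T) y (tens (tsub q (tconj p)) h) ^+ 2 <= e * sq h.
  apply: le_trans h1 _; rewrite mulrC; exact: ler_pM.
have h2' : toeplitz (zpow_op T) (lmul p y) [:: (0, h)] ^+ 2 <= e * sq h.
  by apply: le_trans h2 _; apply: ler_wpM2r.
have := sqr_ge0 (toeplitz (zpow_op T) y (tens (tsub q (tconj p)) h) -
   toeplitz (zpow_op T) (lmul p y) [:: (0, h)]).
lra.
Qed.

(** With [q] from [concentration] applied to [T'], the vector [q(U') h] is near
    some [g] in [H]. Domination makes [q(U) h - g] small, and [q(U) h] is small
    because [q] has small mean; so [g], and with it [q(U') h], is small, against
    the lower bound on the value of [q] at [T']. *)
Lemma acont_dominating c T T' h : 0 < c ->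
  linear_contraction T -> linear_contraction T' -> toeplitz_dominated c T T' ->
  acont T h -> acont T' h.
Proof.
move=> c0 hT hT' hc hac; apply: contrapT => /existsNP[e0 /not_implyP[e0p hn]].
have [|h0] := leP (sq h) 0.
  move=> /sq_eq0 h0; apply: hn; exists 1 => // p _ _.
  by rewrite /trig_form big1 ?ltW// => x _; rewrite h0 rdot0r.
have hC d : 0 < d -> exists p, [/\ unit_trig p, tmean p <= d &
     e0 <= trig_form (zpow_op T') p h].
  move=> dp; apply: contrapT => hp; apply: hn; exists d => // p up mp.
  by rewrite leNgt; apply/negP => lt_f; apply: hp; exists p; split=> //; exact: ltW.
(* [eta] makes the final bound [|q(U') h|^2 |h|^2 <= e0^2 / 2] *)
pose eta := e0 ^+ 2 / (2 * sq h * (3 + 2 * c)).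
have etap : 0 < eta.
  by rewrite divr_gt0 ?exprn_gt0// !mulr_gt0//; lra.
have [d0 d0p hd0] := acont_tens hT hac etap.
pose e := eta ^+ 2 / (4 * sq h).
have ep : 0 < e by rewrite divr_gt0 ?exprn_gt0//; lra.
have [q [uq mq fq hq]] := concentration hT' hC ep d0p.
have := concentrated_in_space hT' ep uq hq.
rewrite (_ : 4 * e * sq h = eta ^+ 2); last by rewrite /e; field; lra.
set x := tens q h; set g := lproj T' x => close.
pose y := x ++ [:: (0, - g)].
have NT : toeplitz (zpow_op T) x x <= eta.
  apply: hd0; last exact: le_trans (tnorm2_unit uq) mq.
  by move=> z z1; exact: unit_trig_le1.
have Ny S : linear_contraction S -> toeplitz (zpow_op S) y y =
    toeplitz (zpow_op S) x x - 2 * rdot (lproj S x) g + sq g.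
  move=> hS; rewrite toeplitz_catl !toeplitz_catr (toeplitz_sym _ x)//.
  rewrite toeplitz_single toeplitz_single2 rdotNr rdotNl rdotNr opprK -/(sq g); ring.
have Ny' : toeplitz (zpow_op T') y y <= eta.
  rewrite Ny// -/g -/(sq g); move: close.
  set a := toeplitz _ x x; move=> close.
  have : a - sq g <= eta.
    have [/le_trans|/ltW a0] := leP (a - sq g) 0; first by apply; exact: ltW.
    by rewrite -(@ler_pXn2r _ 2) ?nnegrE// ltW.
  lra.
have sg : sq g <= 2 * toeplitz (zpow_op T) x x + 2 * toeplitz (zpow_op T) y y.
  rewrite (Ny T hT).
  have := toeplitz_ge0 (lscale (2 : R)%:C%C x ++ [:: (0, - g)]) hT.
  rewrite toeplitz_catl !toeplitz_catr !toeplitz_scalel// toeplitz_scaler//.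
  rewrite (toeplitz_sym [:: (0, - g)])// toeplitz_scalel//.
  rewrite !toeplitz_single /lproj !big_seq1 /= -/(lproj T x).
  rewrite rdotNr rdotNl rdotNr opprK -/(sq g); lra.
have := hc y => hcy.
have Fq : e0 ^+ 2 <= toeplitz (zpow_op T') x x * sq h.
  apply: (@le_trans _ _ (trig_form (zpow_op T') q h ^+ 2)).
    by rewrite ler_pXn2r ?nnegrE// ?(le_trans _ fq)// ltW.
  rewrite -toeplitz_tens_single// [sq h](_ : _ = toeplitz (zpow_op T') [:: (0, h)] [:: (0, h)]).
    exact: toeplitz_CS.
  by rewrite toeplitz_single2.
have Nx : toeplitz (zpow_op T') x x <= (3 + 2 * c) * eta.
  have := Ny T' hT'; rewrite -/g -/(sq g) => E.
  have : c * toeplitz (zpow_op T') y y <= c * eta by rewrite ler_pM2l.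
  lra.
have : e0 ^+ 2 <= e0 ^+ 2 / 2.
  apply: le_trans Fq _; apply: (@le_trans _ _ ((3 + 2 * c) * eta * sq h)).
    by rewrite ler_pM2r.
  by rewrite le_eqVlt; apply/orP; left; apply/eqP; rewrite /eta; field; lra.
have := exprn_gt0 2 e0p; lra.
Qed.

End Transfer.

(** * Arc length on the circle *)

Section CircleMeasure.
Context {R : realType}.
Local Notation lam := (@lebesgue_measure R).

Lemma circle_exp_proof (t : R) :
  ((cos t +i* sin t)%C : R[i]^o) \in [set z : R[i]^o | `|z| = 1].
Proof. by rewrite inE /= normc_def /= cos2Dsin2 sqrtr1. Qed.

Definition circle_exp (t : R) : borel_circle R :=
  (exist _ (cos t +i* sin t)%C (circle_exp_proof t) : circle R).

Definition cval (z : borel_circle R) : R[i] := set_val (z : circle R).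

Lemma cval_exp t : cval (circle_exp t) = (cos t +i* sin t)%C.
Proof. by []. Qed.

Lemma cval_norm z : `|cval z| = 1.
Proof. by case: z => z hz; exact: (set_mem hz). Qed.

Lemma cval_inj : injective cval.
Proof. exact: val_inj. Qed.

Lemma circle_exp_continuous : continuous (circle_exp : R -> circle R).
Proof.
apply: (@continuous_comp_initial _ _ _ (set_val : circle R -> R[i]^o)).
move=> t; apply/(@cvgrPdist_lt _ R[i]^o) => e e0.
have eE : e = (Re e)%:C%C by rewrite RRe_real// realE ltW.
have e1 : 0 < Re e by rewrite -ltcR -eE.
have e2 : 0 < Re e / 2 by lra.
have hc := (cvgrPdist_lt _ _).1 (@continuous_cos R t) _ e2.
have hs := (cvgrPdist_lt _ _).1 (@continuous_sin R t) _ e2.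
near=> s.
rewrite eE /= -(@ltr_pXn2r _ 2) ?nnegrE ?normr_ge0 ?ler0c ?(ltW e1)//.
rewrite -normsqE -rmorphXn ltcR /normsq /=.
have sq_lt (x : R) : `|x| < Re e / 2 -> x ^+ 2 < (Re e / 2) ^+ 2.
  by move=> xe; rewrite -real_normK ?num_real// ltr_pXn2r ?nnegrE ?normr_ge0 ?(ltW e2).
have h1 : (cos t - cos s) ^+ 2 < (Re e / 2) ^+ 2 by apply: sq_lt; near: s; exact: hc.
have h2 : (sin t - sin s) ^+ 2 < (Re e / 2) ^+ 2 by apply: sq_lt; near: s; exact: hs.
move: h1 h2; nra.
Unshelve. all: by end_near.
Qed.

Lemma measurable_circle_exp : measurable_fun setT circle_exp.
Proof.
apply: (@measurability _ _ _ (borel_circle R) setT circle_exp (@open (circle R))) => //.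
move=> _ [U oU <-]; rewrite setTI; apply: open_measurable.
by move/continuousP: circle_exp_continuous; apply.
Qed.

(** Covers the real and the imaginary part at once. *)
Lemma contractive_cval_measurable (f : R[i] -> R) :
  (forall a b, (f a - f b) ^+ 2 <= normsq (a - b)) ->
  measurable_fun setT (fun z => f (cval z)).
Proof.
move=> hf; apply: (measurability _ (RGenOpens.measurableE R)).
move=> _ [_ [a [b ->] <-]]; rewrite setTI; apply: sub_sigma_algebra.
have c : continuous (f \o (set_val : circle R -> R[i]^o)).
  move=> z; apply: continuous_comp; first exact: initial_continuous.
  apply/(@cvgrPdist_lt _ _ _ _ (@nbhs_filter R[i]^o (set_val z))) => e e0.
  have e1 : 0 < e%:C%C by rewrite ltcR.
  have := @nbhsx_ballx _ R[i]^o (set_val z) _ e1; apply: filterS => w.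
  rewrite -ball_normE /= -(@ltr_pXn2r _ 2) ?nnegrE ?normr_ge0 ?ler0c ?(ltW e0)//.
  rewrite -normsqE -rmorphXn ltcR => zw.
  rewrite -(@ltr_pXn2r _ 2) ?nnegrE ?normr_ge0 ?(ltW e0)// real_normK ?num_real//.
  exact: le_lt_trans (hf _ _) zw.
by move/continuousP: c; apply; exact: interval_open.
Qed.

Definition cpow (n : int) (z : borel_circle R) : R[i] := cval z ^ n.

Lemma cpowS (n : nat) z : cpow n.+1 z = cval z * cpow n z.
Proof. by rewrite /cpow exprSz. Qed.

Lemma cpowN n z : cpow (- n) z = Num.conj (cpow n z).
Proof. by rewrite /cpow conj_exprz// cval_norm. Qed.

Lemma measurable_cpow n : measurable_fun setT (fun z => Re (cpow n z)) /\
  measurable_fun setT (fun z => Im (cpow n z)).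
Proof.
have mR : measurable_fun setT (fun z => Re (cval z)).
  by apply: contractive_cval_measurable => a b; rewrite /normsq Re_add Re_opp lerDl sqr_ge0.
have mI : measurable_fun setT (fun z => Im (cval z)).
  by apply: contractive_cval_measurable => a b; rewrite /normsq Im_add Im_opp lerDr sqr_ge0.
have nat_case (k : nat) : measurable_fun setT (fun z => Re (cpow k z)) /\
    measurable_fun setT (fun z => Im (cpow k z)).
  elim: k => [|k [IHr IHi]]; first by split; exact: measurable_cst.
  split.
    under eq_fun do rewrite cpowS Re_mul.
    by apply: measurable_funB; apply: measurable_funM.
  under eq_fun do rewrite cpowS Im_mul.
  by apply: measurable_funD; apply: measurable_funM.
case: n => k; first exact: nat_case.
have [hr hi] := nat_case k.+1; rewrite NegzE; split.
  by under eq_fun do rewrite cpowN Re_conjC.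
by under eq_fun do rewrite cpowN Im_conjC; apply: measurableT_comp.
Qed.

Lemma norm_Re_Im_le1 (a : R[i]) : `|a| = 1 -> `|Re a| <= 1 /\ `|Im a| <= 1.
Proof.
move=> /norm1_normsq; rewrite /normsq => h.
have := sqr_ge0 (Re a); have := sqr_ge0 (Im a) => i0 r0.
by split; rewrite -(@ler_pXn2r _ 2) ?nnegrE ?normr_ge0// real_normK ?num_real// expr1n; lra.
Qed.

Lemma cpow_norm n z : `|cpow n z| = 1.
Proof. by rewrite norm1_exprz// cval_norm. Qed.

Lemma trig_measurable p : measurable_fun setT (fun z => Re (trig p (cval z))).
Proof.
elim: p => [|x p IH].
  by under eq_fun do rewrite /trig big_nil /=; exact: measurable_cst.
under eq_fun do rewrite /trig big_cons -/(trig p _) Re_add Re_mul.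
have [mr mi] := measurable_cpow x.1.
by apply: measurable_funD => //; apply: measurable_funB; apply: measurable_funM.
Qed.

End CircleMeasure.

(** * Integration of trigonometric polynomials *)

Section TrigIntegral.
Context {R : realType} d {T : measurableType d}.
Variables (mu : {measure set T -> \bar R}) (phi : T -> borel_circle R).
Hypothesis mphi : measurable_fun setT phi.
Variable D : set T.
Hypotheses (mD : measurable D) (finD : (mu D < +oo)%E).

Lemma finite_integrable (f : T -> R) (b : R) :
  measurable_fun setT f -> (forall z, `|f z| <= b) -> mu.-integrable D (EFin \o f).
Proof.
move=> mf hf; apply: measurable_bounded_integrable => //.
  exact: measurable_funTS.
exists b; split; first by rewrite num_real.
by move=> x bx z _; apply: le_trans (hf z) (ltW bx).
Qed.

Section Weighted.
Variables (g : T -> R) (b : R).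
Hypotheses (mg : measurable_fun setT g) (gb : forall t, `|g t| <= b).

Lemma integrable_weighted_cpow n :
  mu.-integrable D (EFin \o (fun t => g t * Re (cpow n (phi t)))) /\
  mu.-integrable D (EFin \o (fun t => g t * Im (cpow n (phi t)))).
Proof.
have [mr mi] := measurable_cpow (R := R) n.
have le1 z : `|g z * Re (cpow n (phi z))| <= b /\ `|g z * Im (cpow n (phi z))| <= b.
  have [hr hi] := norm_Re_Im_le1 (cpow_norm n (phi z)).
  have b0 := le_trans (normr_ge0 _) (gb z).
  by rewrite !normrM -[b]mulr1; split; apply: ler_pM.
split; apply: (@finite_integrable _ b) => [|z].
- by apply: measurable_funM => //; exact: (measurableT_comp mr mphi).
- exact: (le1 z).1.
- by apply: measurable_funM => //; exact: (measurableT_comp mi mphi).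
- exact: (le1 z).2.
Qed.

Lemma Rintegral_weighted_trig p :
  mu.-integrable D (EFin \o (fun t => g t * Re (trig p (cval (phi t))))) /\
  Rintegral mu D (fun t => g t * Re (trig p (cval (phi t)))) =
  \sum_(x <- p) (Re x.2 * Rintegral mu D (fun t => g t * Re (cpow x.1 (phi t))) -
                 Im x.2 * Rintegral mu D (fun t => g t * Im (cpow x.1 (phi t)))).
Proof.
elim: p => [|x p [IHi IH]].
  rewrite big_nil.
  have -> : (fun t => g t * Re (trig [::] (cval (phi t)))) = cst (0 : R).
    by apply/funext => z; rewrite /trig big_nil mulr0.
  split; first by apply: (@finite_integrable _ 0) => // z; rewrite normr0.
  by rewrite Rintegral_cst// mul0r.
have [ir ii] := integrable_weighted_cpow x.1.
have E : (fun t => g t * Re (trig (x :: p) (cval (phi t)))) =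
    (fun t => (Re x.2 * (g t * Re (cpow x.1 (phi t))) -
               Im x.2 * (g t * Im (cpow x.1 (phi t))))
              + g t * Re (trig p (cval (phi t)))).
  by apply/funext => z; rewrite /trig big_cons Re_add Re_mul /cpow; ring.
have ir' : mu.-integrable D (EFin \o (fun t => Re x.2 * (g t * Re (cpow x.1 (phi t))))).
  by under [X in _.-integrable _ X]eq_fun do rewrite /= EFinM; apply: integrableZl.
have ii' : mu.-integrable D (EFin \o (fun t => Im x.2 * (g t * Im (cpow x.1 (phi t))))).
  by under [X in _.-integrable _ X]eq_fun do rewrite /= EFinM; apply: integrableZl.
have i2 : mu.-integrable D (EFin \o (fun t => Re x.2 * (g t * Re (cpow x.1 (phi t))) -
    Im x.2 * (g t * Im (cpow x.1 (phi t))))).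
  by under [X in _.-integrable _ X]eq_fun do rewrite /= EFinB; apply: integrableB.
rewrite E big_cons; split.
  by under [X in _.-integrable _ X]eq_fun do rewrite /= EFinD; apply: integrableD.
by rewrite RintegralD// IH RintegralB// !RintegralZl.
Qed.

End Weighted.

Lemma Rintegral_trig p :
  mu.-integrable D (EFin \o (fun t => Re (trig p (cval (phi t))))) /\
  Rintegral mu D (fun t => Re (trig p (cval (phi t)))) =
  \sum_(x <- p) (Re x.2 * Rintegral mu D (fun t => Re (cpow x.1 (phi t))) -
                 Im x.2 * Rintegral mu D (fun t => Im (cpow x.1 (phi t)))).
Proof.
have b1 (t : T) : `|cst (1 : R) t| <= 1 by rewrite normr1.
have E (f : T -> R) : (fun t => cst 1 t * f t) = f by apply/funext => t; rewrite mul1r.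
have m1 : measurable_fun setT (cst (1 : R) : T -> R) by exact: measurable_cst.
have [] := Rintegral_weighted_trig m1 b1 p.
rewrite E => hi ->; split=> //; apply: eq_bigr => x _; by rewrite !E.
Qed.

End TrigIntegral.

Section ArcMoments.
Context {R : realType}.
Local Notation lam := (@lebesgue_measure R).

Definition turn : set R := `[0, 2 * pi[%classic.

Lemma measurable_turn : measurable turn.
Proof. exact: measurable_itv. Qed.

Lemma turn_measure : lam turn = (2 * pi)%:E.
Proof.
by rewrite lebesgue_measure_itv /= lte_fin mulr_gt0 ?pi_gt0// -EFinB subr0.
Qed.

Lemma turn_finite : (lam turn < +oo)%E.
Proof. by rewrite turn_measure ltry. Qed.

Lemma cpow_exp (k : nat) (t : R) :
  cpow k (circle_exp t) = (cos (k%:R * t) +i* sin (k%:R * t))%C.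
Proof.
elim: k => [|k IH]; first by rewrite mul0r cos0 sin0.
rewrite cpowS IH -natr1 mulrDl mul1r cosD sinD cval_exp.
by apply: complex_eq; rewrite ?Re_mul ?Im_mul /=; ring.
Qed.

Lemma cpow_exp_2pi (k : nat) : cpow k (circle_exp (2 * pi : R)) = 1.
Proof.
elim: k => [|k IH]; first by [].
by rewrite cpowS IH mulr1 cval_exp mulr_natl cos2pi sin2pi.
Qed.

Lemma Rintegral_turn (F f : R -> R) :
  (forall t, is_derive t (1 : R) F (f t)) -> continuous f ->
  Rintegral lam turn f = F (2 * pi) - F 0.
Proof.
move=> dF cf.
have p0 : 0 < 2 * pi :> R by rewrite mulr_gt0 ?pi_gt0.
rewrite Rintegral_itv_bndo_bndc; last first.
  have := @integrableS _ _ R lam `[0, 2 * pi]%classic `[0, 2 * pi[%classic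
    (EFin \o f) (measurable_itv _) (measurable_itv _).
  apply => //.
    by apply: subset_itvl; rewrite bnd_simp.
  apply: continuous_compact_integrable; first exact: segment_compact.
  exact: continuous_subspaceT.
rewrite /Rintegral (@continuous_FTC2 _ f F)//.
- exact: continuous_subspaceT.
- split=> [x _||].
  + by have [] := dF x.
  + apply: cvg_at_right_filter; apply: differentiable_continuous.
    by apply/derivable1_diffP; have [] := dF 0.
  + apply: cvg_at_left_filter; apply: differentiable_continuous.
    by apply/derivable1_diffP; have [] := dF (2 * pi).
- by move=> x _; rewrite derive1E; have [] := dF x.
Qed.

Lemma turn_moments (n : int) :
  Rintegral lam turn (fun t => Re (cpow n (circle_exp t))) = (if n == 0 then 2 * pi else 0) /\
  Rintegral lam turn (fun t => Im (cpow n (circle_exp t))) = 0.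
Proof.
have dlin (c t : R) : is_derive t (1 : R) (fun x : R => c * x) c.
  by apply: is_derive_eq; rewrite /GRing.scale /= mulr1.
have dsin (k : nat) : k%:R != 0 :> R -> forall t : R,
    is_derive t (1 : R) (fun t => k%:R^-1 * sin (k%:R * t)) (cos (k%:R * t)).
  move=> kn0 t; have h := is_derive1_comp (is_derive_sin (k%:R * t)) (dlin k%:R t).
  apply: (@is_derive_eq _ _ _ _ _ _ _ _ (is_deriveZ k%:R^-1 h)).
  by rewrite /GRing.scale /=; field.
have dcos (k : nat) : k%:R != 0 :> R -> forall t : R,
    is_derive t (1 : R) (fun t => - k%:R^-1 * cos (k%:R * t)) (sin (k%:R * t)).
  move=> kn0 t; have h := is_derive1_comp (is_derive_cos (k%:R * t)) (dlin k%:R t).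
  apply: (@is_derive_eq _ _ _ _ _ _ _ _ (is_deriveZ (- k%:R^-1) h)).
  by rewrite /GRing.scale /=; field.
have nat_case (k : nat) :
    Rintegral lam turn (fun t => Re (cpow k (circle_exp t))) = (if k == 0%N then 2 * pi else 0) /\
    Rintegral lam turn (fun t => Im (cpow k (circle_exp t))) = 0.
  have [->|k0] := eqVneq k 0%N.
    split; last by rewrite Rintegral_cst ?mul0r//; exact: measurable_turn.
    rewrite Rintegral_cst; last exact: measurable_turn.
    by rewrite mul1r; exact: (congr1 fine turn_measure).
  have kn0 : k%:R != 0 :> R by rewrite pnatr_eq0.
  have [hc hs] : cos (k%:R * (2 * pi)) = 1 :> R /\ sin (k%:R * (2 * pi)) = 0 :> R.
    by have := cpow_exp_2pi k; rewrite cpow_exp => -[-> ->].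
  split.
    under eq_Rintegral do rewrite cpow_exp /=.
    rewrite (Rintegral_turn (F := fun t => k%:R^-1 * sin (k%:R * t)) (dsin k kn0)).
      by rewrite hs mulr0 mulr0 sin0 mulr0 subrr.
    move=> t; apply: continuous_comp; last exact: continuous_cos.
    exact: mulrl_continuous.
  under eq_Rintegral do rewrite cpow_exp /=.
  rewrite (Rintegral_turn (F := fun t => - k%:R^-1 * cos (k%:R * t)) (dcos k kn0)).
    by rewrite hc mulr0 cos0 subrr.
  move=> t; apply: continuous_comp; last exact: continuous_sin.
  exact: mulrl_continuous.
case: n => k; first exact: nat_case.
have [hr hi] := nat_case k.+1; rewrite NegzE; split.
  by under eq_Rintegral do rewrite cpowN Re_conjC; rewrite hr.
under eq_Rintegral do rewrite cpowN Im_conjC -mulN1r.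
rewrite RintegralZl ?hi ?mulr0//; first exact: measurable_turn.
apply: (@finite_integrable R _ _ lam turn measurable_turn turn_finite _ 1).
  exact: (measurableT_comp (measurable_cpow (R := R) k.+1).2 measurable_circle_exp).
by move=> t; have [] := norm_Re_Im_le1 (cpow_norm k.+1 (circle_exp t)).
Qed.

End ArcMoments.

(** * Absolute continuity in terms of trigonometric polynomials *)

Section SpectralMeasure.
Context {R : realType} {H : hilbertType R}.
Local Notation lam := (@lebesgue_measure R).
Implicit Types (T : H -> H) (p : seq (int * R[i])) (h : H).

Definition arcset (S : set (borel_circle R)) : set R := turn `&` circle_exp @^-1` S.

Lemma measurable_arcset S : measurable S -> measurable (arcset S).
Proof.
move=> mS; apply: measurableI; first exact: measurable_turn.
by rewrite -[X in measurable X]setTI; apply: measurable_circle_exp.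
Qed.

Lemma arc_lengthE S : arc_length S = lam (arcset S).
Proof.
rewrite /arc_length; congr (lam _); apply/seteqP; split=> t /=.
  move=> [t01 [z Sz hz]]; split; first by rewrite /turn /= in_itv /=; lra.
  have zE : z = circle_exp t by apply: cval_inj; rewrite cval_exp -hz.
  by rewrite zE in Sz.
rewrite /arcset /turn /= in_itv /= => -[/andP[t0 t1] St].
by split; [rewrite t0 t1|exists (circle_exp t)].
Qed.

Lemma arc_length_lt S : measurable S -> (lam (arcset S) < +oo)%E.
Proof.
move=> mS; apply: le_lt_trans (turn_finite (R := R)); apply: le_measure.
- by rewrite inE; exact: measurable_arcset.
- by rewrite inE; exact: measurable_turn.
- exact: subIsetl.
Qed.

Lemma Rintegral_turn_trig p :
  Rintegral lam turn (fun t => Re (trig p (cval (circle_exp t)))) = 2 * pi * tmean p.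
Proof.
have [_ ->] := @Rintegral_trig R _ _ lam circle_exp measurable_circle_exp turn
  measurable_turn turn_finite p.
rewrite /tmean mulr_sumr [RHS]big_mkcond; apply: eq_bigr => x _.
have [-> ->] := turn_moments (R := R) x.1.
by case: ifP => _; ring.
Qed.

Section Chebyshev.
Context d {X : measurableType d} (mu : {measure set X -> \bar R}) (D : set X).
Hypotheses (mD : measurable D) (finD : (mu D < +oo)%E).

Lemma integrable_indic_fin E : measurable E -> mu.-integrable D (EFin \o \1_E).
Proof.
move=> mE; apply: (finite_integrable mD finD (b := 1)).
  exact: measurable_indic.
by move=> z; rewrite indicE; case: (z \in E); rewrite ?normr1 ?normr0.
Qed.

Lemma Rintegral_indic E : measurable E ->
  Rintegral mu D \1_E = fine (mu (E `&` D)).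
Proof. by move=> mE; rewrite /Rintegral integral_indic. Qed.

Lemma chebyshev_le (f : X -> R) (eta : R) E : measurable E ->
  mu.-integrable D (EFin \o f) -> (forall x, D x -> 0 <= f x) ->
  (forall x, E x -> eta <= f x) ->
  eta * fine (mu (E `&` D)) <= Rintegral mu D f.
Proof.
move=> mE intf f0 fE; rewrite -Rintegral_indic// -RintegralZl//; last exact: integrable_indic_fin.
apply: le_Rintegral => //.
  by under [X in _.-integrable _ X]eq_fun do rewrite /= EFinM;
    apply: integrableZl => //; exact: integrable_indic_fin.
move=> x Dx; case: (boolP (x \in E)) => xE; last by rewrite mulr0 f0.
by rewrite mulr1 fE//; exact: set_mem.
Qed.

Lemma chebyshev_ge (f : X -> R) (eta : R) E : measurable E -> 0 <= eta ->
  mu.-integrable D (EFin \o f) -> (forall x, f x <= 1) ->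
  (forall x, ~ E x -> f x <= eta) ->
  Rintegral mu D f <= fine (mu (E `&` D)) + eta * fine (mu D).
Proof.
move=> mE eta0 intf f1 fE; rewrite -Rintegral_indic// -Rintegral_cst//.
rewrite -RintegralD//; [|exact: integrable_indic_fin|].
  apply: le_Rintegral => //.
    under [X in _.-integrable _ X]eq_fun do rewrite /= EFinD.
    apply: integrableD => //; first exact: integrable_indic_fin.
    exact: (finite_integrable mD finD (b := `|eta|)).
  move=> x Dx; case: (boolP (x \in E)) => xE.
    by apply: le_trans (f1 x) _; rewrite lerDl.
  by rewrite add0r fE// => Ex; move: xE; rewrite mem_set.
exact: (finite_integrable mD finD (b := `|eta|)).
Qed.

End Chebyshev.

(** Suppose that polynomials [P k] with values in [[0, 1]] have integral above
    [e] and summable means. The sets where [P k > eta] then have summable arc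
    length, so their limit superior is null, while its [m]-measure is at least
    [e / 2]. *)
Lemma null_trig_small (m : {finite_measure set (borel_circle R) -> \bar R}) :
  (forall S, measurable S -> arc_length S = 0%E -> m S = 0%E) ->
  forall e : R, 0 < e -> exists2 d : R, 0 < d &
  forall p, unit_trig p -> tmean p <= d ->
    Rintegral m setT (fun z => Re (trig p (cval z))) <= e.
Proof.
move=> hm e e0; apply: contrapT => hn.
pose mt := fine (m setT).
have mt0 : 0 <= mt by rewrite fine_ge0.
(* below the level [eta], a polynomial contributes at most [e / 2] to its integral *)
pose eta := e / (2 * (mt + 1)).
have eta0 : 0 < eta by rewrite divr_gt0//; lra.
have pi0 : 0 < pi :> R := pi_gt0 R.
pose d (k : nat) := eta / (2 * pi) * (1 / (2 ^ k.+1)%:R) : R.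
have d0 k : 0 < d k.
  have p2 : 0 < (2 ^ k.+1)%:R :> R by rewrite ltr0n expn_gt0.
  exact: (mulr_gt0 (divr_gt0 eta0 (mulr_gt0 (ltr0Sn R 1) pi0)) (divr_gt0 ltr01 p2)).
have /choice [P hP] : forall k, exists p, [/\ unit_trig p, tmean p <= d k &
    e < Rintegral m setT (fun z => Re (trig p (cval z)))].
  move=> k; apply: contrapT => hp; apply: hn; exists (d k) => // p up mp.
  by rewrite leNgt; apply/negP => lt_e; apply: hp; exists p.
pose f k z := Re (trig (P k) (cval z)).
have f01 k z : 0 <= f k z <= 1.
  have [up _ _] := hP k; have := up _ (cval_norm z).
  by rewrite /f; case: (trig _ _) => a b; rewrite !lecE /= => /andP[/andP[_ ->] /andP[_ ->]].
have mf k : measurable_fun setT (f k) by exact: trig_measurable.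
pose S k := [set z | eta < f k z].
have mS k : measurable (S k).
  rewrite (_ : S k = f k @^-1` `]eta, +oo[%classic); last first.
    by apply/seteqP; split=> z /=; rewrite /S /= in_itv /= andbT.
  by rewrite -[X in measurable X]setTI; apply: (mf k) => //; exact: measurable_itv.
have finm : (m setT < +oo)%E by exact: fin_num_fun_lty (fin_num_measure m).
have etamt : eta * mt <= e / 2.
  rewrite /eta -subr_ge0 (_ : _ - _ = e / (2 * (mt + 1))); first exact: ltW.
  by field; lra.
have mmS k : ((e / 2)%:E <= m (S k))%E.
  have [_ _ he] := hP k.
  have [int_f _] := @Rintegral_trig R _ _ m id (@measurable_id _ _ setT) setT measurableT finm (P k).
  have := @chebyshev_ge _ _ m setT measurableT finm (f k) eta (S k) (mS k) (ltW eta0) int_f.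
  rewrite setIT -/mt => h.
  rewrite -(@fineK _ (m (S k))) ?fin_num_measure// lee_fin.
  have : Rintegral m setT (f k) <= fine (m (S k)) + eta * mt.
    apply: h => [z|z Sz]; first by have /andP[] := f01 k z.
    by rewrite leNgt; apply/negP => /Sz.
  move: he; rewrite -/(f k); lra.
have lamS k : (lam (arcset (S k)) <= (1 / (2 ^ k.+1)%:R)%:E)%E.
  have [_ mp _] := hP k.
  have [int_f _] := @Rintegral_trig R _ _ lam circle_exp measurable_circle_exp turn
     measurable_turn turn_finite (P k).
  have := @chebyshev_le _ _ lam turn measurable_turn turn_finite _ eta
    (circle_exp @^-1` S k) _ int_f.
  rewrite setIC -/(arcset (S k)) Rintegral_turn_trig => h.
  rewrite -(@fineK _ (lam (arcset (S k)))); last first.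
    by rewrite ge0_fin_numE ?measure_ge0// arc_length_lt.
  rewrite lee_fin -(ler_pM2l eta0); apply: le_trans (h _ _ _) _.
  - by rewrite -[X in measurable X]setTI; apply: measurable_circle_exp.
  - by move=> t _; have /andP[] := f01 k (circle_exp t).
  - by move=> t /ltW.
  rewrite -ler_pdivlMl ?mulr_gt0//; apply: le_trans mp _.
  by rewrite /d [leRHS]mulrA [eta / _]mulrC.
have lim0 : lam (lim_sup_set (fun k => arcset (S k))) = 0%E.
  apply: lim_sup_set_cvg0 => [k|]; first exact: measurable_arcset.
  apply: (@le_lt_trans _ _ 1%:E); last by rewrite ltry.
  apply: le_trans (epsilon_trick0 xpredT ler01).
  by apply: lee_nneseries => [k _ _|k _]; [exact: measure_ge0|exact: lamS].
have arclim : arcset (lim_sup_set S) = lim_sup_set (fun k => arcset (S k)).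
  apply/seteqP; split=> t.
    by move=> [tt hS] n _; have [j nj Sj] := hS n I; exists j.
  move=> hS; split; first by have [j _ []] := hS 0%N I.
  by move=> n _; have [j nj [_ Sj]] := hS n I; exists j.
have mlimS : measurable (lim_sup_set S).
  by apply: bigcap_measurable => // k _; apply: bigcup_measurable.
have ml0 : m (lim_sup_set S) = 0%E.
  by apply: hm => //; rewrite arc_lengthE arclim.
have mU n : measurable (\bigcup_(k >= n) S k) by apply: bigcup_measurable.
have finU : (m (\bigcup_(k >= 0) S k) < +oo)%E by rewrite ltey_eq fin_num_measure.
have cv := lim_sup_set_cvg m S mS finU.
have : ((e / 2)%:E <= 0)%E.
  rewrite -ml0 -(cvg_lim _ cv)//; apply: lime_ge.
    by apply/cvg_ex; eexists; exact: cv.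
  apply: nearW => n; apply: le_trans (mmS n) _.
  by apply: le_measure; rewrite ?inE//; apply: bigcup_sup => /=.
by rewrite lee_fin; lra.
Qed.

Lemma measure_sum_Rintegral
    (m m0 m2 : {finite_measure set (borel_circle R) -> \bar R}) (f : borel_circle R -> R) b :
  measurable_fun setT f -> (forall z, `|f z| <= b) ->
  (forall S, measurable S -> fine (m0 S) = fine (m S) + fine (m2 S)) ->
  Rintegral m0 setT f = Rintegral m setT f + Rintegral m2 setT f.
Proof.
move=> mf hb hm.
have fin (mu : {finite_measure set (borel_circle R) -> \bar R}) :
    (mu setT < +oo)%E by exact: fin_num_fun_lty (fin_num_measure mu).
have int (mu : {finite_measure set (borel_circle R) -> \bar R}) :
    mu.-integrable setT (EFin \o f).
  exact: (@finite_integrable R _ _ mu setT measurableT (fin mu) f b).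
rewrite /Rintegral -fineD; [|by apply: integrable_fin_num (int m)|
  by apply: integrable_fin_num (int m2)].
rewrite -(integral_measure_add measurableT (int m) (int m2)).
congr fine; apply: eq_measure_integral => A mA _.
rewrite [RHS]measure_addE; transitivity ((fine (m0 A))%:E).
  by rewrite fineK ?fin_num_measure.
rewrite hm// EFinD.
by rewrite !fineK ?fin_num_measure.
Qed.

(** A decomposition [m0 + i m1 - m2 - i m3] of a positive measure [m] has
    [m0 = m + m2] and [m1 = m3], so the superfluous parts cancel in the
    integral. *)
Lemma cmeasure_integral_positive (nu : set (borel_circle R) -> R[i])
    (m : {finite_measure set (borel_circle R) -> \bar R}) (f : borel_circle R -> R[i]) I b :
  (forall S, measurable S -> nu S = (fine (m S))%:C%C) ->
  measurable_fun setT (fun z => Re (f z)) -> measurable_fun setT (fun z => Im (f z)) ->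
  (forall z, `|Re (f z)| <= b) -> (forall z, `|Im (f z)| <= b) ->
  cmeasure_integral nu f I ->
  Re I = Rintegral m setT (fun z => Re (f z)) /\
  Im I = Rintegral m setT (fun z => Im (f z)).
Proof.
move=> hnu mR mI bR bI [mu [hmu ->]].
pose o0 : 'I_4 := inord 0; pose o1 : 'I_4 := inord 1.
pose o2 : 'I_4 := inord 2; pose o3 : 'I_4 := inord 3.
have sum4 (g : 'I_4 -> R[i]) : \sum_(j < 4) 'i ^+ j * g j =
    g o0 + 'i%C * g o1 - g o2 - 'i%C * g o3.
  rewrite !big_ord_recl big_ord0 /= expr0 mul1r -complexiE.
  rewrite (_ : lift ord0 (lift ord0 (lift ord0 ord0)) = o3); last by apply/val_inj; rewrite /= inordK.
  rewrite (_ : lift ord0 (lift ord0 ord0) = o2); last by apply/val_inj; rewrite /= inordK.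
  rewrite (_ : lift ord0 ord0 = o1); last by apply/val_inj; rewrite /= inordK.
  rewrite (_ : ord0 = o0); last by apply/val_inj; rewrite /= inordK.
  rewrite (_ : bump 0 0 = 1%N)// (_ : bump 0 1 = 2%N)// (_ : bump 0 2 = 3%N)//.
  have i3 : 'i%C ^+ 3 = - 'i%C :> R[i] by rewrite exprS sqr_i mulrN1.
  by rewrite i3 sqr_i; ring.
have eqs S : measurable S -> fine (mu o0 S) = fine (m S) + fine (mu o2 S) /\
    fine (mu o1 S) = fine (mu o3 S).
  move=> mS; have := hmu _ mS; rewrite hnu// sum4 => /eqP; rewrite eq_complex.
  rewrite !(Re_add, Im_add, Re_opp, Im_opp, Re_mul, Im_mul) /=.
  by move=> /andP[/eqP h0 /eqP h1]; split; lra.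
have zm S : measurable S -> fine (mu o1 S) = fine ((mzero : {measure set _ -> \bar R}) S) + fine (mu o3 S).
  by move=> mS; rewrite (eqs _ mS).2 add0r.
rewrite sum4 !(Re_add, Im_add, Re_opp, Im_opp, Re_mul, Im_mul) /=.
have e02 f' b' := @measure_sum_Rintegral m (mu o0) (mu o2) f' b'.
have e13 f' : Rintegral (mu o1) setT f' = Rintegral (mu o3) setT f'.
  congr fine; apply: eq_measure_integral => A mA _.
  transitivity ((fine (mu o1 A))%:E); first by rewrite fineK ?fin_num_measure.
  by rewrite (eqs _ mA).2 fineK ?fin_num_measure.
have h S mS := (eqs S mS).1.
rewrite (e02 _ _ mR bR h) (e02 _ _ mI bI h) !e13; split; ring.
Qed.

Lemma trig_poly_delta (n : int) (z : borel_circle R) :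
  trig_poly `|n|%N (fun k => if k == n then 1 else 0) z = cpow n z.
Proof.
rewrite /trig_poly.
have [k kE] : exists k : nat, k%:Z = n + `|n|%N%:Z by exists (absz (n + `|n|%N%:Z)); lia.
have hj : (k < (`|n|%N).*2.+1)%N by lia.
rewrite (bigD1 (Ordinal hj))//= big1 => [|j jn].
  rewrite (_ : k%:Z - `|n|%N%:Z = n); last by lia.
  by rewrite eqxx mul1r addr0.
case: eqP => [e|_]; last by rewrite mul0r.
by move: jn; rewrite -val_eqE /=; lia.
Qed.

Lemma trig_poly_op_delta T (n : int) h :
  trig_poly_op `|n|%N (fun k => if k == n then 1 else 0) T h = zpow_op T n h.
Proof.
rewrite /trig_poly_op.
have [k kE] : exists k : nat, k%:Z = n + `|n|%N%:Z by exists (absz (n + `|n|%N%:Z)); lia.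
have hj : (k < (`|n|%N).*2.+1)%N by lia.
rewrite (bigD1 (Ordinal hj))//= big1 => [|j jn].
  rewrite (_ : k%:Z - `|n|%N%:Z = n); last by lia.
  by rewrite eqxx scale1r addr0.
case: eqP => [e|_]; last by rewrite scale0r.
by move: jn; rewrite -val_eqE /=; lia.
Qed.

(** At [h] the moments of the positive measure [<F h, h>] are the numbers
    [<T^n h, h>], so [<p(T) h, h>] is the integral of [p]. *)
Lemma absolutely_continuous_acont T h : absolutely_continuous_op T -> acont T h.
Proof.
move=> [F [[_ pos] hF] null].
have [m hm] := pos h.
have moments n : Re (hdot (zpow_op T n h) h) = Rintegral m setT (fun z => Re (cpow n z)) /\
    Im (hdot (zpow_op T n h) h) = Rintegral m setT (fun z => Im (cpow n z)).
  have := hF `|n|%N (fun k => if k == n then 1 else 0) h h.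
  rewrite trig_poly_op_delta => hI.
  have [mr mi] := measurable_cpow (R := R) n.
  have E : trig_poly `|n|%N (fun k => if k == n then 1 else 0) =
      cpow n :> (borel_circle R -> R[i]).
    by apply/funext => z; rewrite trig_poly_delta.
  rewrite E in hI.
  have bR z : `|Re (cpow n z)| <= 1 :> R := (norm_Re_Im_le1 (cpow_norm n z)).1.
  have bI z : `|Im (cpow n z)| <= 1 :> R := (norm_Re_Im_le1 (cpow_norm n z)).2.
  exact: (cmeasure_integral_positive hm mr mi bR bI hI).
have mnull S : measurable S -> arc_length S = 0%E -> m S = 0%E.
  move=> mS aS; rewrite -(@fineK _ (m S)) ?fin_num_measure//.
  have := hm _ mS; rewrite null// -(scale0r 0) dotZl mul0r => /(congr1 (fun z => Re z)) /= <-//.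
move=> e e0; have [d d0 hd] := null_trig_small mnull e0.
exists d => // p up mp; apply: le_trans (hd p up mp); rewrite le_eqVlt.
have finm : (m setT < +oo)%E by exact: fin_num_fun_lty (fin_num_measure m).
have [_ ->] := @Rintegral_trig R _ _ m id (@measurable_id _ _ setT) setT measurableT finm p.
apply/orP; left; apply/eqP; apply: eq_bigr => x _.
by have [<- <-] := moments x.1; rewrite /rdot dotZl Re_mul.
Qed.

End SpectralMeasure.

(** * Fejer means of functions on the circle *)

Section FejerMeans.
Context {R : realType}.
Local Notation lam := (@lebesgue_measure R).
Implicit Types (f g : borel_circle R -> R) (M : nat) (n : int).

(** The scalar instance of the telescoping argument for Fejer sums. *)
Lemma scalar_fejer_ge0 M (u : R[i]) : `|u| = 1 ->
  0 <= \sum_(n <- zrange M) tri M n * Re (u ^ n).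
Proof.
move=> u1; rewrite big_zrange.
pose S m : R[i] := \sum_(j < m) u ^+ j.
pose K m : R := m%:R + 2 * \sum_(1 <= j < m.+1) (m - j)%N%:R * Re (u ^+ j).
have -> : tri M 0 * Re (u ^ 0) + \sum_(1 <= j < M.+1) (tri M j%:Z * Re (u ^ j%:Z) +
    tri M (- j%:Z) * Re (u ^ (- j%:Z))) = K M.
  rewrite /K mulr_sumr; congr (_ + _); first by rewrite /tri subn0 expr0z mulr1.
  apply: eq_bigr => j _; rewrite -conj_exprz// Re_conjC /tri abszN absz_nat -exprnP; ring.
suff : normsq (S M) <= K M by apply: le_trans; exact: normsq_ge0.
elim: M => [|M IH]; first by rewrite /S /K big_ord0 big_geq// mulr0 addr0 /normsq /= expr0n /= addr0.
have -> : K M.+1 = K M + 2 * Re (S M.+1) - 1.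
  rewrite /K big_nat_recr//= subnn mul0r addr0.
  have -> : Re (S M.+1) = 1 + \sum_(1 <= j < M.+1) Re (u ^+ j).
    by rewrite /S Re_sum -(big_mkord xpredT (fun j => Re (u ^+ j))) big_ltn.
  have -> : \sum_(1 <= j < M.+1) (M.+1 - j)%N%:R * Re (u ^+ j) =
     \sum_(1 <= j < M.+1) (M - j)%N%:R * Re (u ^+ j) + \sum_(1 <= j < M.+1) Re (u ^+ j).
    rewrite -big_split /=; apply: eq_big_nat => j /andP[j1 jM].
    by rewrite subSn// -natr1 mulrDl mul1r.
  rewrite -natr1; ring.
have : normsq (S M.+1 - 1) = normsq (S M).
  have -> : S M.+1 - 1 = u * S M.
    rewrite /S big_ord_recl addrAC subrr add0r mulr_sumr.
    by apply: eq_bigr => j _; rewrite -exprS.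
  by rewrite normsqM (norm1_normsq u).1// mul1r.
rewrite /normsq Re_add Im_add Re_opp Im_opp /=; move: IH; rewrite /normsq; lra.
Qed.

(** Fejer weights [1 - |n| / (M + 1)], truncated at 0. *)
Definition wt M n : R := tri M.+1 n / M.+1%:R.

Lemma wt_ge0 M n : 0 <= wt M n.
Proof. by rewrite divr_ge0. Qed.

Lemma wt_le1 M n : wt M n <= 1.
Proof. by rewrite ler_pdivrMr ?ltr0n// mul1r ler_nat leq_subr. Qed.

Lemma wt0 M : wt M 0 = 1.
Proof. by rewrite /wt /tri subn0 divff ?pnatr_eq0. Qed.

Lemma wtN M n : wt M (- n) = wt M n.
Proof. by rewrite /wt /tri abszN. Qed.

Lemma wt_out M n : (M < `|n|)%N -> wt M n = 0.
Proof.
move=> h; rewrite /wt /tri; have -> : (M.+1 - `|n|)%N = 0%N by apply/eqP; rewrite subn_eq0.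
by rewrite mul0r.
Qed.

Lemma wt_mono L M n : (L <= M)%N -> wt L n <= wt M n.
Proof.
move=> LM; have [h|h] := leqP `|n|%N L.+1; last by rewrite wt_out ?wt_ge0// ltnW.
rewrite /wt /tri !natrB//; last by apply: leq_trans h _.
rewrite !mulrBl !divff ?pnatr_eq0// lerD2l lerN2.
by apply: ler_wpM2l => //; rewrite lef_pV2 ?posrE ?ltr0n// ler_nat.
Qed.

Lemma wt_cvg n (e : R) : 0 < e -> exists M0, forall M, (M0 <= M)%N -> 1 - wt M n <= e.
Proof.
move=> e0; exists (maxn `|n|%N (Num.truncn (`|n|%N%:R / e))) => M; rewrite geq_max => /andP[nM hM].
rewrite /wt /tri natrB; last exact: leqW.
rewrite mulrBl divff ?pnatr_eq0// opprB addrC subrK.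
rewrite ler_pdivrMr ?ltr0n// mulrC -ler_pdivrMr//.
apply: ltW; apply: lt_le_trans (truncnS_gt _) _.
by rewrite ler_nat ltnS.
Qed.

Lemma big_zrange_extend (V : nmodType) N K (F : int -> V) : (N <= K)%N ->
  (forall n, (N < `|n|)%N -> F n = 0) ->
  \sum_(n <- zrange K) F n = \sum_(n <- zrange N) F n.
Proof.
move=> NK hF; rewrite !big_zrange; congr (_ + _).
have tail : \sum_(N.+1 <= j < K.+1) (F j%:Z + F (- j%:Z)) = 0.
  rewrite big_nat_cond big1// => j /andP[/andP[jN _] _].
  by rewrite !hF ?addr0//; lia.
by rewrite (@big_cat_nat _ _ _ N.+1)//= tail addr0.
Qed.

Definition bfun f := measurable_fun setT f /\ exists b, forall z, `|f z| <= b.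
Definition ufun f := measurable_fun setT f /\ forall z, 0 <= f z <= 1.

Lemma ufun_bfun f : ufun f -> bfun f.
Proof.
by case=> mf hf; split=> //; exists 1 => z; have /andP[h0 h1] := hf z; rewrite ger0_norm.
Qed.

Lemma bfun_exp f : bfun f -> measurable_fun setT (f \o circle_exp) /\
  exists b, forall t, `|(f \o circle_exp) t| <= b.
Proof.
case=> mf [b hb]; split; last by exists b => t; exact: hb.
exact: (measurableT_comp mf measurable_circle_exp).
Qed.

(** Cosine and sine moments over one turn: Fourier coefficients are assembled
    from real integrals. *)
Definition cosm f n := Rintegral lam turn (fun t => f (circle_exp t) * Re (cpow n (circle_exp t))).
Definition sinm f n := Rintegral lam turn (fun t => f (circle_exp t) * Im (cpow n (circle_exp t))).

Definition fcoef f n : R[i] := ((2 * pi)^-1 * cosm f n -i* ((2 * pi)^-1 * sinm f n))%C.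

Lemma twopi_gt0 : 0 < 2 * pi :> R.
Proof. by rewrite mulr_gt0 ?pi_gt0. Qed.

Lemma integrable_trig f p : bfun f ->
  lam.-integrable turn (EFin \o (fun t => f (circle_exp t) * Re (trig p (cval (circle_exp t))))) /\
  Rintegral lam turn (fun t => f (circle_exp t) * Re (trig p (cval (circle_exp t)))) =
  \sum_(x <- p) (Re x.2 * cosm f x.1 - Im x.2 * sinm f x.1).
Proof.
move=> /bfun_exp[mf [b hb]].
exact: (@Rintegral_weighted_trig R _ _ lam circle_exp measurable_circle_exp turn
  measurable_turn turn_finite (f \o circle_exp) b mf hb p).
Qed.

Lemma integrable_cos f n : bfun f ->
  lam.-integrable turn (EFin \o (fun t => f (circle_exp t) * Re (cpow n (circle_exp t)))) /\
  lam.-integrable turn (EFin \o (fun t => f (circle_exp t) * Im (cpow n (circle_exp t)))).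
Proof.
move=> /bfun_exp[mf [b hb]].
exact: (@integrable_weighted_cpow R _ _ lam circle_exp measurable_circle_exp turn
  measurable_turn turn_finite (f \o circle_exp) b mf hb n).
Qed.

Lemma cosmN f n : cosm f (- n) = cosm f n.
Proof. by apply: eq_Rintegral => t _; rewrite cpowN Re_conjC. Qed.

Lemma sinmN f n : bfun f -> sinm f (- n) = - sinm f n.
Proof.
move=> bf; rewrite /sinm -[RHS]mulN1r -RintegralZl; [|exact: measurable_turn|exact: (integrable_cos n bf).2].
by apply: eq_Rintegral => t _; rewrite cpowN Im_conjC; ring.
Qed.

Lemma fcoefN f n : bfun f -> fcoef f (- n) = Num.conj (fcoef f n).
Proof.
move=> bf; rewrite /fcoef cosmN sinmN// conjE /=.
by rewrite mulrN.
Qed.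

Lemma cosm_lin f g (r s : R) n : bfun f -> bfun g ->
  cosm (fun z => r * f z + s * g z) n = r * cosm f n + s * cosm g n.
Proof.
move=> bf bg; have [hf _] := integrable_cos n bf; have [hg _] := integrable_cos n bg.
have mt := measurable_turn (R := R).
rewrite /cosm /sinm -!RintegralZl// -RintegralD//.
- by apply: eq_Rintegral => t _; ring.
- by under [X in _.-integrable _ X]eq_fun do rewrite /= EFinM; apply: integrableZl.
- by under [X in _.-integrable _ X]eq_fun do rewrite /= EFinM; apply: integrableZl.
Qed.

Lemma sinm_lin f g (r s : R) n : bfun f -> bfun g ->
  sinm (fun z => r * f z + s * g z) n = r * sinm f n + s * sinm g n.
Proof.
move=> bf bg; have [_ hf] := integrable_cos n bf; have [_ hg] := integrable_cos n bg.
have mt := measurable_turn (R := R).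
rewrite /cosm /sinm -!RintegralZl// -RintegralD//.
- by apply: eq_Rintegral => t _; ring.
- by under [X in _.-integrable _ X]eq_fun do rewrite /= EFinM; apply: integrableZl.
- by under [X in _.-integrable _ X]eq_fun do rewrite /= EFinM; apply: integrableZl.
Qed.

Lemma fcoef_lin f g (r s : R) n : bfun f -> bfun g ->
  fcoef (fun z => r * f z + s * g z) n = r%:C%C * fcoef f n + s%:C%C * fcoef g n.
Proof.
move=> bf bg; apply: complex_eq; rewrite /fcoef cosm_lin// sinm_lin//.
  by rewrite Re_add !Re_mul /=; ring.
by rewrite Im_add !Im_mul /=; ring.
Qed.

Definition fser (c : int -> R[i]) M : seq (int * R[i]) := [seq (n, c n) | n <- zrange M.+1].
Definition fmean f M := fser (fun n => (wt M n)%:C%C * fcoef f n) M.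

Lemma trig_fser c M z : trig (fser c M) z = \sum_(n <- zrange M.+1) c n * z ^ n.
Proof. by rewrite /trig big_map. Qed.

Lemma tmean_fser c M : tmean (fser c M) = Re (c 0).
Proof.
have z0 : (0 : int) \in zrange M.+1 by rewrite mem_zrange.
rewrite /tmean big_map /= big_mkcond (bigD1_seq 0 z0 (zrange_uniq _)) /=.
by rewrite big1 ?addr0// => n /negbTE ->.
Qed.

Lemma tnorm2_fser c M : tnorm2 (fser c M) = \sum_(n <- zrange M.+1) normsq (c n).
Proof.
rewrite tnorm2E big_map; apply: eq_big_seq => n nM; rewrite big_map.
rewrite (bigD1_seq n nM (zrange_uniq _)) /= subrr eqxx big1 ?addr0 => [|m mn].
  by rewrite mulr_conj.
by rewrite subr_eq0 eq_sym (negbTE mn).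
Qed.

Lemma Re_fmean f M z : bfun f -> `|z| = 1 ->
  Re (trig (fmean f M) z) = (2 * pi)^-1 * Rintegral lam turn (fun t =>
    f (circle_exp t) *
    Re (trig (fser (fun n => (wt M n)%:C%C * z ^ (- n)) M) (cval (circle_exp t)))).
Proof.
move=> bf z1; have [_ ->] := integrable_trig (fser (fun n => (wt M n)%:C%C * z ^ (- n)) M) bf.
rewrite trig_fser big_map Re_sum mulr_sumr.
apply: eq_bigr => n _; rewrite -(conj_exprz n z1) !(Re_mul, Im_mul) Re_conjC Im_conjC /=.
by ring.
Qed.

Lemma trig_fmean_real f M z : bfun f -> `|z| = 1 -> Im (trig (fmean f M) z) = 0.
Proof.
move=> bf z1; rewrite trig_fser Im_sum big_zrange big1 => [|j _].
  have s0 : sinm f 0 = 0 by have := sinmN 0 bf; rewrite oppr0; lra.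
  by rewrite expr0z mulr1 addr0 Im_mul /= s0; ring.
rewrite wtN fcoefN// -conj_exprz// !(Im_mul, Re_mul) !Re_conjC !Im_conjC /=; ring.
Qed.

Lemma kernel_real M (w z : R[i]) : `|z| = 1 -> `|w| = 1 ->
  0 <= Re (trig (fser (fun n => (wt M n)%:C%C * z ^ (- n)) M) w).
Proof.
move=> z1 w1; rewrite trig_fser Re_sum.
have u1 : `|w / z| = 1 by rewrite normrM normfV z1 w1 divr1.
have := scalar_fejer_ge0 M.+1 u1; rewrite -(pmulr_rge0 _ (_ : 0 < M.+1%:R^-1)) ?invr_gt0 ?ltr0n//.
congr (_ <= _); rewrite mulr_sumr; apply: eq_bigr => n _.
rewrite -mulrA Re_mul /= mul0r subr0 /wt mulrA [_^-1 * _]mulrC; congr (_ * Re _).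
by rewrite expfzMl exprz_inv; exact: mulrC.
Qed.

(** Averaging against the nonnegative Fejer kernel of mean 1 preserves the
    bounds 0 and 1. *)
Lemma unit_trig_fmean f M : ufun f -> unit_trig (fmean f M).
Proof.
move=> uf z z1; have bf := ufun_bfun uf; have [mf f01] := uf.
have I0 := trig_fmean_real M bf z1; have R0 := Re_fmean M bf z1.
set q := fser _ M in R0.
have [iq _] := integrable_trig q bf.
have pos := twopi_gt0.
have lo : 0 <= Re (trig (fmean f M) z).
  rewrite R0 mulr_ge0 ?invr_ge0 ?(ltW pos)//; apply: Rintegral_ge0 => t _.
  by rewrite mulr_ge0 ?kernel_real ?cval_norm//; have /andP[] := f01 (circle_exp t).
have hi : Re (trig (fmean f M) z) <= 1.
  rewrite R0 ler_pdivrMl// mulr1.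
  apply: (@le_trans _ _ (Rintegral lam turn (fun t => Re (trig q (cval (circle_exp t)))))).
    apply: le_Rintegral; [exact: measurable_turn|exact: iq| |].
      exact: (@Rintegral_trig R _ _ lam circle_exp measurable_circle_exp turn
        measurable_turn turn_finite q).1.
    move=> t _; rewrite ler_piMl ?kernel_real ?cval_norm//.
    by have /andP[] := f01 (circle_exp t).
  by rewrite Rintegral_turn_trig tmean_fser oppr0 expr0z mulr1 wt0 /= mulr1.
by rewrite !lecE I0 /= eqxx lo hi.
Qed.

Lemma tmean_fmean f M : tmean (fmean f M) = (2 * pi)^-1 * cosm f 0.
Proof. by rewrite tmean_fser wt0 Re_mul /= mul1r mul0r subr0. Qed.

Definition energy f M : R := \sum_(n <- zrange M.+1) normsq ((wt M n)%:C%C * fcoef f n).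

Lemma energyE f M K : (M <= K)%N ->
  energy f M = \sum_(n <- zrange K.+1) wt M n ^+ 2 * normsq (fcoef f n).
Proof.
move=> MK; rewrite (@big_zrange_extend _ M.+1) => [|//|n Mn].
  apply: eq_bigr => n _; rewrite normsqM; congr (_ * _).
  by rewrite /normsq /=; ring.
by rewrite wt_out ?expr0n ?mul0r// ltnW.
Qed.

Lemma energy_mono f L M : (L <= M)%N -> energy f L <= energy f M.
Proof.
move=> LM; rewrite (energyE _ LM) (energyE _ (leqnn M)); apply: ler_sum => n _.
apply: ler_wpM2r; first exact: normsq_ge0.
by rewrite ler_pXn2r ?nnegrE ?wt_ge0// wt_mono.
Qed.

(** A form of Bessel's inequality: the integral of [f] against its Fejer mean is
    at most 1 after normalisation, and it dominates the energy because the
    weights lie between 0 and 1. *)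
Lemma energy_le1 f M : ufun f -> energy f M <= 1.
Proof.
move=> uf; have bf := ufun_bfun uf; have [mf f01] := uf.
have [iq hq] := integrable_trig (fmean f M) bf.
have pos := twopi_gt0.
have : Rintegral lam turn (fun t => f (circle_exp t) *
    Re (trig (fmean f M) (cval (circle_exp t)))) <= 2 * pi.
  have <- : Rintegral lam turn (cst 1) = 2 * pi.
    rewrite Rintegral_cst; last exact: measurable_turn.
    by rewrite mul1r; exact: (congr1 fine turn_measure).
  apply: le_Rintegral; [exact: measurable_turn|exact: iq| |].
    apply: (@finite_integrable R _ _ lam turn measurable_turn turn_finite _ 1) => [|t].
      exact: measurable_cst.
    by rewrite normr1.
  move=> t _; have /andP[f0 f1] := f01 (circle_exp t).
  have := unit_trig_fmean M uf (cval_norm (circle_exp t)).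
  rewrite !lecE => /andP[/andP[_ p0] /andP[_ p1]].
  by rewrite -[1]mulr1; apply: ler_pM.
rewrite hq -(ler_pM2l pos (energy f M)) mulr1; apply: le_trans.
rewrite big_map /energy mulr_sumr; apply: ler_sum => n _.
have -> : Re ((wt M n)%:C%C * fcoef f n) * cosm f n - Im ((wt M n)%:C%C * fcoef f n) * sinm f n
    = 2 * pi * (wt M n * normsq (fcoef f n)).
  have p0 : pi != 0 :> R by rewrite gt_eqF ?pi_gt0.
  rewrite Re_mul Im_mul /normsq /=; move: p0 (cosm f n) (sinm f n) (wt M n).
  by move: (@pi R) => P P0 a b w; field.
rewrite ler_pM2l// normsqM (_ : normsq (wt M n)%:C%C = wt M n ^+ 2); last first.
  by rewrite /normsq /=; ring.
apply: ler_wpM2r; first exact: normsq_ge0.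
by rewrite expr2 ler_piMl ?wt_ge0 ?wt_le1.
Qed.

End FejerMeans.

(** * The functional calculus of an absolutely continuous contraction *)

Section Calculus.
Context {R : realType} {H : hilbertType R}.
Variable T : H -> H.
Hypotheses (hT : linear_contraction T) (hac : forall h, acont T h).
Implicit Types (f g : borel_circle R -> R) (M : nat) (n : int) (h k : H).

Lemma lproj_le v : sq (lproj T v) <= toeplitz (zpow_op T) v v.
Proof.
set l := lproj T v; have := toeplitz_ge0 (v ++ [:: (0, - l)]) hT.
rewrite toeplitz_catl !toeplitz_catr (toeplitz_sym _ v)// toeplitz_single2 toeplitz_single.
rewrite -/l !rdotNr !rdotNl -/(sq _); lra.
Qed.

Lemma lproj_fser (c : int -> R[i]) M h :
  lproj T (tens (fser c M) h) = \sum_(n <- zrange M.+1) c n *: zpow_op T n h.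
Proof.
rewrite /lproj /tens /fser -map_comp big_map; apply: eq_bigr => n _ /=.
by rewrite (complex_linear_zpow n hT).2.
Qed.

(** [p(T) h] for the [M]-th Fejer mean [p] of [f]. *)
Definition fop f M h : H := lproj T (tens (fmean f M) h).

Lemma fopE f M K h : (M <= K)%N -> fop f M h =
  \sum_(n <- zrange K.+1) ((wt M n)%:C%C * fcoef f n) *: zpow_op T n h.
Proof.
move=> MK; rewrite /fop lproj_fser [RHS](@big_zrange_extend _ M.+1)// => n Mn.
by rewrite wt_out ?mul0r ?scale0r// ltnW.
Qed.

Lemma fopD f M h k : fop f M (h + k) = fop f M h + fop f M k.
Proof.
rewrite !(fopE _ _ (leqnn M)) -big_split; apply: eq_bigr => n _.
by rewrite (complex_linear_zpow n hT).1 scalerDr.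
Qed.

Lemma fopZ f M (a : R[i]) h : fop f M (a *: h) = a *: fop f M h.
Proof.
rewrite !(fopE _ _ (leqnn M)) scaler_sumr; apply: eq_bigr => n _.
by rewrite (complex_linear_zpow n hT).2 !scalerA mulrC.
Qed.

Lemma fop_lin f g (r s : R) M h : bfun f -> bfun g ->
  fop (fun z => r * f z + s * g z) M h = r%:C%C *: fop f M h + s%:C%C *: fop g M h.
Proof.
move=> bf bg; rewrite !(fopE _ _ (leqnn M)) !scaler_sumr -big_split.
apply: eq_bigr => n _ /=; rewrite fcoef_lin// !scalerA -scalerDl; congr (_ *: _); ring.
Qed.

Lemma rdot_fop f M h : rdot (fop f M h) h = trig_form (zpow_op T) (fmean f M) h.
Proof. by rewrite -toeplitz_tens_single// toeplitz_single. Qed.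

Lemma fop_le f M h : ufun f -> sq (fop f M h) <= sq h.
Proof.
move=> uf; apply: le_trans (lproj_le _) _; rewrite -[leRHS]mul1r.
by apply: toeplitz_tens_le => // z z1; apply: unit_trig_le1 => //; exact: unit_trig_fmean.
Qed.

(** The energies of the Fejer means increase and are bounded by 1, so that the
    difference of two late means is small in [L^2]; it is also bounded by 1, and
    absolute continuity makes it small at [T]. *)
Lemma fop_cauchy f h (e : R) : ufun f -> 0 < e ->
  exists M0, forall L M, (M0 <= L)%N -> (L <= M)%N -> sq (fop f M h - fop f L h) <= e.
Proof.
move=> uf e0; have bf := ufun_bfun uf.
have [d d0 hd] := acont_tens hT (@hac h) e0.
have dec0 M : 0 <= 1 - energy f M by rewrite subr_ge0 energy_le1.
have dec L M : (L <= M)%N -> 1 - energy f M <= 1 - energy f L.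
  by move=> LM; rewrite lerD2l lerN2 energy_mono.
have [M0 hM0] := nonincreasing_cauchy dec0 dec d0.
exists M0 => L M M0L LM.
pose D : seq (int * R[i]) := fser (fun n => (wt M n - wt L n)%:C%C * fcoef f n) M.
have -> : fop f M h - fop f L h = lproj T (tens D h).
  rewrite lproj_fser (fopE _ _ (leqnn M)) (fopE _ _ LM) -sumrB; apply: eq_bigr => n _.
  by rewrite -scalerBl rmorphB mulrBl.
apply: le_trans (lproj_le _) _; apply: hd.
  move=> z z1.
  have -> : trig D z = trig (fmean f M) z - trig (fmean f L) z.
    rewrite !trig_fser -[X in _ - X](@big_zrange_extend _ L.+1 M.+1)//; last first.
      by move=> n Ln; rewrite wt_out ?mul0r ?mul0r// ltnW.
    by rewrite -sumrB; apply: eq_bigr => n _; rewrite rmorphB !mulrBl.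
  have := unit_trig_fmean M uf z1; have := unit_trig_fmean L uf z1.
  case: (trig _ _) => a b; case: (trig _ _) => a' b'.
  rewrite !lecE /= => /andP[/andP[/eqP -> l0] /andP[_ l1]].
  move=> /andP[/andP[/eqP -> m0] /andP[_ m1]].
  rewrite /normsq /= subrr expr0n /= addr0; nra.
rewrite tnorm2_fser; apply: (@le_trans _ _ (energy f M - energy f L)); last first.
  have := hM0 L M M0L LM; lra.
rewrite (energyE _ (leqnn M)) (energyE _ LM) -sumrB; apply: ler_sum => n _.
rewrite normsqM -mulrBl; apply: ler_wpM2r; first exact: normsq_ge0.
rewrite (_ : normsq _ = (wt M n - wt L n) ^+ 2); last by rewrite /normsq /=; ring.
have := mulr_ge0 (wt_ge0 (R := R) L n) (_ : 0 <= wt M n - wt L n).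
rewrite subr_ge0 wt_mono// => /(_ isT); lra.
Qed.

(** [f(T) h], for Borel functions with values in the unit interval. *)
Definition phi f h : H := lim (fop f M h @[M --> \oo]).

Lemma phi_cvg f h : ufun f -> fop f M h @[M --> \oo] --> phi f h.
Proof.
move=> uf; have [l hl] : exists l : H, fop f M h @[M --> \oo] --> l.
  apply: cauchy_sq => e e0; have [|M0 hM0] := fop_cauchy h uf (e := e / 2); first by lra.
  exists M0 => n m hn hm; have [nm|mn] := leqP n m.
    by rewrite -opprB sqN; have := hM0 n m hn nm; lra.
  by have := hM0 m n hm (ltnW mn); lra.
by rewrite /phi (cvg_lim _ hl)//; exact: norm_hausdorff.
Qed.

Arguments phi_cvg : clear implicits.

Lemma phiD f h k : ufun f -> phi f (h + k) = phi f h + phi f k.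
Proof.
move=> uf; apply: (lim_unique (phi_cvg _ (h + k) uf)).
under eq_fun do rewrite fopD.
exact: cvgD (phi_cvg _ h uf) (phi_cvg _ k uf).
Qed.

Lemma phiZ f (a : R[i]) h : ufun f -> phi f (a *: h) = a *: phi f h.
Proof.
move=> uf; apply: (lim_unique (phi_cvg _ (a *: h) uf)).
under eq_fun do rewrite fopZ.
exact: cvgZr (phi_cvg _ h uf).
Qed.

Lemma phi_lin f g (r s : R) h : ufun f -> ufun g ->
  ufun (fun z => r * f z + s * g z) ->
  phi (fun z => r * f z + s * g z) h = r%:C%C *: phi f h + s%:C%C *: phi g h.
Proof.
move=> uf ug ufg; apply: (lim_unique (phi_cvg _ h ufg)).
under eq_fun do rewrite (fop_lin _ _ _ _ (ufun_bfun uf) (ufun_bfun ug)).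
apply: cvgD; exact: cvgZr (phi_cvg _ h _).
Qed.

Lemma rdot_lim_le (u : nat -> H) (l : H) k (b : R) (n0 : nat) :
  u n @[n --> \oo] --> l ->
  (forall n : nat, (n0 <= n)%N -> rdot (u n) k <= b) -> rdot l k <= b.
Proof.
move=> /cvg_sq hu hb; apply/ler_addgt0Pl => e e0.
have k0 := sq_ge0 k.
have [|n hn] := hu (e ^+ 2 / (sq k + 1)); first by rewrite divr_gt0 ?exprn_gt0//; lra.
have := hn _ (leq_maxl n n0); have := hb _ (leq_maxr n n0).
set m := maxn n n0 => h1 h2.
have := rdot_CS (l - u m) k; rewrite -opprB sqN rdotNl => h3.
have h4 : rdot (u m - l) k ^+ 2 <= e ^+ 2.
  rewrite sqrrN in h3; apply: le_trans h3 _.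
  move: h2; rewrite ltr_pdivlMr; last by lra.
  have := sq_ge0 (u m - l); nra.
have h5 : - rdot (u m - l) k <= e.
  by move: h4; rewrite -[_ ^+ 2]real_normK ?num_real// ler_pXn2r ?nnegrE// ?(ltW e0)// ler_norml; lra.
by move: h5; rewrite rdotDl rdotNl; lra.
Qed.

Lemma rdot_phi_bounds f h : ufun f -> 0 <= rdot (phi f h) h <= sq h.
Proof.
move=> uf; have b M : 0 <= rdot (fop f M h) h <= sq h.
  rewrite rdot_fop; have uM := unit_trig_fmean M uf.
  rewrite trig_form_ge0// => [|z z1]; last by have /andP[] := uM _ z1.
  have -> : sq h = trig_form (zpow_op T) [:: (0, 1)] h.
    by rewrite /trig_form big_seq1 scale1r.
  apply: trig_form_le => // z z1; rewrite /trig big_seq1 expr0z mulr1.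
  by have /andP[] := uM _ z1.
apply/andP; split; last first.
  by apply: (rdot_lim_le (n0 := 0) (phi_cvg _ h uf)) => M _; have /andP[] := b M.
rewrite -oppr_le0 -rdotNr; apply: (rdot_lim_le (n0 := 0) (phi_cvg _ h uf)) => M _.
by rewrite rdotNr oppr_le0; have /andP[] := b M.
Qed.

Lemma phi_small h (e : R) : 0 < e -> exists2 d : R, 0 < d &
  forall f, ufun f -> (2 * pi)^-1 * cosm f 0 <= d -> rdot (phi f h) h <= e.
Proof.
move=> e0; have [d d0 hd] := @hac h e e0; exists d => // f uf fd.
apply: (rdot_lim_le (n0 := 0) (phi_cvg _ h uf)) => M _; rewrite rdot_fop.
by apply: hd; [exact: unit_trig_fmean|rewrite tmean_fmean].
Qed.

Lemma phi_bound f h : ufun f -> sq (phi f h) <= sq h.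
Proof.
move=> uf; apply: (@le_trans _ _ (sq (phi f h))) => //.
have : sq (phi f h) ^+ 2 <= sq h * sq (phi f h).
  have s0 := sq_ge0 h; have p0 := sq_ge0 (phi f h).
  have le : sq (phi f h) <= Num.sqrt (sq h * sq (phi f h)).
    apply: (rdot_lim_le (n0 := 0) (phi_cvg _ h uf)) => M _.
    rewrite (le_trans (ler_norm _))// -(@ler_pXn2r _ 2) ?nnegrE ?normr_ge0 ?sqrtr_ge0//.
    rewrite real_normK ?num_real// sqr_sqrtr ?mulr_ge0//.
    apply: le_trans (rdot_CS _ _) _; apply: ler_wpM2r => //; exact: fop_le.
  by rewrite -[leRHS]sqr_sqrtr ?mulr_ge0// ler_pXn2r ?nnegrE ?sqrtr_ge0.
have := sq_ge0 (phi f h); rewrite le_eqVlt => /orP[/eqP <- _|p0]; first exact: sq_ge0.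
by rewrite expr2 ler_pM2r.
Qed.

End Calculus.

(** * The spectral measure of an absolutely continuous contraction *)

Section MeasureOfFunction.
Context {d} {X : measurableType d} {R : realType} (mu : set X -> \bar R).
Hypotheses (mu0 : mu set0 = 0%E) (mu_ge0 : forall S, (0 <= mu S)%E).
Hypothesis mu_sigma : semi_sigma_additive mu.
Hypothesis mu_fin : fin_num_fun mu.

#[local] HB.instance Definition _ := isMeasure.Build _ _ _ mu mu0 mu_ge0 mu_sigma.
#[local] HB.instance Definition _ := Measure_isFinite.Build _ _ _ mu mu_fin.

Lemma finite_measure_exists :
  exists m : {finite_measure set X -> \bar R}, forall S, m S = mu S.
Proof. by exists mu. Qed.

End MeasureOfFunction.

Section Construction.
Context {R : realType} {H : hilbertType R}.
Local Notation lam := (@lebesgue_measure R).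
Variable T : H -> H.
Hypotheses (hT : linear_contraction T) (hac : forall h, acont T h).
Implicit Types (f g : borel_circle R -> R) (S : set (borel_circle R)) (h k : H).

Lemma ufun_indic S : measurable S -> ufun (\1_S : borel_circle R -> R).
Proof.
move=> mS; split; first exact: measurable_indic.
by move=> z; rewrite indicE; case: (z \in S); rewrite ?lexx ?ler01.
Qed.

Lemma cosm_indic S : measurable S -> cosm (\1_S : borel_circle R -> R) 0 = fine (lam (arcset S)).
Proof.
move=> mS; rewrite /arcset setIC -(Rintegral_indic lam measurable_turn).
  apply: eq_Rintegral => t _; rewrite /cpow expr0z mulr1 !indicE.
  by congr (_%:R); congr nat_of_bool; apply/idP/idP; rewrite !inE.
by rewrite -[X in measurable X]setTI; apply: measurable_circle_exp.
Qed.

Lemma phi_indicU A B h : measurable A -> measurable B -> A `&` B = set0 ->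
  phi T \1_(A `|` B) h = phi T \1_A h + phi T \1_B h.
Proof.
move=> mA mB AB.
have E : \1_(A `|` B) = (fun z => 1 * \1_A z + 1 * \1_B z) :> (borel_circle R -> R).
  apply/funext => z; rewrite !mul1r !indicE.
  have [zA|zA] := boolP (z \in A); have [zB|zB] := boolP (z \in B).
  - move: zA zB; rewrite !inE => zA zB.
    by have : (A `&` B) z by []; rewrite AB.
  - by rewrite mem_set ?addr0//; left; exact: set_mem.
  - by rewrite mem_set ?add0r//; right; exact: set_mem.
  rewrite memNset ?addr0// => -[/mem_set|/mem_set] h'; [by rewrite h' in zA|by rewrite h' in zB].
have uA := ufun_indic mA; have uB := ufun_indic mB.
have uAB := ufun_indic (measurableU _ _ mA mB).
have uE : ufun (fun z => 1 * \1_A z + 1 * \1_B z : R) by rewrite -E.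
by rewrite E (phi_lin hT hac h uA uB uE) !scale1r.
Qed.

Lemma phi_null S h : measurable S -> lam (arcset S) = 0%E -> phi T \1_S h = 0.
Proof.
move=> mS S0; have uS := ufun_indic mS.
apply: (lim_unique (phi_cvg hT hac uS)).
suff -> : (fun M => fop T \1_S M h) = (fun=> 0) by exact: cvg_cst.
apply/funext => M; apply: sq_eq0; apply/ler_addgt0Pl => e e0; rewrite addr0.
apply: le_trans (lproj_le hT _) _.
have [d d0 hd] := acont_tens hT (@hac h) e0; have uM := unit_trig_fmean M uS.
apply: hd => [z z1|]; first exact: unit_trig_le1.
apply: le_trans (tnorm2_unit uM) _.
by rewrite tmean_fmean cosm_indic// S0 mulr0 ltW.
Qed.

(** The value 0 off the Borel sets makes [nur h] a total function that is
    nonnegative everywhere. *)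
Definition nur h S : R := if `[< measurable S >] then rdot (phi T \1_S h) h else 0.
Definition nu h S : \bar R := (nur h S)%:E.

Lemma nurE h S : measurable S -> nur h S = rdot (phi T \1_S h) h.
Proof. by move=> mS; rewrite /nur asboolT. Qed.

Lemma nur_ge0 h S : 0 <= nur h S.
Proof.
rewrite /nur; case: asboolP => // mS.
by have /andP[] := rdot_phi_bounds hT hac h (ufun_indic mS).
Qed.

Lemma nur0 h : nur h set0 = 0.
Proof.
by rewrite nurE// phi_null ?rdot0l// /arcset preimage_set0 setI0 measure0.
Qed.

Lemma nurU h A B : measurable A -> measurable B -> A `&` B = set0 ->
  nur h (A `|` B) = nur h A + nur h B.
Proof.
move=> mA mB AB; rewrite !nurE//; last exact: measurableU.
by rewrite phi_indicU// rdotDl.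
Qed.

Lemma nur_small h (e : R) : 0 < e -> exists2 d : R, 0 < d &
  forall S, measurable S -> fine (lam (arcset S)) <= d -> nur h S <= e.
Proof.
move=> e0; have [d d0 hd] := phi_small hT hac h e0.
exists (2 * pi * d); first by rewrite mulr_gt0 ?twopi_gt0.
move=> S mS Sd; rewrite nurE//; apply: hd; first exact: ufun_indic.
by rewrite cosm_indic// ler_pdivrMl ?twopi_gt0.
Qed.

(** By finite additivity, the tail of a disjoint union is what remains; its arc
    length tends to 0, and absolute continuity makes its value tend to 0. *)
Lemma nu_sigma h : semi_sigma_additive (nu h).
Proof.
move=> F mF tF mUF.
have mbig n : measurable (\big[setU/set0]_(i < n) F i).
  by apply: bigsetU_measurable.
pose B n := (\bigcup_i F i) `\` \big[setU/set0]_(i < n) F i.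
have mB n : measurable (B n) by apply: measurableD.
have disj n : (\big[setU/set0]_(i < n) F i) `&` F n = set0.
  rewrite -subset0 => z [].
  rewrite -bigcup_mkord => -[i /= ilt Fi] Fn.
  have /trivIsetP/(_ i n I I (negbT (ltn_eqF ilt))) e := tF.
  by have : (F i `&` F n) z by []; rewrite e.
have fin_sum n : nur h (\big[setU/set0]_(i < n) F i) = \sum_(i < n) nur h (F i).
  elim: n => [|n IH]; first by rewrite !big_ord0 nur0.
  by rewrite !big_ord_recr/= nurU ?IH; [|exact: mbig|exact: mF|exact: disj].
have split_all n : nur h (\bigcup_i F i) = \sum_(i < n) nur h (F i) + nur h (B n).
  rewrite -fin_sum -(nurU h (mbig n) (mB n)); last exact: setDIK.
  by congr nur; rewrite setDUK// -bigcup_mkord; apply: bigcup_sub => i _; exact: bigcup_sup.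
have lamB : (lam \o (fun n => arcset (B n))) n @[n --> \oo] --> 0%E.
  rewrite -(measure0 lam) -[X in _ --> lam X](_ : \bigcap_n arcset (B n) = set0).
    apply: nonincreasing_cvg_mu.
    - exact: arc_length_lt.
    - by move=> n; exact: measurable_arcset.
    - by apply: bigcapT_measurable => n; exact: measurable_arcset.
    - apply/nonincreasing_seqP => n; apply/subsetPset => t [tt [Ft nFt]]; split=> //.
      by split=> // hn; apply: nFt; rewrite big_ord_recr; left.
  rewrite -subset0 => t ht; have [_ [[i _ Fi] _]] := ht 0%N I.
  have [_ [_]] := ht i.+1 I; apply.
  by rewrite big_ord_recr; right.
have /fine_cvg lamBr := lamB.
rewrite /nu; under eq_fun do rewrite sumEFin big_mkord.
apply: cvg_EFin; first by apply: nearW.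
apply/cvgrPdist_lt => e e0.
have [|dl dl0 hdl] := nur_small h (e := e / 2); first by lra.
have [n0 _ hn0] := (cvgrPdist_lt _ _).1 lamBr _ dl0.
exists n0 => // n /hn0 /=; rewrite sub0r normrN => lamn.
rewrite (split_all n) addrAC subrr add0r ger0_norm ?nur_ge0//.
apply: le_lt_trans (hdl _ (mB n) _) _; last by lra.
by apply: le_trans (ler_norm _) (ltW lamn).
Qed.

Lemma nu_measure h : exists m : {finite_measure set (borel_circle R) -> \bar R},
  forall S, measurable S -> m S = (rdot (phi T \1_S h) h)%:E.
Proof.
have nu00 : nu h set0 = 0%E by rewrite /nu nur0.
have nu_ge0 S : (0 <= nu h S)%E by rewrite lee_fin nur_ge0.
have nu_fin : fin_num_fun (nu h) by [].
have [m hm] := finite_measure_exists nu00 nu_ge0 (@nu_sigma h) nu_fin.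
by exists m => S mS; rewrite hm /nu nurE.
Qed.

End Construction.

(** * Moments of the spectral measure *)

Section Integrals.
Context {R : realType} {H : hilbertType R}.
Local Notation lam := (@lebesgue_measure R).
Variable T : H -> H.
Hypotheses (hT : linear_contraction T) (hac : forall h, acont T h).
Implicit Types (f g : borel_circle R -> R) (S : set (borel_circle R)) (h k : H).

Lemma ufun_integrable (m : {finite_measure set (borel_circle R) -> \bar R}) f :
  bfun f -> m.-integrable setT (EFin \o f).
Proof.
move=> [mf [b hb]]; apply: (@finite_integrable R _ _ m setT measurableT _ f b) => //.
exact: fin_num_fun_lty (fin_num_measure m).
Qed.

(** One step of the binary expansion of [f]: [S] is the set where the leading
    digit is 1. *)
Lemma ufun_digit f : ufun f -> exists S g, [/\ measurable S, ufun g &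
  f = (fun z => 2^-1 * \1_S z + 2^-1 * g z)].
Proof.
move=> [mf f01]; pose S := f @^-1` `[2^-1, +oo[%classic.
have mS : measurable S.
  by rewrite -[X in measurable X]setTI; apply: mf => //; exact: measurable_itv.
have SE z : (z \in S) = (2^-1 <= f z).
  by apply/idP/idP; rewrite inE /S /= in_itv /= andbT.
exists S, (fun z => 2 * f z - \1_S z); split=> //; last first.
  by apply/funext => z; field.
split.
  by apply: measurable_funB; [apply: measurable_funM|exact: measurable_indic].
move=> z; rewrite indicE SE; have /andP[f0 f1] := f01 z.
by case: (leP 2^-1 (f z)) => h /=; lra.
Qed.

(** The two functionals agree on indicator functions, so that by [ufun_digit]
    their difference at [f] is half of their difference at another function
    with values in the unit interval. Differences being bounded, it is 0. *)
Lemma nu_integral h (m : {finite_measure set (borel_circle R) -> \bar R}) f :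
  (forall S, measurable S -> m S = (rdot (phi T \1_S h) h)%:E) -> ufun f ->
  Rintegral m setT f = rdot (phi T f h) h.
Proof.
move=> hm uf.
pose C := fine (m setT) + sq h.
pose D f := Rintegral m setT f - rdot (phi T f h) h.
have s0 := sq_ge0 h.
have mt0 : 0 <= fine (m setT) by rewrite fine_ge0.
have DC g : ufun g -> `|D g| <= C.
  move=> ug; have /andP[j0 j1] := rdot_phi_bounds hT hac h ug.
  have [mg g01] := ug.
  have i0 : 0 <= Rintegral m setT g by apply: Rintegral_ge0 => z _; have /andP[] := g01 z.
  have i1 : Rintegral m setT g <= fine (m setT).
    rewrite -[leRHS]mul1r -Rintegral_cst//; apply: le_Rintegral => //.
    - by apply: ufun_integrable; exact: ufun_bfun.
    - by apply: ufun_integrable; split; [exact: measurable_cst|exists 1 => z; rewrite normr1].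
    - by move=> z _; have /andP[] := g01 z.
  rewrite /D /C ler_norml; lra.
have half g : ufun g -> exists2 g1, ufun g1 & D g = 2^-1 * D g1.
  move=> ug; have [S [g1 [mS ug1 gE]]] := ufun_digit ug; exists g1 => //.
  have uS := ufun_indic (R := R) mS.
  have iS := ufun_integrable m (ufun_bfun uS); have i1 := ufun_integrable m (ufun_bfun ug1).
  have uE : ufun (fun z => 2^-1 * \1_S z + 2^-1 * g1 z) by rewrite -gE.
  rewrite /D {1 2}gE (phi_lin hT hac h uS ug1 uE) rdotDl !rdotZl.
  have -> : Rintegral m setT (fun z => 2^-1 * \1_S z + 2^-1 * g1 z) =
      2^-1 * Rintegral m setT (\1_S : borel_circle R -> R) + 2^-1 * Rintegral m setT g1.
    rewrite -!RintegralZl// -RintegralD//.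
      by under [X in _.-integrable _ X]eq_fun do rewrite /= EFinM; apply: integrableZl.
    by under [X in _.-integrable _ X]eq_fun do rewrite /= EFinM; apply: integrableZl.
  have E : Rintegral m setT (\1_S : borel_circle R -> R) = rdot (phi T \1_S h) h.
    by rewrite Rintegral_indic// setIT; exact: (congr1 fine (hm S mS)).
  by rewrite E opprD addrACA subrr add0r mulrBr.
have small n g : ufun g -> `|D g| <= C / 2 ^+ n.
  elim: n g => [|n IH] g ug; first by rewrite expr0 divr1 DC.
  have [g1 ug1 ->] := half g ug; have := IH g1 ug1.
  have n2 : `|2^-1 : R| = 2^-1 by rewrite ger0_norm ?invr_ge0.
  by rewrite normrM n2 exprS invfM mulrCA ler_pM2l ?invr_gt0.
apply/eqP; rewrite -subr_eq0 -/(D f) -normr_le0.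
apply/ler_addgt0Pl => e e0; rewrite addr0.
have [n hn] : exists n, C / 2 ^+ n <= e.
  exists (Num.truncn (C / e)); rewrite ler_pdivrMr ?exprn_gt0// mulrC -ler_pdivrMr//.
  apply: ltW; apply: lt_le_trans (truncnS_gt _) _.
  by rewrite -natrX ler_nat ltn_expl.
exact: le_trans (small n f uf) hn.
Qed.

Lemma cpow_mul (n k : int) (z : borel_circle R) : cpow n z * cpow k z = cpow (n + k) z.
Proof. by rewrite /cpow expfzDr// norm1_neq0// cval_norm. Qed.

Lemma Re_cpow_prod (a : R[i]) (n k : int) (z : borel_circle R) :
  Re (a * cpow n z) * Re (cpow k z) =
    Re (trig [:: (n + k, a / 2); (n - k, a / 2)] (cval z)) /\
  Re (a * cpow n z) * Im (cpow k z) =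
    Re (trig [:: (n + k, - 'i%C * a / 2); (n - k, 'i%C * a / 2)] (cval z)).
Proof.
rewrite /trig !big_cons !big_nil /= !addr0 -!/(cpow _ _) -!cpow_mul cpowN conjE.
have -> : 2^-1 = (2^-1 : R)%:C%C :> R[i] by rewrite fmorphV rmorph_nat.
by split; rewrite !(Re_add, Re_mul, Im_mul, Re_opp, Im_opp) /=; field.
Qed.

Lemma bfun_cpow (a : R[i]) n : bfun (fun z => Re (a * cpow n z)).
Proof.
have [mr mi] := measurable_cpow (R := R) n; split.
  under eq_fun do rewrite Re_mul.
  by apply: measurable_funB; apply: measurable_funM.
exists (`|Re a| + `|Im a|) => z; rewrite Re_mul.
have [r1 i1] := norm_Re_Im_le1 (cpow_norm n z).
apply: le_trans (ler_normB _ _) _; rewrite !normrM.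
by apply: lerD; apply: ler_piMr.
Qed.

Lemma fcoef_cpow (a : R[i]) (n k : int) : fcoef (fun z => Re (a * cpow n z)) k =
  (2^-1 : R)%:C%C * ((k == n)%:R * a + (k == - n)%:R * Num.conj a).
Proof.
have pos := twopi_gt0 (R := R).
have h2 : 2^-1 = (2^-1 : R)%:C%C :> R[i] by rewrite fmorphV rmorph_nat.
have delta (b c : R[i]) : tmean [:: (n + k, b); (n - k, c)] =
    Re b * (k == - n)%:R + Re c * (k == n)%:R.
  have e1 : (n + k == 0) = (k == - n) by apply/eqP/eqP; lia.
  have e2 : (n - k == 0) = (k == n) by apply/eqP/eqP; lia.
  rewrite /tmean !big_cons big_nil /= e1 e2.
  by case: (k == n); case: (k == - n) => /=; ring.
have cE : cosm (fun z => Re (a * cpow n z)) k =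
    2 * pi * (2^-1 * Re a * (k == - n)%:R + 2^-1 * Re a * (k == n)%:R).
  transitivity (Rintegral lam turn (fun t =>
      Re (trig [:: (n + k, a / 2); (n - k, a / 2)] (cval (circle_exp t))))).
    by apply: eq_Rintegral => t _; rewrite (Re_cpow_prod a n k _).1.
  by rewrite Rintegral_turn_trig delta h2 Re_mul /=; ring.
have sE : sinm (fun z => Re (a * cpow n z)) k =
    2 * pi * (2^-1 * Im a * (k == - n)%:R - 2^-1 * Im a * (k == n)%:R).
  transitivity (Rintegral lam turn (fun t =>
      Re (trig [:: (n + k, - 'i%C * a / 2); (n - k, 'i%C * a / 2)] (cval (circle_exp t))))).
    by apply: eq_Rintegral => t _; rewrite (Re_cpow_prod a n k _).2.
  by rewrite Rintegral_turn_trig delta h2 !(Re_mul, Im_mul, Re_opp, Im_opp) /=; ring.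
have p0 : 2 * pi != 0 :> R by rewrite gt_eqF.
rewrite /fcoef cE sE !(mulKf p0) conjE.
have bE (b : bool) : b%:R = (b%:R : R)%:C%C :> R[i] by rewrite rmorph_nat.
by rewrite !bE; apply: complex_eq; rewrite ?(Re_mul, Im_mul, Re_add, Im_add) /=; ring.
Qed.

End Integrals.

Section SpectralMeasureExists.
Context {R : realType} {H : hilbertType R}.
Variable T : H -> H.
Hypotheses (hT : linear_contraction T) (hac : forall h, acont T h).
Implicit Types (f g : borel_circle R -> R) (S : set (borel_circle R)) (h k : H).

Lemma zrange_delta M (n : int) (b : R[i]) (X : int -> H) :
  \sum_(k <- zrange M.+1) ((wt M k)%:C%C * ((k == n)%:R * b)) *: X k =
  ((wt M n)%:C%C * b) *: X n.
Proof.
have [nM|nM] := boolP (n \in zrange M.+1).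
  rewrite (bigD1_seq n nM (zrange_uniq _)) /= eqxx mul1r big1 ?addr0// => k /negbTE ->.
  by rewrite mul0r mulr0 scale0r.
rewrite wt_out ?mul0r ?scale0r; last by move: nM; rewrite mem_zrange; lia.
rewrite big_seq big1// => k kM; case: eqP => [kn|_]; first by rewrite -kn kM in nM.
by rewrite mul0r mulr0 scale0r.
Qed.

Lemma rdot_fop_cpow (a : R[i]) (n : int) M h :
  rdot (fop T (fun z => Re (a * cpow n z)) M h) h = wt M n * rdot (a *: zpow_op T n h) h.
Proof.
rewrite (fopE hT _ h (leqnn M)).
under eq_bigr do rewrite fcoef_cpow mulrCA mulrDr mulrDr scalerDl.
rewrite big_split /=.
under eq_bigr do rewrite -scalerA.
under [X in _ + X]eq_bigr do rewrite -scalerA.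
rewrite -!scaler_sumr !zrange_delta -!scalerDr rdotZl rdotDl wtN -!scalerA !rdotZl.
have -> : rdot (Num.conj a *: zpow_op T (- n) h) h = rdot (a *: zpow_op T n h) h.
  by rewrite -rdotZJ rdotC -rdot_zpow// (complex_linear_zpow n hT).2.
lra.
Qed.

(** A character rotated and rescaled to take values in the unit interval: its
    Fejer means only change the weight of one frequency, and that weight tends
    to 1. *)
Lemma rdot_phi_cpow (a : R[i]) (n : int) h : `|a| = 1 ->
  let g := fun z => 2^-1 * Re (1 * cpow 0 z) + 2^-1 * Re (a * cpow n z) in
  ufun g /\ rdot (phi T g h) h = 2^-1 * sq h + 2^-1 * rdot (a *: zpow_op T n h) h.
Proof.
move=> a1 g; have b0 := bfun_cpow (1 : R[i]) 0; have ba := bfun_cpow a n.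
have ug : ufun g.
  have mb0 := b0.1; have mba := ba.1.
  split; first by apply: measurable_funD; apply: measurable_funM.
  move=> z; have aw1 : `|a * cpow n z| = 1 by rewrite normrM a1 cpow_norm mulr1.
  have [+ _] := norm_Re_Im_le1 aw1; rewrite ler_norml => /andP[r0 r1].
  rewrite /g /cpow expr0z mulr1 -/(cpow n z) /=; lra.
split=> //; set c := rdot (a *: _) h.
have val M : rdot (fop T g M h) h = 2^-1 * sq h + 2^-1 * (wt M n * c).
  rewrite /g (fop_lin hT _ _ _ _ b0 ba) rdotDl !rdotZl !rdot_fop_cpow wt0 mul1r.
  by rewrite scale1r.
have near (e : R) : 0 < e -> exists M0, forall M, (M0 <= M)%N -> `|wt M n * c - c| <= e.
  move=> e0; have c0 := normr_ge0 c.
  have [|M0 hM0] := wt_cvg n (e := e / (`|c| + 1)).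
    by rewrite divr_gt0//; lra.
  exists M0 => M /hM0 hM; have := wt_le1 (R := R) M n => w1.
  have -> : wt M n * c - c = - ((1 - wt M n) * c) by ring.
  have w0 : 0 <= 1 - wt M n :> R by lra.
  rewrite normrN normrM (ger0_norm w0).
  move: hM; rewrite ler_pdivlMr; last by lra.
  nra.
apply/eqP; rewrite eq_le; apply/andP; split; apply/ler_addgt0Pl => e e0.
  have [M0 hM0] := near e e0.
  apply: (rdot_lim_le (n0 := M0) (phi_cvg hT hac ug)) => M /hM0.
  rewrite val ler_norml => /andP[]; lra.
have [M0 hM0] := near e e0.
have : rdot (phi T g h) (- h) <= e - (2^-1 * sq h + 2^-1 * c).
  apply: (rdot_lim_le (n0 := M0) (phi_cvg hT hac ug)) => M /hM0.
  rewrite rdotNr val ler_norml => /andP[]; lra.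
rewrite rdotNr; lra.
Qed.

Lemma nu_moment h (m : {finite_measure set (borel_circle R) -> \bar R}) (a : R[i]) (n : int) :
  (forall S, measurable S -> m S = (rdot (phi T \1_S h) h)%:E) -> `|a| = 1 ->
  Rintegral m setT (fun z => Re (a * cpow n z)) = rdot (a *: zpow_op T n h) h.
Proof.
move=> hm a1.
have b0 := bfun_cpow (1 : R[i]) 0; have ba := bfun_cpow a n.
have i0 := ufun_integrable m b0; have ia := ufun_integrable m ba.
have step (b : R[i]) (j : int) : `|b| = 1 -> 2^-1 * Rintegral m setT (fun z => Re (1 * cpow 0 z)) +
    2^-1 * Rintegral m setT (fun z => Re (b * cpow j z)) =
    2^-1 * sq h + 2^-1 * rdot (b *: zpow_op T j h) h.
  move=> b1; have [ug <-] := rdot_phi_cpow j h b1.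
  have ib := ufun_integrable m (bfun_cpow b j).
  rewrite -(nu_integral hT hac hm ug) -!RintegralZl// -RintegralD//.
    by under [X in _.-integrable _ X]eq_fun do rewrite /= EFinM; apply: integrableZl.
  by under [X in _.-integrable _ X]eq_fun do rewrite /= EFinM; apply: integrableZl.
have := step 1 0 (normr1 _); rewrite scale1r /= -/(sq h).
have := step a n a1; lra.
Qed.

Lemma nu_moments h (m : {finite_measure set (borel_circle R) -> \bar R}) (n : int) :
  (forall S, measurable S -> m S = (rdot (phi T \1_S h) h)%:E) ->
  Rintegral m setT (fun z => Re (cpow n z)) = Re (hdot (zpow_op T n h) h) /\
  Rintegral m setT (fun z => Im (cpow n z)) = Im (hdot (zpow_op T n h) h).
Proof.
move=> hm; split.
  have := nu_moment n hm (normr1 R[i]); rewrite scale1r /rdot => <-.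
  by apply: eq_Rintegral => z _; rewrite mul1r.
have ni : `|- 'i%C| = 1 :> R[i].
  by apply/norm1_normsq; rewrite /normsq /= oppr0 expr0n /= sqrrN expr1n add0r.
have := nu_moment n hm ni; rewrite /rdot dotZl Re_mul /= oppr0 mul0r mulN1r opprK add0r => <-.
apply: eq_Rintegral => z _; rewrite Re_mul /=; ring.
Qed.

(** The coefficients of a real function are conjugate-symmetric. *)
Lemma fop_selfadjoint f M h k : bfun f -> rdot (fop T f M h) k = rdot h (fop T f M k).
Proof.
move=> bf; rewrite !(fopE hT _ _ (leqnn M)) rdot_suml rdot_sumr.
have flip (F : int -> R) : \sum_(n <- zrange M.+1) F (- n) = \sum_(n <- zrange M.+1) F n.
  by rewrite !big_zrange oppr0; congr (_ + _); apply: eq_bigr => j _; rewrite opprK addrC.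
rewrite -flip; apply: eq_bigr => n _.
rewrite rdotZ rdot_zpow// opprK wtN fcoefN// (complex_linear_zpow n hT).2.
rewrite rmorphM /= conjCK (_ : Num.conj (wt M n)%:C%C = (wt M n)%:C%C)//.
by rewrite conjE /= oppr0.
Qed.

Lemma hdot_phi f h : ufun f -> hdot (phi T f h) h = (rdot (phi T f h) h)%:C%C.
Proof.
move=> uf; apply: complex_eq => //=; rewrite Im_hdot.
have z M : rdot (fop T f M h) ('i%C *: h) = 0.
  have := fop_selfadjoint M h ('i%C *: h) (ufun_bfun uf).
  have ci : Num.conj 'i%C = - 'i%C :> R[i].
    by rewrite conjE; apply: complex_eq; rewrite /= ?oppr0.
  have := rdotZJ 'i%C (fop T f M h) h; rewrite ci scaleNr rdotNl.
  by rewrite (fopZ hT) (rdotC h); lra.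
apply/eqP; rewrite eq_le; apply/andP; split.
  by apply: (rdot_lim_le (n0 := 0) (phi_cvg hT hac uf)) => M _; rewrite z.
rewrite -oppr_le0 -rdotNr.
by apply: (rdot_lim_le (n0 := 0) (phi_cvg hT hac uf)) => M _; rewrite rdotNr z oppr0.
Qed.

(** The factor 1/2 absorbs the 1/4 of the polarization identity into the
    vectors, so that it holds with the weights [i^j] required by
    [cmeasure_integral]. *)
Definition polar h k (j : nat) : H := (2^-1 : R)%:C%C *: (h + 'i ^+ j *: k).

Lemma polarization (A : H -> H) h k : complex_linear A ->
  \sum_(j < 4) 'i ^+ j * hdot (A (polar h k j)) (polar h k j) = hdot (A h) k.
Proof.
move=> [D Z].
rewrite !big_ord_recl big_ord0 /= -complexiE.
rewrite (_ : bump 0 0 = 1%N)// (_ : bump 0 1 = 2%N)// (_ : bump 0 2 = 3%N)//.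
have i3 : 'i%C ^+ 3 = - 'i%C :> R[i] by rewrite exprS sqr_i mulrN1.
rewrite /polar -complexiE expr0 expr1 sqr_i i3.
rewrite !(Z, D) !(dotZl, dotZr) !(dotDl, dotDr) !(dotZl, dotZr).
have c2 : Num.conj (2^-1 : R)%:C%C = (2^-1 : R)%:C%C by rewrite conjE /= oppr0.
have ci : Num.conj 'i%C = - 'i%C :> R[i].
  by rewrite conjE; apply: complex_eq; rewrite /= ?oppr0.
rewrite !rmorphN /= !ci c2 rmorph1.
move: (hdot (A h) h) (hdot (A h) k) (hdot (A k) h) (hdot (A k) k) => x y z w.
have four : (2^-1 : R)%:C%C * (2^-1 : R)%:C%C *+ 4 = 1 :> R[i].
  by apply: complex_eq; rewrite /= ?mulr0 ?mul0r ?subr0 ?addr0 ?mulr0n //; field.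
have ii : 'i%C * 'i%C = -1 :> R[i] by rewrite -expr2 sqr_i.
move: four ii; set c := (2^-1)%:C%C; set i := 'i%C => four ii.
transitivity (y * (c * c *+ 4) + (1 + i * i) * (c * c *+ 2) * (z - y)); first by ring.
by rewrite four ii subrr !mul0r addr0 mulr1.
Qed.

End SpectralMeasureExists.

(** * Absolute continuity from polynomial estimates *)

Section SpectralMeasureConclusion.
Context {R : realType} {H : hilbertType R}.
Variable T : H -> H.
Hypotheses (hT : linear_contraction T) (hac : forall h, acont T h).
Implicit Types (S : set (borel_circle R)) (h k : H).

Lemma nu_trig h (m : {finite_measure set (borel_circle R) -> \bar R}) p :
  (forall S, measurable S -> m S = (rdot (phi T \1_S h) h)%:E) ->
  Rintegral m setT (fun z => Re (trig p (cval z))) = trig_form (zpow_op T) p h.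
Proof.
move=> hm; have finm : (m setT < +oo)%E by rewrite ltey_eq fin_num_measure.
have [_ ->] := @Rintegral_trig R _ _ m id (@measurable_id _ _ setT) setT measurableT finm p.
apply: eq_bigr => x _.
by have [-> ->] := nu_moments hT hac x.1 hm; rewrite /rdot dotZl Re_mul.
Qed.

Lemma nu_trig_poly h (m : {finite_measure set (borel_circle R) -> \bar R}) N a :
  (forall S, measurable S -> m S = (rdot (phi T \1_S h) h)%:E) ->
  (Rintegral m setT (fun z => Re (trig_poly N a z)) +i*
   Rintegral m setT (fun z => Im (trig_poly N a z)))%C = hdot (trig_poly_op N a T h) h.
Proof.
move=> hm.
pose p (b : R[i]) : seq (int * R[i]) :=
  [seq (j%:Z - N%:Z, b * a (j%:Z - N%:Z)) | j : 'I_N.*2.+1].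
have tp b z : trig (p b) (cval z) = b * trig_poly N a z.
  rewrite /trig big_map big_enum mulr_sumr; apply: eq_bigr => j _.
  by rewrite -mulrA.
have tf b : trig_form (zpow_op T) (p b) h = Re (b * hdot (trig_poly_op N a T h) h).
  rewrite -dotZl -/(rdot _ _) scaler_sumr rdot_suml /trig_form big_map big_enum.
  by apply: eq_bigr => j _; rewrite scalerA.
have I b := nu_trig (p b) hm.
apply: complex_eq => /=.
  by have := I 1; rewrite tf mul1r => <-; apply: eq_Rintegral => z _; rewrite tp mul1r.
have := I (- 'i%C); rewrite tf Re_mul /= oppr0 mul0r mulN1r sub0r opprK => <-.
by apply: eq_Rintegral => z _; rewrite tp Re_mul /= oppr0 mul0r mulN1r sub0r opprK.
Qed.

Lemma complex_linear_trig_poly_op N a : complex_linear (trig_poly_op N a T).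
Proof.
split=> [x y|b x].
  rewrite -big_split; apply: eq_bigr => j _.
  by rewrite (complex_linear_zpow _ hT).1 scalerDr.
rewrite scaler_sumr; apply: eq_bigr => j _.
by rewrite (complex_linear_zpow _ hT).2 !scalerA mulrC.
Qed.

(** [F S] is the value of the functional calculus at the indicator of [S]. The
    four positive measures that decompose [<F h, k>] are the measures of [F] at
    the polarization vectors of [h] and [k]. *)
Lemma acont_absolutely_continuous : absolutely_continuous_op T.
Proof.
have cl S : measurable S -> complex_linear (phi T \1_S).
  move=> mS; have uS := ufun_indic mS.
  by split=> [x y|a x]; [exact: phiD|exact: phiZ].
have Fex S : exists B : {linear H -> H}, measurable S -> forall h, B h = phi T \1_S h.
  have [mS|mS] := pselect (measurable S); first by have [B hB] := linear_pack (cl S mS); exists B.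
  by have [B _] := @linear_pack R H id (conj (fun _ _ => erefl) (fun _ _ => erefl)); exists B.
have [F hF] := choice Fex.
exists F; last by move=> S mS S0 h; rewrite hF// phi_null// -arc_lengthE.
have pos h (m : {finite_measure set (borel_circle R) -> \bar R}) :
    (forall S, measurable S -> m S = (rdot (phi T \1_S h) h)%:E) ->
    forall S, measurable S -> hdot (F S h) h = (fine (m S))%:C%C.
  by move=> hm S mS; rewrite hF// hm// (hdot_phi hT hac)//; exact: ufun_indic.
split.
  split=> [S mS|h].
    apply: bounded_op_sq => x; rewrite hF//.
    have := phi_bound hT hac x (ufun_indic mS); have := sq_ge0 x; lra.
  by have [m hm] := nu_measure hT hac h; exists m; exact: pos.
move=> N a h k.
have [m hm] := choice (fun j : 'I_4 => nu_measure hT hac (polar h k j)).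
exists m; split=> [S mS|].
  have lF : complex_linear (F S) by split=> [x y|b x]; [exact: linearD|exact: linearZ].
  rewrite -(polarization h k lF); apply: eq_bigr => j _.
  by rewrite (pos _ _ (hm j)).
rewrite -(polarization h k (complex_linear_trig_poly_op N a)); apply: eq_bigr => j _.
by rewrite (nu_trig_poly _ _ (hm j)).
Qed.

End SpectralMeasureConclusion.

Theorem theorem5p5 (R : realType) (H : hilbertType R) (T T' : {linear H -> H})
    (hT : contraction_op T) (hT' : contraction_op T')
    (hTT' : harnack_dominated T T') :
  (completely_nonunitary T -> completely_nonunitary T') /\
  (absolutely_continuous_op T <-> absolutely_continuous_op T') /\
  ((class_C0_ T <-> class_C0_ T') /\
   (class_C_0 T <-> class_C_0 T') /\
   (class_C00 T <-> class_C00 T')) /\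
  (strongly_convergent T <-> strongly_convergent T') /\
  (weakly_stable T <-> weakly_stable T') /\
  (weakly_convergent T <-> weakly_convergent T').
Proof.
have lT := contraction_linear hT; have lT' := contraction_linear hT'.
have aT := linear_contraction_adj lT; have aT' := linear_contraction_adj lT'.
have [c [c0 dom tdom]] := harnack_toeplitz lT lT' hTT'.
have adom := toeplitz_dominated_adj lT lT' dom.
have s1 := shadowed_dominated c0 lT lT' dom.
have s2 := shadowed_dominating c0 lT lT' dom.
have a1 := shadowed_dominated c0 aT aT' adom.
have a2 := shadowed_dominating c0 aT aT' adom.
have C0 : class_C0_ T <-> class_C0_ T'.
  by split; apply: shadowed_strongly_stable.
have C1 : class_C_0 T <-> class_C_0 T'.
  by split; apply: shadowed_strongly_stable.
split; first exact: completely_nonunitary_dominated dom.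
split.
  split=> haT; apply: acont_absolutely_continuous => // g.
    exact: acont_dominating c0 lT lT' dom (absolutely_continuous_acont g haT).
  exact: acont_dominated c0 (fun p => @tdom p g) (absolutely_continuous_acont g haT).
split; first by split=> //; split=> //; rewrite /class_C00 C0 C1.
split.
  rewrite -(strong_limit lT) -(strong_limit lT'); split; exact: shadowed_cauchy.
split; first by split; apply: shadowed_weakly_stable.
rewrite -(weak_limit lT) -(weak_limit lT'); split; exact: shadowed_weakly_cvg.
Qed.
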